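(* Let $r\ge 2$, let $p$ divide $r$, let $n\ge 1$ and let $k\ge 0$ be an integer. Then the irreducible modules of the centralizer algebra $\mathrm{End}_{G(r,p,n)}(V^{\otimes k})$ are indexed by the set $\Omega_k(r,p,n)$, and the irreducible modules of the centralizer algebra $\mathrm{End}_{L(r,p,n)}(V^{\otimes (k+\frac12)})$ are indexed by the set $\Omega_{k+\frac12}(r,p,n)$.
   Context: $r,p,n$ are positive integers, $p\mid r$, $m=r/p$, $r\ge 2$; $\zeta$ is a primitive $r$-th root of unity. $G(r,1,n)$ is the group of $n\times n$ generalized permutation matrices whose nonzero entries are $r$-th roots of unity; $G(r,p,n)$ is the subgroup of those for which the $m$-th power of the product of the nonzero entries is $1$; $L(r,p,n)$ is the subgroup of matrices in $G(r,p,n)$ with nonzero $(n,n)$-entry. $V=\mathbb C^n$ with standard basis $v_1,\dots,v_n$, and these groups act diagonally on $V^{\otimes k}$. $V^{\otimes(k+\frac12)}=V^{\otimes k}\otimes v_n$, regarded as an $L(r,p,n)$-module isomorphic to $V^{\otimes k}$ (restricted to $L(r,p,n)$) via $v\otimes v_n\leftrightarrow v$. $\mathcal Y(r,n)$: the set of $r$-tuples $\lambda=(\lambda_1,\dots,\lambda_r)$ of Young diagrams with $n$ boxes in total. Such a $\lambda$ is arranged as an $(m,p)$-necklace $\tilde\lambda$ with nodes $\tilde\lambda_{(i,j)}=\lambda_{(j-1)m+i}$, $1\le i\le m$, $1\le j\le p$ (component $i$, node $j$); $\tilde\lambda,\tilde\mu$ are equivalent if for some integer $t$, $\tilde\lambda_{(i,j)}=\tilde\mu_{(i,(j+t)\bmod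 p)}$ for all $i,j$ (indices mod $p$ taken in $\{1,\dots,p\}$). $\mathcal Y(m,p,n)$ is the set of $(m,p)$-necklaces with $n$ boxes up to equivalence. An $(n,i,j)$-colored necklace $\tilde\mu^{(n,i,j)}$ is a necklace $\tilde\mu$ with $n-1$ boxes in total together with the distinguished (colored) node $(i,j)$; two such, $\tilde\mu^{(n,i,j)}$ and $\tilde\nu^{(n,s,t)}$, are equivalent if $i=s$ and some simultaneous rotation $j\mapsto j+l$ of all components carries one to the other together with the colored node. $\mathcal Y^n(m,p,n-1)$ is the set of equivalence classes. $\delta_0:G(r,1,n)\to\mathbb C^*$ sends a matrix to the product of its nonzero entries; $C=\langle\delta_0^m\rangle$, cyclic of order $p$. With $\mathrm{sh}(\lambda_1,\dots,\lambda_r)=(\lambda_r,\lambda_1,\dots,\lambda_{r-1})$, the element $\delta_0^{m}$ acts on $\mathcal Y(r,n)$ by $\mathrm{sh}^m$ (rotation of necklaces), and $C_\lambda$ is the stabilizer of $\lambda$ in $C$; it depends only on the class of $\tilde\lambda$. The sets are defined recursively. $\Omega_0(r,p,n)=\{(\tilde\lambda,1)\}$ with $\lambda=((n),\emptyset,\dots,\emptyset)$. From $\Omega_k$ to $\Omega_{k+\frac12}$: $\Omega_{k+\frac12}(r,p,n)\subseteq\mathcal Y^n(m,p,n-1)$ consists of all $\tilde\mu^{(n,i,j)}$ where, for some $(\tilde\lambda,\delta)\in\Omega_k$, $\tilde\mu$ is obtained from $\tilde\lambda$ by deleting a box at an inner (removable) corner of $\tilde\lambda_{(i,j)}$. From $\Omega_{k+\frac12}$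 to $\Omega_{k+1}$: $\Omega_{k+1}(r,p,n)\subseteq\mathcal Y(m,p,n)\times C$ consists of all $(\tilde\nu,\delta)$ with $\delta\in C_\nu$, where, for some $\tilde\mu^{(n,i,j)}\in\Omega_{k+\frac12}$, $\tilde\nu$ is obtained from $\tilde\mu$ (color removed) by adding a box at an outer (addable) corner of node $(i+1,j)$ if $i\le m-1$, or of node $(1,(j+1)\bmod p)$ if $i=m$. *)

(* Defs.v *)
From HB Require Import structures.
From mathcomp Require Import all_boot all_order all_algebra.
From mathcomp Require Import boolp classical_sets reals complex mxtens.

Set Implicit Arguments.
Unset Strict Implicit.
Unset Printing Implicit Defensive.
Import Order.TTheory GRing.Theory Num.Theory.
Local Open Scope ring_scope.

Section Groups.
Variables (K : fieldType) (n : nat).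
Implicit Type g : 'M[K]_n.

Definition prod_nonzero g : K := \prod_i \prod_(j | g i j != 0) g i j.

Definition gen_perm_mx g : bool :=
  [forall i, #|[set j | g i j != 0]| == 1%N] &&
  [forall j, #|[set i | g i j != 0]| == 1%N].

Definition Gr1n (r : nat) g : bool :=
  gen_perm_mx g && [forall i, forall j, (g i j != 0) ==> (g i j ^+ r == 1)].

Definition Grpn (r p : nat) g : bool :=
  Gr1n r g && (prod_nonzero g ^+ (r %/ p) == 1).

Definition Lrpn (r p : nat) g : bool :=
  Grpn r p g && [forall i : 'I_n, (i.+1 == n) ==> (g i i != 0)].

End Groups.

(* With V = K^n, the space V^{(x) k} is K^(n^k) in its standard basis, and [g]
   acts on it diagonally, i.e. by the Kronecker power [g ^t k].  For a set [H]
   of matrices, [centralizer H k] is the ring End_H(V^{(x) k}).  As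
   V^{(x) (k + 1/2)} = V^{(x) k} (x) v_n is, as an L(r,p,n)-module, V^{(x) k}
   restricted to L(r,p,n), its centralizer is [centralizer (Lrpn r p) k]. *)
Section Centralizer.
Variables (K : fieldType) (n : nat) (H : pred 'M[K]_n) (k : nat).

Definition centralizing : {pred 'M[K]_(n ^ k)} := fun A =>
  `[< forall g : 'M[K]_n, H g -> A *m (g ^t k) = (g ^t k) *m A >].

Fact centralizing_subring_closed : subring_closed centralizing.
Proof.
split=> [|A B /asboolP cA /asboolP cB|A B /asboolP cA /asboolP cB];
    apply/asboolP => g Hg.
- by rewrite mul1mx mulmx1.
- by rewrite mulmxBl mulmxBr cA // cB.
- by rewrite -mulmxA cB // mulmxA cA // mulmxA.
Qed.

HB.instance Definition _ :=
  GRing.isSubringClosed.Build 'M[K]_(n ^ k) centralizing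
    centralizing_subring_closed.

Record centralizer := Centralizer {
  centralizer_val :> 'M[K]_(n ^ k);
  _ : centralizer_val \in centralizing }.

HB.instance Definition _ := [isSub for centralizer_val].
HB.instance Definition _ := [Choice of centralizer by <:].
HB.instance Definition _ :=
  GRing.SubChoice_isSubPzRing.Build 'M[K]_(n ^ k) centralizing centralizer
    centralizing_subring_closed.

End Centralizer.

(* The scalars of K sit inside [centralizer H k] as scalar matrices, so a module
   over the K-algebra is the same thing as a module over the underlying ring. *)
Section Modules.
Variable A : pzRingType.

(* Quantifying over boolean predicates loses no submodule: classical logic is
   available through [asbool]. *)
Definition irreducible_module (M : lmodType A) : Prop :=
  (exists x : M, x != 0) /\
  (forall N : {pred M}, submod_closed N ->
     (forall x, x \in N -> x = 0) \/ (forall x, x \in N)).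

Definition isomorphic_modules (M N : lmodType A) : Prop :=
  exists f : {linear M -> N}, bijective f.

Definition irreducibles_indexed_by (I : Type) (Omega : set I) : Prop :=
  exists S : I -> lmodType A,
    [/\ forall w, Omega w -> irreducible_module (S w),
        forall w w', Omega w -> Omega w' ->
          isomorphic_modules (S w) (S w') -> w = w'
      & forall M : lmodType A, irreducible_module M ->
          exists2 w, Omega w & isomorphic_modules M (S w)].

End Modules.

(* A Young diagram is the weakly decreasing sequence of its positive row lengths,
   and its rows are numbered from 0. *)

Definition is_young (s : seq nat) : bool := sorted geq s && (0%N \notin s).

Definition young := {s : seq nat | is_young s}.

Definition young0 : young := exist _ [::] isT.

Section Corners.
Implicit Type l : young.

Definition row_len l (a : nat) : nat := nth 0%N (val l) a.

Definition boxes l : nat := sumn (val l).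

Definition inner_corner l (a : nat) : bool := (row_len l a.+1 < row_len l a)%N.

Definition outer_corner l (a : nat) : bool :=
  (a == 0%N) || (row_len l a < row_len l a.-1)%N.

Definition delete_box l l' : Prop := exists2 a, inner_corner l a &
  forall b, row_len l' b = (row_len l b - (b == a))%N.

Definition add_box l l' : Prop := exists2 a, outer_corner l a &
  forall b, row_len l' b = (row_len l b + (b == a))%N.

End Corners.

Definition multi (r n : nat) :=
  {l : r.-tuple young | (\sum_(y <- l) boxes y == n)%N}.

(* Components and nodes are numbered from 0: [node m l i j] is the node
   (i+1, j+1) of the necklace of [l]. *)
Definition node (r n m : nat) (l : multi r n) (i j : nat) : young :=
  nth young0 (val l) (j * m + i).

Section Necklaces.
Variables (r p n : nat).
Let m := (r %/ p)%N.

Definition rotated (l l' : multi r n) (t : nat) : Prop :=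
  forall i j, (i < m)%N -> (j < p)%N ->
    node m l i j = node m l' i ((j + t) %% p).

Definition necklace_rel : rel (multi r n) := fun l l' =>
  `[< exists t, rotated l l' t >].

Definition colored := (multi r n * ('I_m * 'I_p))%type.

Definition colored_rel : rel colored := fun c c' =>
  `[< exists t, [/\ rotated c.1 c'.1 t, c.2.1 = c'.2.1
                  & c'.2.2 = (c.2.2 + t) %% p :> nat]%N >].

Fact rotated0 l : rotated l l 0.
Proof. by move=> i j _ jp; rewrite addn0 modn_small. Qed.

Fact rotatedN l l' t : rotated l l' t -> rotated l' l (t * p.-1).
Proof.
move=> h i j im jp; have p0 : (0 < p)%N by apply: leq_ltn_trans jp.
rewrite h ?ltn_mod // modnDml -addnA -mulnSr prednK //.
by rewrite addnC modnMDl modn_small.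
Qed.

Fact rotatedD l1 l2 l3 t u :
  rotated l1 l2 t -> rotated l2 l3 u -> rotated l1 l3 (t + u).
Proof.
move=> h h' i j im jp; have p0 : (0 < p)%N by apply: leq_ltn_trans jp.
by rewrite h // h' ?ltn_mod // modnDml addnA.
Qed.

Fact necklace_rel_equiv : equiv_class_of necklace_rel.
Proof.
split=> [l|l l'|l2 l1 l3].
- by apply/asboolP; exists 0%N; apply: rotated0.
- by apply/asboolP/asboolP=> -[t h]; exists (t * p.-1)%N; apply: rotatedN.
- move=> /asboolP[t h] /asboolP[u h']; apply/asboolP.
  by exists (t + u)%N; apply: rotatedD h h'.
Qed.

Fact colored_rel_equiv : equiv_class_of colored_rel.
Proof.
have sym c c' : colored_rel c c' -> colored_rel c' c.
  case: c c' => l [i j] [l' [i' j']] /asboolP[t [/= h -> e]].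
  apply/asboolP; exists (t * p.-1)%N; split=> //=; first exact: rotatedN.
  have p0 : (0 < p)%N by apply: leq_ltn_trans (ltn_ord j).
  by rewrite e modnDml -addnA -mulnS prednK // addnC modnMDl modn_small.
split=> [c|c c'|c2 c1 c3].
- apply/asboolP; exists 0%N; split=> //; first exact: rotated0.
  by rewrite addn0 modn_small.
- by apply/idP/idP; apply: sym.
- move=> /asboolP[t [h e1 e2]] /asboolP[u [h' e1' e2']]; apply/asboolP.
  exists (t + u)%N; split; first exact: rotatedD h h'.
    by rewrite e1.
  by rewrite e2' e2 modnDml addnA.
Qed.

Canonical necklace_equiv := EquivRelPack necklace_rel_equiv.
Canonical colored_equiv := EquivRelPack colored_rel_equiv.

Definition necklace := {eq_quot necklace_equiv}%qT.
Definition necklace_class (l : multi r n) : necklace := (\pi_necklace l)%qT.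

(* Y^(n+1)(m, p, n): here [n] is the number of boxes, without the color *)
Definition colored_necklace := {eq_quot colored_equiv}%qT.
Definition colored_class (l : multi r n) (c : 'I_m * 'I_p) : colored_necklace :=
  (\pi_colored_necklace (l, c))%qT.

Definition next_node (c : 'I_m * 'I_p) : 'I_m * 'I_p :=
  if (c.1.+1 < m)%N then (ordS c.1, c.2) else (ordS c.1, ordS c.2).

End Necklaces.

Definition change_node (r p n n' : nat) (R : young -> young -> Prop)
    (c : 'I_(r %/ p) * 'I_p) (l : multi r n) (l' : multi r n') : Prop :=
  forall d : 'I_(r %/ p) * 'I_p,
    let y := node (r %/ p) l d.1 d.2 in
    let y' := node (r %/ p) l' d.1 d.2 in
    if d == c then R y y' else y' = y.

Section Omega.
Variables (K : fieldType) (r p n : nat).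

Definition character := {g : 'M[K]_n | Gr1n r g} -> K.

Definition delta0 : character := fun g => prod_nonzero (val g).

(* [stabilizer l] is C_l: the t-th power of delta0 ^ m acts by sh ^ (m t), and
   sh is [rotr 1] on tuples. *)
Definition stabilizer (l : multi r n) : set character :=
  [set delta | exists2 t : nat,
     delta = (fun g => (delta0 g ^+ (r %/ p)) ^+ t)
   & iter t (iter (r %/ p) (rotr 1)) (val (val l)) = val (val l)].

Definition Omega_start : set (necklace r p n * character) :=
  [set x | exists2 l : multi r n,
     [seq val y | y <- val l] = [:: n] :: nseq r.-1 [::]
   & x = (necklace_class p l, fun=> 1)].

Definition step_delete (S : set (necklace r p n * character)) :
    set (colored_necklace r p n.-1) :=
  [set x | exists (l : multi r n) (delta : character) (mu : multi r n.-1) c,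
     [/\ S (necklace_class p l, delta),
         change_node delete_box c l mu
       & x = colored_class mu c]].

Definition step_add (S : set (colored_necklace r p n.-1)) :
    set (necklace r p n * character) :=
  [set x | exists (mu : multi r n.-1) c (nu : multi r n) (delta : character),
     [/\ S (colored_class mu c),
         change_node add_box (next_node c) mu nu,
         stabilizer nu delta
       & x = (necklace_class p nu, delta)]].

Fixpoint Omega (k : nat) : set (necklace r p n * character) :=
  if k is k'.+1 then step_add (step_delete (Omega k')) else Omega_start.

Definition Omega_half (k : nat) : set (colored_necklace r p n.-1) :=
  step_delete (Omega k).

End Omega.

(* Main.v *)
Require Import Defs.
From HB Require Import structures.
From mathcomp Require Import all_boot all_order all_fingroup all_algebra.
From mathcomp Require Import boolp classical_sets reals complex mxtens.
From mathcomp Require Import ring zify.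
From mathcomp Require cyclic cyclotomic separable.

Set Implicit Arguments.
Unset Strict Implicit.
Unset Printing Implicit Defensive.
Import Order.TTheory GRing.Theory Num.Theory.

(* Let X be the span of the standard multitableaux with n boxes, on which the
   adjacent transpositions act by Young's orthogonal form and the diagonal matrices
   by weights; as a G(r,1,n)-module X contains every irreducible module once.  If x
   and y are addable to the shape D, and y lies in the component following that of
   x, then the matrix unit of X that exchanges x and y in the last position, spread
   over the n positions of V by conjugation, maps the component of shape D + x into
   V (x) X with shape D + y.  Lagrange interpolation at the contents, which needs
   one more addable than removable box in each component, turns these maps into a
   resolution of the identity of V (x) X, so that by induction on k the shapes of
   the constituents of the k-th tensor power are those of the recursion.

   An operator on X commuting with G(r,p,n) relates a tableau only to its rotations
   by multiples of m, because the Jucys-Murphy contents and the diagonal weights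
   separate all others, and its entries are constant along the swaps connecting the
   tableaux of a shape.  Hence its blocks are spanned by rotations, and averaging
   them against the characters of the stabilizer of a shape gives primitive
   idempotents indexed by a necklace and a character.  For L(r,p,n) only the first
   n - 1 boxes can be swapped, so that the last box becomes the color and no
   stabilizer remains.

   The simple modules of a ring A are finally the A e, for idempotents e that are
   primitive in the strong sense that each nonzero a e has a left multiple equal to
   e, mutually orthogonal across A, and together generate A as an ideal. *)

(** The tensor power is handled through pairs [U], [Q] of maps between it and X, equivariant in the
    two directions, with [Q *m U] an idempotent [f] of the commutant of X. Then [U *m f *m Q] is an
    idempotent of the centralizer, and products of such elements reduce to maps on X, whose entries
    are read off tableau by tableau. Equivariance is tested on adjacent swaps and diagonal matrices.
    The parameter [h] counts the positions that may be swapped: [h = n] treats G(r,p,n) and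
    [h = n - 1] treats L(r,p,n) by the same lemmas. Young's form is taken orthogonal because
    symmetric matrices let a transpose turn an equivariant map into one of the opposite direction;
    the price is square roots. The next component appears because v_a has weight d_a, and moving the
    box at position a to the next component multiplies its weight by d_a. Interpolation has one
    condition per removable box and the normalization that the weights have sum 1, hence the count
    of corners. For L(r,p,n) the last box may move within its component without changing the
    isomorphism class, so the color records a component and not a box. *)

Module Import NecklaceIndexing.
Local Open Scope ring_scope.

(** * Modules over a ring with enough idempotents *)

Section SumOf.
Variable V : nmodType.

(** Serves both for the ideal generated by idempotents and for resolutions of the identity of a
    tensor power, with no index type to carry along. *)
Definition sum_of (P : V -> Prop) (v : V) : Prop :=
  exists s : seq V, (forall x, x \in s -> P x) /\ v = \sum_(x <- s) x.

Lemma sum_of_gen (P : V -> Prop) v : P v -> sum_of P v.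
Proof.
move=> Pv; exists [:: v]; rewrite big_seq1; split=> // x.
by rewrite inE => /eqP ->.
Qed.

Lemma sum_of0 (P : V -> Prop) : sum_of P 0.
Proof. by exists [::]; rewrite big_nil. Qed.

Lemma sum_ofD (P : V -> Prop) u v : sum_of P u -> sum_of P v -> sum_of P (u + v).
Proof.
move=> [s [Ps ->]] [t [Pt ->]]; exists (s ++ t); rewrite big_cat; split=> // x.
by rewrite mem_cat => /orP[/Ps|/Pt].
Qed.

Lemma sum_of_sum (P : V -> Prop) (I : eqType) (s : seq I) (Q : pred I) (F : I -> V) :
  (forall i, i \in s -> Q i -> sum_of P (F i)) -> sum_of P (\sum_(i <- s | Q i) F i).
Proof.
move=> h; rewrite big_seq_cond.
by elim/big_rec: _ => [|i v /andP[/h + Qi]]; [exact: sum_of0|move=> /(_ Qi); exact: sum_ofD].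
Qed.

End SumOf.

Section LeftIdeal.
Variables (A : pzRingType) (e : A).

(** For an idempotent [e] this is the left ideal A e; the fixed-point form is a boolean test that
    needs no witness [a] with x = a e. *)
Definition in_left_ideal : {pred A^o} := fun x => x * e == x.

Fact left_ideal_submod_closed : submod_closed in_left_ideal.
Proof.
split=> [|a x y /eqP xe /eqP ye]; rewrite unfold_in; first by rewrite mul0r.
by rewrite mulrDl ye [a *: x]/(a * x) -mulrA xe.
Qed.

HB.instance Definition _ :=
  GRing.isSubmodClosed.Build A A^o in_left_ideal left_ideal_submod_closed.

Record left_ideal := LeftIdeal {
  left_ideal_val :> A^o;
  _ : left_ideal_val \in in_left_ideal }.

HB.instance Definition _ := [isSub for left_ideal_val].
HB.instance Definition _ := [Choice of left_ideal by <:].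
HB.instance Definition _ := [SubChoice_isSubLmodule of left_ideal by <:].

Lemma left_ideal_mulr (x : left_ideal) : (val x : A) * e = val x.
Proof. by apply/eqP; have := valP x. Qed.

End LeftIdeal.

Lemma isomorphic_modules_sym (A : pzRingType) (M N : lmodType A) :
  isomorphic_modules M N -> isomorphic_modules N M.
Proof.
case=> f [g fK gK].
have lin : linear g.
  by move=> a x y; rewrite -{1}(gK x) -{1}(gK y) -linearP fK.
pose h : {linear N -> M} := HB.pack g (GRing.isLinear.Build _ _ _ _ _ lin).
by exists h; exists f.
Qed.

Lemma inj_surj_bijective (T U : choiceType) (f : T -> U) :
  injective f -> (forall y, exists x, f x = y) -> bijective f.
Proof.
move=> inj surj.
have surj' y : exists x, f x == y by have [x <-] := surj y; exists x.
exists (fun y => xchoose (surj' y)) => x.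
  by apply: inj; apply/eqP/(xchooseP (surj' (f x))).
exact/eqP/(xchooseP (surj' x)).
Qed.

(** A e is simple because each nonzero z = z e has [e] among its left multiples. A homomorphism from
    A [e w] to A [e w'] sends [e w] to some [e w * u * e w'], which is 0 when [w <> w']. A simple M
    is not killed by all the [e w], since they generate 1, and [e w *: m != 0] gives a nonzero
    homomorphism between simple modules. *)
Lemma irreducibles_of_idempotents (A : pzRingType) (I : Type) (Omega : set I)
    (e : I -> A) :
  (forall w, Omega w -> e w * e w = e w) ->
  (forall w, Omega w -> e w != 0) ->
  (forall w a, Omega w -> a * e w != 0 -> exists b, b * (a * e w) = e w) ->
  (forall w w' a, Omega w -> Omega w' -> w <> w' -> e w * a * e w' = 0) ->
  sum_of (fun u : A => exists w x y, Omega w /\ u = x * e w * y) 1 ->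
  irreducibles_indexed_by A Omega.
Proof.
move=> e_id e_neq0 e_inv e_orth [s [s_gen e_gen]].
have e_mem w : Omega w -> e w \in in_left_ideal (e w).
  by move=> /e_id ew; apply/eqP.
have irr w : Omega w -> irreducible_module (left_ideal (e w) : lmodType A).
  move=> Ow; split.
    by exists (LeftIdeal (e_mem w Ow)); rewrite -val_eqE /=; exact: e_neq0.
  move=> N' [N0 Nlin]; have [N1|/existsNP[z /not_implyP[zN /eqP z0]]] :=
    pselect (forall z, z \in N' -> z = 0); [by left|right=> u].
  have : (val z : A) * e w != 0.
    by rewrite left_ideal_mulr -(inj_eq val_inj) in z0 *.
  move=> /(e_inv w _ Ow)[b]; rewrite left_ideal_mulr => bz.
  suff -> : u = (val u * b : A) *: z + 0 by apply: Nlin.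
  apply: val_inj; rewrite addr0.
  transitivity ((val u : A) * b * (val z : A)) => //.
  by rewrite -(mulrA (val u : A)) bz left_ideal_mulr.
exists (fun w => left_ideal (e w) : lmodType A); split=> //.
  move=> w w' Ow Ow' [f [g fK _]]; apply: contrapT => ww'.
  have /negP[] := e_neq0 _ Ow.
  pose E : left_ideal (e w) := LeftIdeal (e_mem w Ow).
  have EE : E = (e w) *: E by apply: val_inj; rewrite /= -[LHS]e_id.
  suff /(congr1 g) : f E = 0.
    by rewrite fK -[X in g X](linear0 f) fK => /(congr1 val) /= ->.
  apply: val_inj; rewrite EE linearZ.
  transitivity (e w * (val (f E) : A)) => //.
  by rewrite -left_ideal_mulr (mulrA (e w)) e_orth.
move=> M [[m0 m0_neq0] Mirr].
have [w [Ow [m etm]]] : exists w, Omega w /\ exists m : M, e w *: m != 0.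
  apply: contrapT => H; move/eqP: m0_neq0; apply.
  rewrite -[m0]scale1r e_gen scaler_suml big_seq big1 // => u /s_gen.
  case=> w [x [y [Ow ->]]]; rewrite -!scalerA.
  case: (eqVneq (e w *: (y *: m0)) 0) => [->|ne]; first by rewrite scaler0.
  by case: H; exists w; split=> //; exists (y *: m0).
exists w => //.
apply: isomorphic_modules_sym.
pose F (z : left_ideal (e w)) : M := (val z : A) *: m.
have lin : linear F.
  by move=> a z1 z2; rewrite /F scalerA -scalerDl.
pose f : {linear left_ideal (e w) -> M} :=
  HB.pack F (GRing.isLinear.Build _ _ _ _ _ lin).
exists f; have [_ irrw] := irr w Ow.
pose E : left_ideal (e w) := LeftIdeal (e_mem w Ow).
apply: inj_surj_bijective.
  have [|ker0|kerT] := irrw (fun z => F z == 0).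
  - split; first by apply/eqP; rewrite /F /= scale0r.
    move=> a z1 z2 /eqP h1 /eqP h2; apply/eqP.
    by rewrite lin h1 h2 scaler0 addr0.
  - move=> z1 z2 /eqP; rewrite -subr_eq0 -linearB => /eqP/eqP h.
    by apply/eqP; rewrite -subr_eq0; apply/eqP/ker0.
  - by have := kerT E; rewrite unfold_in /F /= (negPf etm).
have [|ker0|kerT] := Mirr (fun u => `[< exists z, F z = u >]).
- split; first by apply/asboolP; exists 0; rewrite /F /= scale0r.
  move=> a _ _ /asboolP[z1 <-] /asboolP[z2 <-]; apply/asboolP.
  by exists (a *: z1 + z2); rewrite lin.
- have /negP[] := etm; rewrite (ker0 (e w *: m)) //; apply/asboolP.
  by exists E.
- by move=> u; have /asboolP := kerT u.
Qed.

(** * Young's orthogonal form for multitableaux *)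

Section FinMatrix.
Variable K : numClosedFieldType.

Definition mxf (I J : finType) (f : I -> J -> K) : 'M[K]_(#|I|, #|J|) :=
  \matrix_(i, j) f (enum_val i) (enum_val j).

Definition ent (I J : finType) (A : 'M[K]_(#|I|, #|J|)) (x : I) (y : J) : K :=
  A (enum_rank x) (enum_rank y).

Lemma ent_mxf (I J : finType) (f : I -> J -> K) x y : ent (mxf f) x y = f x y.
Proof. by rewrite /ent mxE !enum_rankK. Qed.

Lemma ent_inj (I J : finType) (A B : 'M[K]_(#|I|, #|J|)) :
  (forall x y, ent A x y = ent B x y) -> A = B.
Proof.
by move=> h; apply/matrixP=> i j; rewrite -(enum_valK i) -(enum_valK j) [LHS]h.
Qed.

Lemma ent_mul (I J L : finType) (A : 'M[K]_(#|I|, #|J|)) (B : 'M[K]_(#|J|, #|L|)) x y :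
  ent (A *m B) x y = \sum_z ent A x z * ent B z y.
Proof.
rewrite /ent mxE (reindex (@enum_rank J)) //.
by apply: onW_bij; exists enum_val; [exact: enum_rankK|exact: enum_valK].
Qed.

Lemma ent1 (I : finType) (x y : I) : ent (1%:M : 'M[K]_(#|I|)) x y = (x == y)%:R.
Proof. by rewrite /ent mxE (inj_eq enum_rank_inj). Qed.

Lemma entD (I J : finType) (A B : 'M[K]_(#|I|, #|J|)) x y :
  ent (A + B) x y = ent A x y + ent B x y.
Proof. by rewrite /ent mxE. Qed.

Lemma entZ (I J : finType) a (A : 'M[K]_(#|I|, #|J|)) x y : ent (a *: A) x y = a * ent A x y.
Proof. by rewrite /ent mxE. Qed.

Lemma ent0 (I J : finType) (x : I) (y : J) : ent (0 : 'M[K]_(#|I|, #|J|)) x y = 0.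
Proof. by rewrite /ent mxE. Qed.

Lemma ent_sum (I J : finType) (T : Type) (s : seq T) (P : pred T) (F : T -> 'M[K]_(#|I|, #|J|)) x y :
  ent (\sum_(t <- s | P t) F t) x y = \sum_(t <- s | P t) ent (F t) x y.
Proof. by rewrite /ent summxE. Qed.

Definition dgf (I : finType) (f : I -> K) : 'M[K]_#|I| := mxf (fun x y => f x * (x == y)%:R).

Lemma ent_dgf (I : finType) (f : I -> K) (x y : I) : ent (dgf f) x y = f x * (x == y)%:R.
Proof. exact: ent_mxf. Qed.

Lemma ent_dgf_mul (I J : finType) (f : I -> K) (A : 'M[K]_(#|I|, #|J|)) x y :
  ent (dgf f *m A) x y = f x * ent A x y.
Proof.
rewrite ent_mul (bigD1 x) //= big1 => [|z zx].
  by rewrite ent_dgf eqxx mulr1 addr0.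
by rewrite ent_dgf eq_sym (negPf zx) mulr0 mul0r.
Qed.

Lemma ent_mul_dgf (I J : finType) (f : I -> K) (A : 'M[K]_(#|J|, #|I|)) x y :
  ent (A *m dgf f) x y = ent A x y * f y.
Proof.
rewrite ent_mul (bigD1 y) //= big1 => [|z zx].
  by rewrite ent_dgf eqxx mulr1 addr0.
by rewrite ent_dgf (negPf zx) !mulr0.
Qed.

Lemma mxtrace_ent (I : finType) (A : 'M[K]_#|I|) : \tr A = \sum_x ent A x x.
Proof.
rewrite /mxtrace (reindex (@enum_rank I)) //.
by apply: onW_bij; exists enum_val; [exact: enum_rankK|exact: enum_valK].
Qed.

End FinMatrix.

Section Tableaux.
Variables (r n : nat).

(* A box is (component, (row, column)). *)
Definition box : Type := ('I_r * ('I_n * 'I_n))%type.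

Definition below (x y : box) : bool :=
  [&& x.1 == y.1, x.2.1 <= y.2.1 & x.2.2 <= y.2.2]%N.

(** [T i] is the box filled at step [i]. Rows and columns below n suffice for n boxes, so the
    tableaux form a finite type. *)
Definition tab := {ffun 'I_n -> box}.
Implicit Type T : tab.

(** A single condition makes the filled boxes a diagram at every step and the entries increasing:
    all that lies weakly above and to the left of a box is filled no later. *)
Definition std T : bool :=
  injectiveb T && [forall i, forall y, below y (T i) ==>
    [exists i' : 'I_n, (i' <= i)%N && (T i' == y)]].

Lemma below_trans : transitive below.
Proof.
move=> y x z /and3P[/eqP xy1 xy2 xy3] /and3P[/eqP yz1 yz2 yz3].
by rewrite /below xy1 yz1 eqxx (leq_trans xy2 yz2) (leq_trans xy3 yz3).
Qed.

Lemma stdP T : reflect (injective T /\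
    forall i y, below y (T i) -> exists2 i' : 'I_n, (i' <= i)%N & T i' = y) (std T).
Proof.
apply: (iffP andP) => -[].
  move=> /injectiveP inj /forallP h; split=> // i y yi.
  have /forallP/(_ y)/implyP/(_ yi)/existsP[i' /andP[ii' /eqP e]] := h i.
  by exists i'.
move=> inj h; split; first exact/injectiveP.
apply/forallP=> i; apply/forallP=> y; apply/implyP=> /h[i' ii' e].
by apply/existsP; exists i'; rewrite ii' e eqxx.
Qed.

Lemma std_inj T : std T -> injective T.
Proof. by case/stdP. Qed.

Lemma std_below T i i' : std T -> below (T i) (T i') -> (i <= i')%N.
Proof. by case/stdP=> inj h /h[k ki' /inj <-]. Qed.

Lemma std_down T i y : std T -> below y (T i) ->
  exists2 i' : 'I_n, (i' <= i)%N & T i' = y.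
Proof. by case/stdP=> inj h /h. Qed.

Definition sw (i i' : 'I_n) T : tab := [ffun k => T (tperm i i' k)].

Lemma swK i i' : involutive (sw i i').
Proof. by move=> T; apply/ffunP=> k; rewrite !ffunE tpermK. Qed.

Lemma sw_std (i i' : 'I_n) T : i' = i.+1 :> nat -> std T ->
  ~~ below (T i) (T i') -> std (sw i i' T).
Proof.
move=> ii' stdT nb; have [inj down] := stdP _ stdT.
have nii' : i != i' by rewrite -val_eqE /= ii' neq_ltn ltnSn.
apply/stdP; split=> [k l|k y]; rewrite !ffunE.
  by move=> /inj/perm_inj.
case: tpermP => [->|->|/eqP ki /eqP ki'] yb.
- have [k' k'i' Tk'] := down _ _ yb.
  have [e|k'i] := eqVneq k' i; first by rewrite -Tk' e (negPf nb) in yb.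
  have [e|k'ni'] := eqVneq k' i'.
    by exists i; rewrite // ffunE tpermL -Tk' e.
  exists k'; last by rewrite ffunE tpermD // eq_sym.
  by move: k'ni' k'i' k'i; rewrite -!val_eqE /= ii'; lia.
- have [k' k'i' Tk'] := down _ _ yb.
  have [e|k'i] := eqVneq k' i.
    by exists i'; rewrite // ffunE tpermR -Tk' e.
  exists k'; last first.
    rewrite ffunE tpermD // eq_sym //; move: k'i'; rewrite -val_eqE /=; lia.
  by rewrite ii'; lia.
have [k' k'k Tk'] := down _ _ yb.
have [e|k'i] := eqVneq k' i.
  exists i'; last by rewrite ffunE tpermR -Tk' e.
  by move: k'k ki ki'; rewrite e -!val_eqE /= ii'; lia.
have [e|k'i'] := eqVneq k' i'.
  exists i; last by rewrite ffunE tpermL -Tk' e.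
  by move: k'k ki ki'; rewrite e -!val_eqE /= ii'; lia.
by exists k' => //; rewrite ffunE tpermD // eq_sym.
Qed.

Definition same_ct (x y : box) : bool :=
  (x.2.2 + y.2.1 == y.2.2 + x.2.1)%N.

(* The boxes to the right of x and below x both lie strictly between two boxes
   x, y of the same diagonal. *)
Lemma diag_between T (i i' : 'I_n) : std T -> (T i).1 = (T i').1 ->
  same_ct (T i) (T i') -> i != i' -> ((i.+2 < i') || (i'.+2 < i))%N.
Proof.
move=> stdT; wlog : i i' / ((T i).2.1 <= (T i').2.1)%N => [H|].
  have [/H//|/ltnW h] := leqP (T i).2.1 (T i').2.1.
  by move=> c sc ii'; rewrite orbC H // 1?eq_sym // /same_ct eq_sym.
move=> rle ec sc ii'; apply/orP; left.
case Ei : (T i) => [c [a b]]; case Ei' : (T i') => [c' [a' b']].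
rewrite Ei Ei' /same_ct /= in rle ec sc; move/eqP: sc => sc.
have aa' : (a < a')%N.
  rewrite ltn_neqAle rle andbT; apply/eqP=> e; case/negP: ii'.
  apply/eqP/(std_inj stdT); rewrite Ei Ei' ec; congr (_, (_, _)); apply/val_inj.
    exact: e.
  by move/eqP: sc; rewrite e eqn_add2r => /eqP.
have bb' : (b < b')%N by lia.
have ha : (a.+1 < n)%N by apply: leq_ltn_trans (ltn_ord a').
have hb : (b.+1 < n)%N by apply: leq_ltn_trans (ltn_ord b').
pose z1 : box := (c, (Ordinal ha, b)); pose z2 : box := (c, (a, Ordinal hb)).
have [||k1 k1i' Tk1] := @std_down T i' z1 => //.
  by rewrite /below Ei' /= ec eqxx aa' ltnW.
have [||k2 k2i' Tk2] := @std_down T i' z2 => //.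
  by rewrite /below Ei' /= ec eqxx bb' ltnW.
have ik1 : (i <= k1)%N.
  by apply: (std_below stdT); rewrite Ei Tk1 /below /= eqxx leqnSn leqnn.
have ik2 : (i <= k2)%N.
  by apply: (std_below stdT); rewrite Ei Tk2 /below /= eqxx leqnSn leqnn.
have ne1 : i != k1.
  by apply/eqP=> e; move: Tk1; rewrite -e Ei => -[] /eqP; rewrite -val_eqE /=; lia.
have ne2 : i != k2.
  by apply/eqP=> e; move: Tk2; rewrite -e Ei => -[] /eqP; rewrite -val_eqE /=; lia.
have ne1' : k1 != i'.
  apply/eqP=> e; move: Tk1; rewrite e Ei' => -[_ _] /eqP.
  by rewrite -val_eqE /=; lia.
have ne2' : k2 != i'.
  apply/eqP=> e; move: Tk2; rewrite e Ei' => -[_] /eqP.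
  by rewrite -val_eqE /=; lia.
have ne12 : k1 != k2.
  by apply/eqP=> e; move: Tk1; rewrite e Tk2 => -[] /eqP; rewrite -val_eqE /=; lia.
move: ne1 ne2 ne1' ne2' ne12 ik1 ik2 k1i' k2i'.
rewrite -!val_eqE /=; lia.
Qed.

(** A box strictly between the two would have to be filled strictly between two consecutive steps,
    so comparable boxes filled in succession are neighbours. *)
Lemma below_adj T (i i' : 'I_n) : std T -> i' = i.+1 :> nat -> below (T i) (T i') ->
  ((T i').2.2 == (T i).2.2.+1 :> nat) && ((T i').2.1 == (T i).2.1 :> nat)
  || ((T i').2.2 == (T i).2.2 :> nat) && ((T i').2.1 == (T i).2.1.+1 :> nat).
Proof.
move=> stdT ii'; case Ei : (T i) => [c [a b]]; case Ei' : (T i') => [c' [a' b']].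
rewrite /below /= => /and3P[/eqP ec aa' bb'].
have between z : below (T i) z -> below z (T i') -> z = T i \/ z = T i'.
  move=> /[swap] /(std_down stdT)[k ki' <-] /(std_below stdT) ik.
  have [->|ki] := eqVneq k i; first by left.
  right; congr (T _); apply/val_inj/eqP; rewrite /= ii'.
  by move: ki ki' ik; rewrite -val_eqE /= ii'; lia.
have [e|nb] := eqVneq (b : nat) b'.
  have ne : (a : nat) != a'.
    apply/eqP=> e'; have : T i = T i'.
      by rewrite Ei Ei' ec; congr (_, (_, _)); apply/val_inj.
    by move/(std_inj stdT)/eqP; rewrite -val_eqE /= ii'; lia.
  have ha : (a.+1 < n)%N by apply: leq_ltn_trans (ltn_ord a'); lia.
  have [|||] := between (c, (Ordinal ha, b)); rewrite ?Ei ?Ei' /below /= ?ec ?eqxx /=.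
  - by rewrite leqnSn leqnn.
  - by rewrite bb' andbT; lia.
  - by move=> -[] /eqP; rewrite -val_eqE /=; lia.
  - by move=> -[<- <-] /=; rewrite !eqxx orbT.
have hb : (b.+1 < n)%N by apply: leq_ltn_trans (ltn_ord b'); lia.
have [|||] := between (c, (a, Ordinal hb)); rewrite ?Ei ?Ei' /below /= ?ec ?eqxx /=.
- by rewrite leqnSn leqnn.
- by rewrite aa' /=; lia.
- by move=> -[] /eqP; rewrite -val_eqE /=; lia.
- by move=> -[<- <-] /=; rewrite !eqxx.
Qed.

End Tableaux.

Section YoungForm.
Variables (K : numClosedFieldType) (r n : nat).
Local Notation box := (box r n).
Local Notation tab := (tab r n).
Implicit Types (x y z : box) (T : tab) (i : 'I_n).

Definition ct x : K := x.2.2%:R - x.2.1%:R.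

Lemma ct_eq x y : (ct x == ct y) = same_ct x y.
Proof.
by rewrite /ct subr_eq addrAC eq_sym subr_eq -!natrD eqr_nat eq_sym.
Qed.

(** The diagonal coefficient of Young's form is the inverse axial distance. The value 0 across
    components makes [coaxial] equal to 1 there, so that the swap becomes a plain permutation. *)
Definition axial x y : K := if x.1 == y.1 then (ct y - ct x)^-1 else 0.

Definition coaxial x y : K := sqrtC (1 - axial x y ^+ 2).

Lemma axialC x y : axial y x = - axial x y.
Proof.
rewrite /axial eq_sym; case: eqP => _; last by rewrite oppr0.
by rewrite -opprB invrN.
Qed.

Lemma coaxialC x y : coaxial y x = coaxial x y.
Proof. by rewrite /coaxial axialC sqrrN. Qed.

Lemma coaxial_sqr x y : coaxial x y ^+ 2 = 1 - axial x y ^+ 2.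
Proof. exact: sqrtCK. Qed.

(* Uniform version of 1/(z - x) = 1/((y - x) + (z - y)), also valid when the
   boxes lie in different components. *)
Lemma axial_triple x y z :
  (x.1 = y.1 -> ~~ same_ct x y) -> (y.1 = z.1 -> ~~ same_ct y z) ->
  (x.1 = z.1 -> ~~ same_ct x z) ->
  axial x y * axial y z = axial x z * (axial x y + axial y z).
Proof.
rewrite /axial -!ct_eq; case: (eqVneq x.1 y.1) => [->|xy]; last first.
  case: (eqVneq y.1 z.1) => [<-|yz]; last by rewrite mul0r addr0 mulr0.
  by rewrite (negPf xy) !mul0r.
case: (eqVneq y.1 z.1) => [ec|_]; last by rewrite mulr0 mul0r.
move=> /(_ erefl) xy /(_ ec) yz /(_ ec) xz.
have {}xy : ct y - ct x != 0 by rewrite subr_eq0 eq_sym.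
have {}yz : ct z - ct y != 0 by rewrite subr_eq0 eq_sym.
have {}xz : ct z - ct x != 0 by rewrite subr_eq0 eq_sym.
by field; rewrite xy yz xz.
Qed.

Definition stab : finType := {T : tab | std T}.

Lemma std_adj_ct T i i' : i' = i.+1 :> nat -> std T ->
  (T i).1 = (T i').1 -> ~~ same_ct (T i) (T i').
Proof.
move=> ii' stdT ec; apply/negP=> sc.
have := diag_between stdT ec sc; rewrite -val_eqE /= ii'; lia.
Qed.

Lemma std_adj2_ct T i i' : i' = i.+2 :> nat -> std T ->
  (T i).1 = (T i').1 -> ~~ same_ct (T i) (T i').
Proof.
move=> ii' stdT ec; apply/negP=> sc.
have := diag_between stdT ec sc; rewrite -val_eqE /= ii'; lia.
Qed.

(** Such boxes are neighbours, hence at axial distance 1 or -1. This is what keeps Young's form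
    inside the span of the standard tableaux. *)
Lemma coaxial_below T i i' : i' = i.+1 :> nat -> std T ->
  below (T i) (T i') -> coaxial (T i) (T i') = 0.
Proof.
move=> ii' stdT b; apply/eqP; rewrite -sqrf_eq0 coaxial_sqr subr_eq0.
have /and3P[ec _ _] := b; rewrite /axial ec /ct.
have /orP[] := below_adj stdT ii' b => /andP[/eqP -> /eqP ->].
  by rewrite [X in X^-1](_ : _ = 1) ?invr1 ?expr1n // -natr1; ring.
by rewrite [X in X^-1](_ : _ = -1) ?invrN1 ?sqrrN ?expr1n // -natr1; ring.
Qed.

Lemma coaxial_std T i i' : i' = i.+1 :> nat -> std T ->
  coaxial (T i) (T i') != 0 -> std (sw i i' T).
Proof.
move=> ii' stdT nz; apply: sw_std => //; apply: contra nz => b.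
by rewrite coaxial_below.
Qed.

(* Entries are extended by 0 to the rows of nonstandard tableaux, so that [sw]
   may be applied freely. *)
Definition rent (J : finType) (B : 'M[K]_(#|stab|, #|J|)) T (u : J) : K :=
  if insub T is Some U then ent B U u else 0.

Lemma rentE (J : finType) (B : 'M[K]_(#|stab|, #|J|)) (S : stab) u :
  rent B (val S) u = ent B S u.
Proof. by rewrite /rent valK. Qed.

Lemma rent_nstd (J : finType) (B : 'M[K]_(#|stab|, #|J|)) T u :
  ~~ std T -> rent B T u = 0.
Proof. by move=> nT; rewrite /rent insubN. Qed.

Lemma rent_inj (J : finType) (A B : 'M[K]_(#|stab|, #|J|)) :
  (forall T u, std T -> rent A T u = rent B T u) -> A = B.
Proof. by move=> h; apply: ent_inj => S u; rewrite -!rentE h //; exact: valP. Qed.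

(* Young's orthogonal form of the transposition of the positions i and i'. *)
Definition Ym (i i' : 'I_n) : 'M[K]_#|stab| :=
  mxf (fun T U : stab => axial (val T i) (val T i') * (T == U)%:R
     + coaxial (val T i) (val T i') * (sw i i' (val T) == val U)%:R).

(** Also valid for nonstandard [T], where both sides are 0: if [sw i i' T] is standard, its
    coefficient must vanish, for otherwise swapping back would make [T] standard. Products of
    several [Ym] can thus be expanded without side conditions. *)
Lemma rent_Ym (J : finType) (B : 'M[K]_(#|stab|, #|J|)) i i' T u :
  i' = i.+1 :> nat ->
  rent (Ym i i' *m B) T u = axial (T i) (T i') * rent B T u
    + coaxial (T i) (T i') * rent B (sw i i' T) u.
Proof.
move=> ii'; have [stdT|nT] := boolP (std T); last first.
  rewrite !(rent_nstd _ _ nT) mulr0 add0r.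
  have [stdT'|nT'] := boolP (std (sw i i' T)); last by rewrite rent_nstd ?mulr0.
  have [->|nz] := eqVneq (coaxial (T i) (T i')) 0; first by rewrite mul0r.
  case/negP: nT; rewrite -(swK i i' T); apply: coaxial_std => //.
  by rewrite !ffunE tpermL tpermR coaxialC.
pose S : stab := exist _ T stdT; rewrite -[T]/(val S) !rentE ent_mul.
under eq_bigr => z _ do rewrite ent_mxf mulrDl -!mulrA.
rewrite big_split /= -!mulr_sumr; congr (_ * _ + _ * _).
  rewrite (bigD1 S) //= eqxx mul1r big1 ?addr0 // => z zS.
  by rewrite eq_sym (negPf zS) mul0r.
have [stdT'|nT'] := boolP (std (sw i i' T)); last first.
  rewrite rent_nstd // big1 // => z _; case: eqP => [e|_]; last by rewrite mul0r.
  by case/negP: nT'; rewrite e; exact: valP.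
pose S' : stab := exist _ (sw i i' T) stdT'; rewrite -[sw i i' T]/(val S') rentE.
rewrite (bigD1 S') //= eqxx mul1r big1 ?addr0 // => z zS.
by rewrite -[sw i i' T]/(val S') eq_sym (inj_eq val_inj) (negPf zS) mul0r.
Qed.

Lemma Ym_tr i i' : (Ym i i')^T = Ym i i'.
Proof.
apply: ent_inj => T U; rewrite /ent mxE -/(ent _ U T) -/(ent _ T U) !ent_mxf.
have e : (sw i i' (val U) == val T) = (sw i i' (val T) == val U).
  by apply/eqP/eqP=> <-; rewrite swK.
rewrite e [U == T]eq_sym; congr (_ + _).
  by case: eqP => [->|_] //; rewrite !mulr0.
case: eqP => [<-|]; last by rewrite !mulr0.
by rewrite !ffunE tpermL tpermR coaxialC.
Qed.

Lemma YmK i i' : i' = i.+1 :> nat -> Ym i i' *m Ym i i' = 1%:M.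
Proof.
move=> ii'; rewrite -[in LHS](mulmx1 (Ym i i' *m _)) -mulmxA.
apply: rent_inj => T u _; rewrite !rent_Ym // swK !ffunE tpermL tpermR.
rewrite (coaxialC (T i) (T i')) (axialC (T i) (T i')) [X in X = _](_ : _ =
  (axial (T i) (T i') ^+ 2 + coaxial (T i) (T i') ^+ 2) * rent 1%:M T u); last by ring.
by rewrite coaxial_sqr addrC subrK mul1r.
Qed.

Lemma Ym_far i i' (l l' : 'I_n) : i' = i.+1 :> nat -> l' = l.+1 :> nat ->
  (i' < l)%N -> Ym i i' *m Ym l l' = Ym l l' *m Ym i i'.
Proof.
move=> ii' ll' il; rewrite -[in LHS](mulmx1 (_ *m _)) -[in RHS](mulmx1 (_ *m _)).
rewrite -!mulmxA; apply: rent_inj => T u _; rewrite !(rent_Ym _ _ _ ii') !(rent_Ym _ _ _ ll') !(rent_Ym _ _ _ ii') !ffunE.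
have [n1 n2 n3 n4] : [/\ i != l, i != l', i' != l & i' != l'].
  by rewrite -!val_eqE /= ll' ii'; split; lia.
rewrite !(tpermD n1 n3) !(tpermD n2 n4).
have [m1 m2 m3 m4] : [/\ l != i, l != i', l' != i & l' != i'].
  by rewrite ![l == _]eq_sym ![l' == _]eq_sym.
rewrite !(tpermD m1 m3) !(tpermD m2 m4).
have -> : sw l l' (sw i i' T) = sw i i' (sw l l' T).
  apply/ffunP=> k; rewrite !ffunE; congr (T _).
  case: (tpermP l l' k) => [->|->|/eqP kl /eqP kl'].
  - by rewrite !(tpermD n1 n3) !(tpermD n2 n4) tpermL.
  - by rewrite !(tpermD n1 n3) !(tpermD n2 n4) tpermR.
  case: (tpermP i i' k) => [_|_|_ _]; rewrite ?(tpermD m1 m3) ?(tpermD m2 m4) //.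
  by rewrite tpermD // eq_sym.
move: (rent _ T u) (rent _ (sw i i' T) u) (rent _ (sw l l' T) u).
move: (rent _ _ _) (axial _ _) (coaxial _ _) (axial _ _) (coaxial _ _).
by move=> *; ring.
Qed.

(** Both sides expand over the tableaux reached from [T] by swaps. The terms of the longest word
    agree because the transpositions satisfy the braid relation; the others reduce to [axial_triple]
    and to the orthogonality relations. *)
Lemma Ym_braid (i1 i2 i3 : 'I_n) : i2 = i1.+1 :> nat -> i3 = i2.+1 :> nat ->
  Ym i1 i2 *m Ym i2 i3 *m Ym i1 i2 = Ym i2 i3 *m Ym i1 i2 *m Ym i2 i3.
Proof.
move=> h2 h3; rewrite -[in LHS](mulmx1 (_ *m _)) -[in RHS](mulmx1 (_ *m _)).
rewrite -!mulmxA; apply: rent_inj => T u stdT.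
rewrite !(rent_Ym _ _ _ h2) !(rent_Ym _ _ _ h3) !(rent_Ym _ _ _ h2) !(rent_Ym _ _ _ h3).
rewrite !ffunE.
have n12 : i1 != i2 by rewrite -val_eqE /= h2; lia.
have n23 : i2 != i3 by rewrite -val_eqE /= h3; lia.
have n13 : i1 != i3 by rewrite -val_eqE /= h3 h2; lia.
have n21 := n12; have n32 := n23; have n31 := n13.
rewrite eq_sym in n21; rewrite eq_sym in n32; rewrite eq_sym in n31.
have p1 : tperm i1 i2 i3 = i3 by rewrite tpermD.
have p2 : tperm i2 i3 i1 = i1 by rewrite tpermD.
rewrite !(tpermL, tpermR, p1, p2).
have e : sw i1 i2 (sw i2 i3 (sw i1 i2 T)) = sw i2 i3 (sw i1 i2 (sw i2 i3 T)).
  apply/ffunP=> k; rewrite !ffunE; congr (T _).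
  have [->|k1] := eqVneq k i1; first by rewrite !(tpermL, tpermR, p1, p2).
  have [->|k2] := eqVneq k i2; first by rewrite !(tpermL, tpermR, p1, p2).
  have [->|k3] := eqVneq k i3; first by rewrite !(tpermL, tpermR, p1, p2).
  by rewrite !(@tpermD _ i1 i2 k, @tpermD _ i2 i3 k) // eq_sym.
rewrite e !swK.
have := @axial_triple (T i1) (T i2) (T i3) (std_adj_ct h2 stdT)
  (std_adj_ct h3 stdT) (std_adj2_ct _ stdT).
rewrite h3 h2 => /(_ erefl) h.
rewrite (axialC (T i1) (T i2)) (axialC (T i2) (T i3)).
rewrite (coaxialC (T i1) (T i2)) (coaxialC (T i2) (T i3)).
have s12 := coaxial_sqr (T i1) (T i2); have s23 := coaxial_sqr (T i2) (T i3).
move: s12 s23 h.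
move: (rent _ T u) (rent _ (sw i1 i2 T) u) (rent _ (sw i2 i3 T) u).
move: (rent _ (sw i1 i2 (sw i2 i3 T)) u) (rent _ (sw i2 i3 (sw i1 i2 T)) u).
move: (rent _ _ _) (axial (T i1) (T i2)) (axial (T i2) (T i3)) (axial (T i1) (T i3)).
move: (coaxial (T i1) (T i2)) (coaxial (T i2) (T i3)) (coaxial (T i1) (T i3)).
move=> a b c f0 A B C f1 f2 f3 f4 f5 a2 b2 h; apply/eqP; rewrite -subr_eq0; apply/eqP.
(* The difference of the two sides as an explicit combination of the relation of the three axial
   coefficients and of the two relations [a ^+ 2 = 1 - A ^+ 2], [b ^+ 2 = 1 - B ^+ 2]. *)
transitivity ((A * B - C * (A + B)) * ((A - B) * f3 + a * f4 - b * f5)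
  + f3 * C * (a ^+ 2 - (1 - A ^+ 2)) - f3 * C * (b ^+ 2 - (1 - B ^+ 2))); first by ring.
by rewrite h a2 b2 !subrr mul0r mulr0 subr0 addr0.
Qed.

End YoungForm.

(** * Connecting the tableaux of a shape by adjacent swaps *)

Section Connectivity.
Variables r n : nat.
Local Notation tab := (tab r n).
Implicit Types (T U : tab) (i : 'I_n).

Definition initial h T : {set box r n} := [set T i | i in [pred i : 'I_n | (i < h)%N]].

Lemma initialP h T x :
  reflect (exists2 i : 'I_n, (i < h)%N & T i = x) (x \in initial h T).
Proof.
apply: (iffP imsetP) => [[i ih ->]|[i ih <-]]; first by exists i.
by exists i.
Qed.

Lemma mem_initial h T i : (i < h)%N -> T i \in initial h T.
Proof. by move=> ih; apply/initialP; exists i. Qed.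

Lemma mem_initial_inj h T i : injective T -> (T i \in initial h T) = (i < h)%N.
Proof.
move=> inj; apply/idP/idP=> [/initialP[k kh /inj <-] //|]; exact: mem_initial.
Qed.

Lemma initial_sw h T (i i' : 'I_n) : (i < h)%N -> (i' < h)%N ->
  initial h (sw i i' T) = initial h T.
Proof.
have sub U : (i < h)%N -> (i' < h)%N -> {subset initial h (sw i i' U) <= initial h U}.
  move=> ih i'h x /initialP[k kh <-]; rewrite ffunE; apply: mem_initial.
  by case: tpermP.
move=> ih i'h; apply/setP=> x; apply/idP/idP; first exact: sub.
by move=> h'; apply: sub; rewrite // swK.
Qed.

Lemma initialS T (i : 'I_n) : initial i.+1 T = T i |: initial i T.
Proof.
apply/setP=> x; rewrite in_setU1; apply/initialP/orP=> [[k]|[/eqP ->|/initialP[k kh <-]]].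
- rewrite ltnS leq_eqVlt => /orP[/eqP/val_inj -> ->|ki <-]; first by left.
  by right; apply: mem_initial.
- by exists i.
- by exists k => //; rewrite ltnS ltnW.
Qed.

Lemma initialSD T (i : 'I_n) : injective T -> initial i T = initial i.+1 T :\ T i.
Proof.
by move=> inj; rewrite initialS setU1K // mem_initial_inj // ltnn.
Qed.

Section Connect.
Variables (Q : tab -> Prop).

Definition swap_stable h := forall T (i i' : 'I_n), i' = i.+1 :> nat ->
  (i' < h)%N -> std T -> std (sw i i' T) -> Q T -> Q (sw i i' T).

(** The box [U l] is carried from position [k] up to [l]. Each swap stays standard: [U l] is the
    last box of [U] among these, hence [below] none of the others. *)
Lemma std_bubble T U (l k : 'I_n) : swap_stable l.+1 -> std T -> std U ->
  initial l.+1 T = initial l.+1 U -> (k <= l)%N -> T k = U l -> Q T ->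
  exists T', [/\ std T', Q T', T' l = U l, initial l.+1 T' = initial l.+1 U
    & forall i, (l < i)%N -> T' i = T i].
Proof.
move=> stab stdT stdU; move: {2}(l - k)%N (erefl (l - k)%N) => q.
elim: q T k stdT => [|q IH] T k stdT eq e kl Tk QT.
  have {}kl : k = l by apply/val_inj/eqP; rewrite eqn_leq kl /=; lia.
  by exists T; rewrite -kl in e Tk *; split.
have k1n : (k.+1 < n)%N by apply: leq_ltn_trans (ltn_ord l); lia.
pose k' := Ordinal k1n.
have k'l : (k' <= l)%N by rewrite /=; lia.
have sT : std (sw k k' T).
  apply: sw_std => //; rewrite Tk; apply/negP=> b.
  have /initialP[j jl Tj] : T k' \in initial l.+1 U by rewrite -e mem_initial.
  rewrite -Tj in b; have lj := std_below stdU b.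
  have jl' : j = l by apply/val_inj/eqP; rewrite eqn_leq lj -ltnS jl.
  move: Tj; rewrite jl' -Tk => /(std_inj stdT)/eqP; rewrite -val_eqE /=; lia.
have [|||||T' [h1 h2 h3 h4 h5]] := IH (sw k k' T) k' sT.
- by rewrite /=; lia.
- by rewrite initial_sw // /=; lia.
- by [].
- by rewrite ffunE tpermR.
- exact: stab.
exists T'; split=> // i li; rewrite h5 // ffunE tpermD // -val_eqE /=; lia.
Qed.

(** Bubble sort: put the box [U l] of the last position l < h in place, then continue with the
    shorter initial segment. The positions from [h] on never move, as L(r,p,n) requires. *)
Lemma std_connect h T U : swap_stable h -> (h <= n)%N -> std T -> std U ->
  initial h T = initial h U -> (forall i, (h <= i)%N -> T i = U i) -> Q T -> Q U.
Proof.
elim: h T => [|h IH] T stab hn stdT stdU e eT QT.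
  by have -> : U = T by apply/ffunP=> i; rewrite eT.
pose l := Ordinal hn.
have /initialP[k kl Tk] : U l \in initial h.+1 T by rewrite e mem_initial.
have [T' [h1 h2 h3 h4 h5]] := @std_bubble T U l k stab stdT stdU e kl Tk QT.
apply: (IH T') => //.
- move=> V i i' ii' i'h; apply: stab => //; exact: leqW.
- exact: ltnW.
- by rewrite (@initialSD T' l) ?(@initialSD U l) ?h3 ?h4 //; apply: std_inj.
move=> i; rewrite leq_eqVlt => /orP[/eqP e'|hi]; last by rewrite h5 // eT.
by have -> : i = l by exact/val_inj.
Qed.

End Connect.
End Connectivity.

(** * Rotation of the components *)

Section Shift.
Variables r n : nat.
Local Notation tab := (tab r n).
Local Notation box := (box r n).
Implicit Types (x y : box) (T U : tab) (i : 'I_n).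

Definition ord_add (c : 'I_r) (s : nat) : 'I_r :=
  Ordinal (ltn_pmod (c + s) (leq_ltn_trans (leq0n c) (ltn_ord c))).

Lemma ord_add0 c : ord_add c 0 = c.
Proof. by apply/val_inj; rewrite /= addn0 modn_small. Qed.

Lemma ord_addD c s t : ord_add (ord_add c s) t = ord_add c (s + t).
Proof. by apply/val_inj; rewrite /= modnDml addnA. Qed.

Lemma ord_add_mod c s : ord_add c (s %% r) = ord_add c s.
Proof. by apply/val_inj; rewrite /= modnDmr. Qed.

Lemma eq_ord_add c s t : (ord_add c s == ord_add c t) = (s == t %[mod r]).
Proof. by rewrite -val_eqE /= eqn_modDl. Qed.

(** The natural number [r - s %% r] stands for -s modulo r here and in all later inverses of
    rotations; the subtraction is not truncated, as the remainder is less than r. *)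
Lemma ord_addK c s : ord_add (ord_add c s) (r - s %% r) = c.
Proof.
have r_gt0 : (0 < r)%N by apply: leq_ltn_trans (ltn_ord c).
rewrite ord_addD -ord_add_mod -modnDml subnKC ?modnn ?ord_add0 //.
by rewrite ltnW // ltn_mod.
Qed.

Lemma ord_add_inj s : injective (ord_add^~ s).
Proof. by move=> c c' /(congr1 (ord_add^~ (r - s %% r)%N)); rewrite !ord_addK. Qed.

Definition shift s x : box := (ord_add x.1 s, x.2).

Lemma shift0 x : shift 0 x = x.
Proof. by case: x => c ab; rewrite /shift ord_add0. Qed.

Lemma shiftD s t x : shift t (shift s x) = shift (s + t) x.
Proof. by rewrite /shift ord_addD. Qed.

Lemma shift_mod s x : shift (s %% r) x = shift s x.
Proof. by rewrite /shift ord_add_mod. Qed.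

Lemma below_shift s x y : below (shift s x) (shift s y) = below x y.
Proof. by rewrite /below (inj_eq (@ord_add_inj s)). Qed.

Lemma shiftK s x : shift (r - s %% r) (shift s x) = x.
Proof. by case: x => c ab; rewrite /shift /= ord_addK. Qed.

Lemma shiftKr s x : shift s (shift (r - s %% r) x) = x.
Proof. by rewrite shiftD addnC -shiftD shiftK. Qed.

Lemma shift_inj s : injective (shift s).
Proof. exact: can_inj (shiftK s). Qed.

Definition shiftt s T : tab := [ffun i => shift s (T i)].

Lemma shift_std s T : std T -> std (shiftt s T).
Proof.
move=> stdT; apply/stdP; split=> [i j|i y]; rewrite !ffunE.
  by move=> /shift_inj/(std_inj stdT).
rewrite -(shiftKr s y) below_shift => /(std_down stdT)[i' i'i e].
by exists i'; rewrite // ffunE e.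
Qed.

Lemma initial_shift s h T : initial h (shiftt s T) = shift s @: initial h T.
Proof.
apply/setP=> x; apply/initialP/imsetP=> [[i ih <-]|[y /initialP[i ih <-] ->]].
  by exists (T i); rewrite ?mem_initial // ffunE.
by exists i; rewrite // ffunE.
Qed.

Lemma sw_shift s i i' T : sw i i' (shiftt s T) = shiftt s (sw i i' T).
Proof. by apply/ffunP=> k; rewrite !ffunE. Qed.

End Shift.

(** * Schur's lemma for the span of the standard tableaux *)

Section Schur.
Variables (K : numClosedFieldType) (r m n : nat).
Local Notation tab := (tab r n).
Local Notation box := (box r n).
Local Notation stab := (stab r n).
Local Notation N := #|stab|.
Local Notation ct := (ct K).
Local Notation Ym := (@Ym K r n).
Local Notation axial := (axial K).
Local Notation coaxial := (coaxial K).
Implicit Types (d : 'I_n -> K) (i : 'I_n) (T U : stab) (X : 'M[K]_N).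

(** With m = r/p these are the diagonal matrices of G(r,p,n), and also those of L(r,p,n). With m = r
    the second condition follows from the first, which gives G(r,1,n). *)
Definition diag_cond d : Prop :=
  (forall i, d i ^+ r = 1) /\ (\prod_i d i) ^+ m = 1.

Definition weight d (T : tab) : K := \prod_i d i ^+ (T i).1.

Definition Dm d : 'M[K]_N := dgf (fun T => weight d (val T)).

(** The commutant of X, tested on generators: of G(r,p,n) for [h = n], and of L(r,p,n) for
    [h = n - 1], where the last position stays fixed. *)
Definition commutes h X : Prop :=
  (forall i i', i' = i.+1 :> nat -> (i' < h)%N -> X *m Ym i i' = Ym i i' *m X) /\
  (forall d, diag_cond d -> X *m Dm d = Dm d *m X).

Lemma commute_dgf X (f : stab -> K) :
  X *m dgf f = dgf f *m X <-> (forall T U, ent X T U != 0 -> f T = f U).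
Proof.
split=> [h T U nz|h].
  have := congr1 (fun A => ent A T U) h; rewrite ent_mul_dgf ent_dgf_mul mulrC.
  by move/(mulIf nz).
apply: ent_inj => T U; rewrite ent_mul_dgf ent_dgf_mul mulrC.
by have [->|/h ->] := eqVneq (ent X T U) 0; rewrite ?mulr0.
Qed.

(** Incomparable boxes of one component differ by at least 1 both in row and in column, in opposite
    directions, so their axial distance is at least 2 in absolute value. *)
Lemma coaxial_neq0 (x y : box) : ~~ below x y -> ~~ below y x -> coaxial x y != 0.
Proof.
move=> nxy nyx; rewrite -sqrf_eq0 coaxial_sqr /axial.
case: (x.1 =P y.1) => [ec|_]; last by rewrite expr0n subr0 oner_eq0.
have key (a b : nat) : (1 < a + b)%N -> 1 - ((a%:R + b%:R : K)^-1) ^+ 2 != 0.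
  move=> ab; rewrite subr_eq0 eq_sym exprVn -natrD -natrX invr_eq1.
  by rewrite -[1]/(1%:R) eqr_nat -[1%N](exp1n 2) eqn_exp2r //; lia.
move: nxy nyx; rewrite /below -ec eqxx /= => nxy nyx.
have [h|h] := leqP x.2.1 y.2.1.
  have l1 : (y.2.2 <= x.2.2)%N by rewrite h /= in nxy; lia.
  have l2 : (x.2.1 <= y.2.1)%N by lia.
  have := key (x.2.2 - y.2.2)%N (y.2.1 - x.2.1)%N.
  rewrite !natrB // /ct => H.
  rewrite -[(_^-1) ^+ 2]sqrrN -invrN [X in X^-1](_ : _ = x.2.2%:R - y.2.2%:R + (y.2.1%:R - x.2.1%:R)).
    by apply: H; rewrite h /= in nxy; lia.
  by ring.
have := key (y.2.2 - x.2.2)%N (x.2.1 - y.2.1)%N.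
have l1 : (x.2.2 <= y.2.2)%N by rewrite (ltnW h) /= in nyx; lia.
have l2 : (y.2.1 <= x.2.1)%N := ltnW h.
rewrite !natrB // /ct => H.
rewrite [X in X^-1](_ : _ = y.2.2%:R - x.2.2%:R + (x.2.1%:R - y.2.1%:R)).
  by apply: H; rewrite (ltnW h) /= in nyx; lia.
by ring.
Qed.

Lemma coaxial_std_neq0 (T : tab) i i' : i' = i.+1 :> nat -> std T ->
  std (sw i i' T) -> coaxial (T i) (T i') != 0.
Proof.
move=> ii' stdT stdT'; apply: coaxial_neq0; apply/negP.
  move=> b; have : (i' <= i)%N.
    by apply: (std_below stdT'); rewrite !ffunE tpermL tpermR.
  by rewrite ii' ltnn.
by move=> b; have := std_below stdT b; rewrite ii' ltnn.
Qed.

Lemma ct_first (T : stab) i : i = 0 :> nat -> ct (val T i) = 0.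
Proof.
move=> i0; case E: (val T i) => [c [a b]].
have z0 : (0 < n)%N by apply: leq_ltn_trans (ltn_ord i).
pose x : box := (c, (Ordinal z0, Ordinal z0)).
have [|k ki Tk] := @std_down _ _ (val T) i x (valP T).
  by rewrite /below E /= eqxx.
have ek : k = i by apply/val_inj; move: ki i0 => /=; lia.
by move: Tk; rewrite ek E => -[<- <-]; rewrite /ct /= subrr.
Qed.

Lemma axial_shift s (x y : box) : axial (shift s x) (shift s y) = axial x y.
Proof. by rewrite /axial (inj_eq (@ord_add_inj _ s)). Qed.

Lemma coaxial_shift s (x y : box) : coaxial (shift s x) (shift s y) = coaxial x y.
Proof. by rewrite /coaxial axial_shift. Qed.

Section Support.
Variables (p : nat) (zeta : K).
Hypotheses (r_eq : r = (p * m)%N) (zeta_prim : r.-primitive_root zeta).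
Variables (h : nat) (X : 'M[K]_N).
Hypotheses (h_le : (h <= n)%N) (Xcomm : commutes h X).

Lemma prod_two (F : 'I_n -> K) i j : i != j ->
  (forall k, k != i -> k != j -> F k = 1) -> \prod_k F k = F i * F j.
Proof.
move=> ij h1; rewrite (bigD1 i) //= (bigD1 j) 1?eq_sym //= big1 ?mulr1 //.
by move=> k /andP[ki kj]; apply: h1.
Qed.

Lemma prod_one (F : 'I_n -> K) i :
  (forall k, k != i -> F k = 1) -> \prod_k F k = F i.
Proof. by move=> h1; rewrite (bigD1 i) //= big1 ?mulr1. Qed.

Let zeta_r : zeta ^+ r = 1. Proof. exact: prim_expr_order. Qed.

Let zeta_neq0 : zeta != 0.
Proof.
apply/eqP=> z0; have := zeta_r; rewrite z0 expr0n.
have := prim_order_gt0 zeta_prim; case: (r) => // r' _ /eqP.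
by rewrite eq_sym oner_eq0.
Qed.

Let p_gt0 : (0 < p)%N.
Proof. by have := prim_order_gt0 zeta_prim; rewrite r_eq muln_gt0 => /andP[]. Qed.

Let m_gt0 : (0 < m)%N.
Proof. by have := prim_order_gt0 zeta_prim; rewrite r_eq muln_gt0 => /andP[]. Qed.

Let expr_p_inj a b : zeta ^+ (p * a) = zeta ^+ (p * b) -> a = b %[mod m].
Proof.
move/eqP; rewrite (eq_prim_root_expr zeta_prim) r_eq -!muln_modr.
by rewrite eqn_pmul2l // => /eqP.
Qed.

(** The diagonal matrices separate weights: one test fixes a single component modulo m, and tests on
    pairs of positions fix all differences of components modulo r. What remains is a common rotation
    by a multiple of m. *)
Lemma support_comp T U : ent X T U != 0 ->
  exists a, forall i, (val T i).1 = ord_add (val U i).1 (m * a).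
Proof.
move=> nz; have wt d : diag_cond d -> weight d (val T) = weight d (val U).
  by move=> dc; apply: (commute_dgf X (fun T => weight d (val T))).1 nz; exact: Xcomm.2.
have [i0 _|n0] := pickP [pred _ : 'I_n | true]; last first.
  by exists 0%N => i; have := n0 i.
have base : (val T i0).1 = (val U i0).1 %[mod m].
  (* A single entry must be an m-th root of unity for the product condition to hold, so it sees the
     component modulo m only. *)
  pose d i := if i == i0 then zeta ^+ p else 1.
  have w (V : tab) : weight d V = (zeta ^+ p) ^+ (V i0).1.
    rewrite /weight (prod_one (i := i0)) /d ?eqxx // => k kn.
    by rewrite (negPf kn) expr1n.
  have /wt : diag_cond d.
    split=> [i|].
      by rewrite /d; case: (i == i0); rewrite ?expr1n // exprAC zeta_r expr1n.
    rewrite (prod_one (i := i0)) /d ?eqxx // => [|k kn]; last by rewrite (negPf kn).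
    by rewrite -exprM -r_eq.
  by rewrite !w -!exprM; exact: expr_p_inj.
have pair i : ((val T i).1 + (val U i0).1 = (val U i).1 + (val T i0).1 %[mod r])%N.
  have [->|ii0] := eqVneq i i0; first by rewrite addnC.
  (* Entries [zeta] and [zeta^-1] have product 1, so a primitive r-th root is allowed here and the
     difference is seen modulo r. *)
  pose d k := if k == i then zeta else if k == i0 then zeta^-1 else 1.
  have w (V : tab) : weight d V = zeta ^+ (V i).1 * zeta ^- (V i0).1.
    rewrite /weight (prod_two ii0) /d ?eqxx.
      by rewrite eq_sym (negPf ii0) exprVn.
    by move=> k /negPf -> /negPf ->; rewrite expr1n.
  have /wt : diag_cond d.
    split=> [k|].
      rewrite /d; case: (k == i); first by [].
      by case: (k == i0); rewrite ?expr1n // exprVn zeta_r invr1.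
    rewrite (prod_two ii0) /d ?eqxx; last by move=> k /negPf -> /negPf ->.
    by rewrite eq_sym (negPf ii0) mulfV // expr1n.
  rewrite !w => /eqP; rewrite eqr_div ?expf_neq0 // -!exprD.
  by rewrite (eq_prim_root_expr zeta_prim) => /eqP.
set t := val (val T i0).1 in base pair; set u := val (val U i0).1 in base pair.
have ur : (u < r)%N by exact: ltn_ord.
have [a am] : exists a, (m * a = t + (r - u))%N.
  have /dvdnP[a ->] : (m %| t + (r - u))%N; last by exists a; rewrite mulnC.
  by rewrite /dvdn -modnDml base modnDml subnKC ?(ltnW ur) // [r in (r %% _)%N]r_eq modnMl.
exists a => i; apply/val_inj; rewrite /= am addnA -modnDml -pair modnDml -addnA.
by rewrite subnKC ?(ltnW ur) // modnDr modn_small.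
Qed.

Lemma ct_shift s (x : box) : ct (shift s x) = ct x.
Proof. by []. Qed.

Lemma support_comp2 T U i j : ent X T U != 0 ->
  ((val T i).1 == (val T j).1) = ((val U i).1 == (val U j).1).
Proof.
by case/support_comp=> a e; rewrite !e (inj_eq (@ord_add_inj _ _)).
Qed.

(* The Jucys-Murphy recursion c_(i+1) = s_i c_i s_i + e_i s_i, where e_i tests the
   equality of the components of the boxes i and i + 1. *)
Lemma content_rec i i' : i' = i.+1 :> nat ->
  dgf (fun T => ct (val T i')) = Ym i i' *m dgf (fun T => ct (val T i)) *m Ym i i'
    + dgf (fun T => ((val T i).1 == (val T i').1)%:R) *m Ym i i'.
Proof.
move=> ii'; apply: (can_inj (mulmxK (_ : Ym i i' \in unitmx))).
  by have /mulmx1_unit[] := YmK K r ii'.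
rewrite mulmxDl -[_ *m Ym i i' *m Ym i i']mulmxA YmK // mulmx1.
rewrite -[_ *m Ym i i' *m Ym i i']mulmxA YmK // mulmx1.
apply: ent_inj => T U; rewrite ent_dgf_mul entD ent_mul_dgf ent_dgf !ent_mxf.
rewrite [LHS]mulrDr [X in _ = X + _]mulrDl -addrA [X in _ = _ + X]addrC addrA.
congr (_ + _).
  have [<-|] := eqVneq T U; last by rewrite !mulr0 mul0r addr0.
  rewrite !mulr1 /axial; case: eqP => [ec|]; last by rewrite mulr0 mul0r addr0.
  have nz : ct (val T i') - ct (val T i) != 0.
    by rewrite subr_eq0 eq_sym ct_eq std_adj_ct //; exact: valP.
  rewrite -[true%:R]/(1 : K) -[in RHS](mulVf nz) -mulrDr.
  by rewrite [_ + (_ - _)]addrC subrK mulrC.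
case: eqP => [<-|]; last by rewrite !mulr0 mul0r.
by rewrite ffunE tpermL !mulr1 mulrC.
Qed.

(** The content matrix of the first position is 0, and the Jucys-Murphy recursion builds the later
    ones from matrices that commute with [X]; the factor testing equality of components does so by
    [support_comp2]. *)
Lemma support_ct T U i : (i < h)%N -> ent X T U != 0 -> ct (val T i) = ct (val U i).
Proof.
move=> ih nz; apply: (commute_dgf X (fun T => ct (val T i))).1 nz.
case: i ih => i /= i_n; elim: i i_n => [|i IH] i_n ih.
  by apply/commute_dgf => V W _; rewrite !ct_first.
have i_n' : (i < n)%N by apply: ltn_trans i_n.
have ii' : Ordinal i_n = (Ordinal i_n').+1 :> nat by [].
rewrite (content_rec ii'); set Y := Ym _ _.
have XY : X *m Y = Y *m X by apply: Xcomm.1.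
rewrite mulmxDr mulmxDl; congr (_ + _).
  rewrite (mulmxA X _ Y) (mulmxA X Y) XY -(mulmxA Y X) IH; last exact: ltnW.
  by rewrite (mulmxA Y) -(mulmxA _ X Y) XY (mulmxA _ Y X).
rewrite (mulmxA X _ Y) (commute_dgf X _).2 -?(mulmxA _ X Y) ?XY ?(mulmxA _ Y X) // => V W nz.
by rewrite (support_comp2 _ _ nz).
Qed.

(** Once the earlier boxes agree up to rotation, the next box is determined by its component and its
    content. From position [h] on only the component is known. *)
Lemma support_partner T U : ent X T U != 0 ->
  exists a, (forall i, (val T i).1 = ord_add (val U i).1 (m * a)) /\
    forall i, (i < h)%N -> val T i = shift (m * a) (val U i).
Proof.
move=> nz; have [a ha] := support_comp nz; exists a; split=> // i ih.
have stdT := valP T; have stdU := shift_std (m * a) (valP U).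
have [q] := ubnP (i : nat); elim: q i ih => // q IH i ih iq.
have sc : same_ct (val T i) (val U i) by rewrite -(ct_eq K) (support_ct ih nz).
(* Suppose the two boxes lie on one diagonal, the first one higher. Its right neighbour is [below]
   the second box, so it is filled before step i in [T2], hence also in [T1], ahead of the box to
   its left. *)
have sub (T1 T2 : tab) : std T1 -> std T2 -> (T1 i).1 = (T2 i).1 ->
    same_ct (T1 i) (T2 i) -> (forall j : 'I_n, (j < i)%N -> T1 j = T2 j) ->
    ~~ ((T1 i).2.1 < (T2 i).2.1)%N.
  move=> s1 s2; case E1 : (T1 i) => [c1 [a1 b1]]; case E2 : (T2 i) => [c2 [a2 b2]].
  rewrite /same_ct /= => ec /eqP e12 ej; apply/negP=> a12.
  have [b' eb'] : exists b' : 'I_n, b' = b1.+1 :> nat.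
    have hb : (b1.+1 < n)%N by apply: leq_ltn_trans (ltn_ord b2); lia.
    by exists (Ordinal hb).
  have [|k ki Tk] := @std_down _ _ T2 i (c1, (a1, b')) s2.
    by rewrite E2 /below /= ec eqxx eb' /=; lia.
  have {}ki : (k < i)%N.
    rewrite ltn_neqAle ki andbT; apply/eqP=> /val_inj e.
    by move: Tk; rewrite e E2 => -[_ e' _]; move: a12; rewrite e' ltnn.
  have := @std_below _ _ T1 i k s1; rewrite E1 (ej k ki) Tk /below /= eqxx eb'.
  by rewrite leqnn leqnSn leqNgt ki => /(_ isT).
have eb (j : 'I_n) : (j < i)%N -> val T j = shiftt (m * a) (val U) j.
  by move=> ji; rewrite ffunE IH //; [exact: ltn_trans ih|exact: leq_trans ji _].
have ec : (val T i).1 = (shiftt (m * a) (val U) i).1 by rewrite ffunE ha.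
have h1 := sub _ _ stdT stdU ec; have h2 := sub _ _ stdU stdT (esym ec).
rewrite !ffunE in h1 h2; have {}h1 := h1 sc eb.
have {}h2 : ~~ ((val U i).2.1 < (val T i).2.1)%N.
  by apply: h2 => [|j ji]; [move: sc; rewrite /same_ct eq_sym|rewrite eb].
move: sc h1 h2 ec; rewrite ffunE /same_ct /shift /=.
case: (val T i) (val U i) => [c1 [a1 b1]] [c2 [a2 b2]] /= /eqP e1 l1 l2 ->.
by congr (_, (_, _)); apply/val_inj; rewrite /=; lia.
Qed.

(** Compare the entry at ([T], [U']) of both sides of the commutation with [Ym i i']. The axial
    terms vanish because the contents of [T] and [U'] disagree at [i], and the remaining two terms
    share a nonzero [coaxial] factor. *)
Lemma ent_swap T U T' U' i i' s : i' = i.+1 :> nat -> (i' < h)%N ->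
  val T i = shift s (val U i) -> val T i' = shift s (val U i') ->
  val T' = sw i i' (val T) -> val U' = sw i i' (val U) -> ent X T' U' = ent X T U.
Proof.
move=> ii' i'h Ti Ti' eT' eU'.
have eqs : ent (X *m Ym i i') T U' = ent (Ym i i' *m X) T U' by rewrite Xcomm.1.
have eU : sw i i' (val U') = val U by rewrite eU' swK.
move: eqs; rewrite -[X *m _]trmxK trmx_mul Ym_tr [LHS]mxE -/(ent _ U' T).
have [e1 e2] : val U' i = val U i' /\ val U' i' = val U i.
  by rewrite eU' !ffunE tpermL tpermR.
rewrite -!rentE !rent_Ym // eU -eT' !rentE e1 e2.
have -> : ent X^T U' T = ent X T U' by rewrite /ent mxE.
have -> : ent X^T U T = ent X T U by rewrite /ent mxE.
rewrite Ti Ti' axial_shift coaxial_shift axialC coaxialC.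
have al0 : axial (val U i) (val U i') * ent X T U' = 0.
  have [->|nz] := eqVneq (ent X T U') 0; first by rewrite mulr0.
  rewrite /axial; case: eqP => [ec|_]; last by rewrite mul0r.
  have ih : (i < h)%N by apply: leq_ltn_trans i'h; rewrite ii'.
  have := support_ct ih nz; rewrite Ti ct_shift eU' ffunE tpermL => /eqP.
  by rewrite ct_eq (negPf (std_adj_ct ii' (valP U) ec)).
rewrite mulNr al0 oppr0 !add0r => /(mulfI _) -> //.
by apply: coaxial_std_neq0 => //; [exact: valP|rewrite -eU'; exact: valP].
Qed.

(** The column tableau is moved from [U] to [U'] by swaps below [h], and the row tableau, being its
    rotation there, follows with the same swaps; each swap preserves the entry. *)
Lemma ent_partner a T U T' U' :
  (forall i, (i < h)%N -> val T i = shift (m * a) (val U i)) ->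
  (forall i, (i < h)%N -> val T' i = shift (m * a) (val U' i)) ->
  (forall i, (h <= i)%N -> val T i = val T' i) ->
  (forall i, (h <= i)%N -> val U i = val U' i) ->
  initial h (val U) = initial h (val U') -> ent X T' U' = ent X T U.
Proof.
move=> TU TU' TT' UU' eU.
pose Q (V : tab) := exists V' W : stab, [/\ val V' = V,
  forall i, (i < h)%N -> val W i = shift (m * a) (V i),
  forall i, (h <= i)%N -> val W i = val T i & ent X W V' = ent X T U].
have : Q (val U').
  apply: (@std_connect _ _ Q h (val U)) => //; try exact: valP; last by exists U, T.
  move=> V i i' ii' i'h stdV stdV' [V' [W [eV WV WT eX]]].
  have ih : (i < h)%N by apply: leq_ltn_trans i'h; rewrite ii'.
  have stdW' : std (sw i i' (val W)).
    apply: sw_std => //; first exact: valP.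
    rewrite !WV // below_shift; apply/negP=> b.
    have : (i' <= i)%N.
      by apply: (std_below stdV'); rewrite !ffunE tpermL tpermR.
    by rewrite ii' ltnn.
  exists (exist _ (sw i i' V) stdV' : stab), (exist _ (sw i i' (val W)) stdW' : stab).
  split=> //=.
  - move=> k kh; rewrite !ffunE WV //; by case: tpermP.
  - move=> k hk; rewrite ffunE -WT // tpermD // -val_eqE /= neq_ltn; apply/orP; left.
      exact: leq_trans ih hk.
    exact: leq_trans i'h hk.
  rewrite -eX; apply: (@ent_swap W V' _ _ i i' (m * a)); rewrite ?eV //=; exact: WV.
case=> V' [W [eV WV WT <-]]; congr ent; apply: val_inj => //.
apply/ffunP=> i; have [hi|ih] := leqP h i; first by rewrite WT ?TT'.
by rewrite WV // TU'.
Qed.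

End Support.
End Schur.

(** * Exchanging the last box *)

Section Exchange.
Variables (K : numClosedFieldType) (r n' : nat).
Local Notation n := n'.+1.
Local Notation tab := (tab r n).
Local Notation box := (box r n).
Local Notation stab := (stab r n).
Local Notation N := #|stab|.
Local Notation Ym := (@Ym K r n).
Implicit Types (D E : {set box}) (x y z : box) (i a : 'I_n) (T U : stab).

(** Order ideals of boxes are the diagrams of multipartitions. *)
Definition ideal D : bool :=
  [forall x, forall z, (x \in D) && below z x ==> (z \in D)].

Lemma idealP D : reflect (forall x z, x \in D -> below z x -> z \in D) (ideal D).
Proof.
apply: (iffP forallP) => [h x z xD zx|h x].
  by have /forallP/(_ z)/implyP := h x; apply; rewrite xD.
by apply/forallP=> z; apply/implyP=> /andP[]; exact: h.
Qed.

Definition addable D x : bool := [&& x \notin D, ideal D & ideal (x |: D)].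

Lemma std_ideal h (T : tab) : std T -> ideal (initial h T).
Proof.
move=> stdT; apply/idealP=> x z /initialP[i ih <-] /(std_down stdT)[i' i'i <-].
exact/mem_initial/(leq_ltn_trans i'i).
Qed.

Lemma std_card h (T : tab) : (h <= n)%N -> std T -> #|initial h T| = h.
Proof.
move=> hn stdT; elim: h hn => [|h IH] hn.
  by apply/eqP; rewrite cards_eq0; apply/eqP/setP=> x; rewrite inE; apply/initialP=> -[].
have := initialS T (Ordinal hn); rewrite /= => ->; rewrite cardsU1 IH; last exact: ltnW.
by rewrite (mem_initial_inj _ (Ordinal hn)) ?ltnn //; exact: std_inj.
Qed.

Lemma std_addable (T : tab) i : std T -> addable (initial i T) (T i).
Proof.
move=> stdT; rewrite /addable mem_initial_inj ?ltnn; last exact: std_inj.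
by rewrite -initialS !std_ideal.
Qed.

(** Sorting by row plus column index is a linear extension of [below]: a smaller box has a strictly
    smaller index sum. *)
Lemma std_ex D : ideal D -> exists s : seq box,
  [/\ uniq s, s =i D & forall x0 i z, (i < size s)%N -> below z (nth x0 s i) ->
     exists2 i', (i' <= i)%N & nth x0 s i' = z].
Proof.
move=> idD; pose rk x := (x.2.1 + x.2.2)%N.
pose s := sort (relpre rk leq) (enum D); exists s.
have us : uniq s by rewrite sort_uniq enum_uniq.
have ms : s =i D by move=> x; rewrite mem_sort mem_enum.
split=> // x0 i z hi zb.
have zs : z \in s by rewrite ms (idealP _ idD _ _ _ zb) // -ms mem_nth.
exists (index z s); last exact: nth_index.
have [->|ne] := eqVneq z (nth x0 s i); first by rewrite index_uniq.
rewrite leqNgt; apply/negP=> lt.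
have srt : sorted (relpre rk leq) s by apply: sort_sorted => x y; exact: leq_total.
have := sorted_ltn_nth (fun y x z => @leq_trans (rk y) (rk x) (rk z)) x0 srt i (index z s).
rewrite !inE hi index_mem zs => /(_ isT isT lt); rewrite /= nth_index //.
have /and3P[/eqP e1 e2 e3] := zb; rewrite /rk => le.
case/eqP: ne; case: z (nth _ _ _) e1 e2 e3 le {zb zs lt} => c [u v] [c' [u' v']] /= -> *.
by congr (_, (_, _)); apply/val_inj; rewrite /=; lia.
Qed.

Definition setlast (T : tab) y : tab := [ffun i => if i == ord_max then y else T i].

Lemma initial_setlast (T : tab) y : initial n' (setlast T y) = initial n' T.
Proof.
apply/setP=> x; apply/initialP/initialP=> -[i ih <-]; exists i; rewrite // ffunE;
  by rewrite -val_eqE /= ltn_eqF.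
Qed.

Lemma setlast_last (T : tab) y : setlast T y ord_max = y.
Proof. by rewrite ffunE eqxx. Qed.

Lemma setlastK (T : tab) y : setlast (setlast T y) (T ord_max) = T.
Proof. by apply/ffunP=> i; rewrite !ffunE; case: eqP => [->|]. Qed.

Lemma setlast_id (T : tab) : setlast T (T ord_max) = T.
Proof. by apply/ffunP=> i; rewrite ffunE; case: eqP => [->|]. Qed.

Lemma setlast2 (T : tab) x y : setlast (setlast T x) y = setlast T y.
Proof. by apply/ffunP=> i; rewrite !ffunE; case: eqP. Qed.

Lemma setlast_std (T : tab) y : std T -> addable (initial n' T) y -> std (setlast T y).
Proof.
move=> stdT /and3P[yD _ idy]; apply/stdP; split=> [i j|i z].
  rewrite !ffunE; case: eqP => [->|/eqP ni]; case: eqP => [->|/eqP nj] //.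
  - move=> e; case/negP: yD; rewrite e mem_initial // ltn_neqAle -ltnS ltn_ord andbT.
    by rewrite -[n']/(val (@ord_max n')) val_eqE.
  - move=> e; case/negP: yD; rewrite -e mem_initial // ltn_neqAle -ltnS ltn_ord andbT.
    by rewrite -[n']/(val (@ord_max n')) val_eqE.
  - exact: std_inj.
rewrite ffunE; case: eqP => [->|/eqP ni] zb.
  have /setU1P[->|/initialP[k kn Tk]] := idealP _ idy y z (setU11 _ _) zb.
    by exists ord_max; rewrite ?ffunE ?eqxx.
  exists k; first exact: ltnW.
  by rewrite ffunE -val_eqE /= ltn_eqF.
have [k ki Tk] := std_down stdT zb; exists k => //; rewrite ffunE.
case: eqP ki => // -> /=; rewrite leqNgt => /negP[].
by rewrite ltn_neqAle -ltnS ltn_ord andbT -[n']/(val (@ord_max n')) val_eqE.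
Qed.

Lemma std_exists D y : addable D y -> #|D| = n' -> exists T,
  initial n' (val T) = D /\ val T ord_max = y.
Proof.
move=> /and3P[yD idD idy] cD; have [s [us ms hs]] := std_ex idD.
have sz : size s = n' by rewrite -(card_uniqP us) (eq_card ms).
pose T : tab := [ffun i : 'I_n => nth y s i].
have Tlast : T ord_max = y by rewrite ffunE nth_default // sz.
have Tin i : (i < n')%N -> T i \in D by move=> ih; rewrite ffunE -ms mem_nth ?sz.
have last_or i : i = ord_max \/ (i < n')%N.
  have [->|ne] := eqVneq i ord_max; [by left|right].
  by rewrite ltn_neqAle -ltnS ltn_ord andbT -[n']/(val (@ord_max n')) val_eqE.
have eD : initial n' T = D.
  apply/setP=> x; apply/initialP/idP=> [[i ih <-]|xD]; first exact: Tin.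
  have lt : (index x s < n')%N.
    have lts : (index x s < size s)%N by rewrite index_mem ms.
    by rewrite sz in lts.
  by exists (Ordinal (leqW lt)); rewrite //= ffunE nth_index ?ms.
suff stdT : std T by exists (exist _ T stdT : stab).
apply/stdP; split=> [i j|i z].
  have [->|hi] := last_or i; have [->|hj] := last_or j => //.
  - by rewrite Tlast => e; case/negP: yD; rewrite e Tin.
  - by rewrite Tlast => e; case/negP: yD; rewrite -e Tin.
  rewrite !ffunE => /eqP; rewrite nth_uniq ?sz // => /eqP e; exact/val_inj.
have [->|hi] := last_or i; rewrite ?Tlast => zb.
  have /setU1P[->|] := idealP _ idy y z (setU11 _ _) zb; first by exists ord_max.
  by rewrite -eD => /initialP[k kn <-]; exists k => //; apply: ltnW.
rewrite ffunE in zb; have [||i' ii' e] := hs y i z => //; first by rewrite sz.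
have lt : (i' < n)%N by rewrite ltnS; apply: leq_trans (ltnW hi).
by exists (Ordinal lt); rewrite //= ffunE.
Qed.

(** The identity on the fillings of [D] times the matrix unit with row [x] and column [y]; hence the
    product rule, the transposition rule and the diagonal case [last_sel]. *)
Definition exchange D x y : 'M[K]_N :=
  mxf (fun T U : stab => ((initial n' (val T) == D) && (val T ord_max == x))%:R
     * (setlast (val T) y == val U)%:R).

Lemma rent_exchange (J : finType) (B : 'M[K]_(N, #|J|)) D x y T u : addable D y ->
  ent (exchange D x y *m B) T u =
  ((initial n' (val T) == D) && (val T ord_max == x))%:R
    * rent B (setlast (val T) y) u.
Proof.
move=> ady; rewrite ent_mul; under eq_bigr do rewrite ent_mxf -mulrA.
rewrite -mulr_sumr; case: andP => [[/eqP eD _]|_]; last by rewrite !mul0r.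
have stdT' : std (setlast (val T) y) by apply: setlast_std; rewrite ?eD //; exact: valP.
pose S' : stab := exist _ (setlast (val T) y) stdT'.
rewrite -[setlast _ _]/(val S') rentE (bigD1 S') //= eqxx mul1r big1 ?addr0 //.
by move=> z zS; rewrite -[setlast _ _]/(val S') eq_sym (inj_eq val_inj) (negPf zS) mul0r.
Qed.

Lemma exchange_mul D x y z : addable D y ->
  exchange D x y *m exchange D y z = exchange D x z.
Proof.
move=> ady; apply: ent_inj => T U; rewrite rent_exchange // ent_mxf.
case: andP => [[/eqP eD /eqP ex]|_]; last by rewrite !mul0r.
have stdT' : std (setlast (val T) y) by apply: setlast_std; rewrite ?eD //; exact: valP.
rewrite -[setlast (val T) y]/(val (exist _ (setlast (val T) y) stdT' : stab)) rentE.
by rewrite ent_mxf /= initial_setlast eD setlast_last !eqxx !mul1r setlast2.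
Qed.

Lemma exchange_tr D x y : (exchange D x y)^T = exchange D y x.
Proof.
apply: ent_inj => T U; rewrite /ent mxE -/(ent _ U T) -/(ent _ T U) !ent_mxf.
rewrite -!natrM !mulnb; congr (_%:R); congr nat_of_bool.
apply/andP/andP=> -[/andP[/eqP <- /eqP <-] /eqP <-];
  by rewrite initial_setlast setlast_last setlastK !eqxx.
Qed.

Definition last_sel D x : 'M[K]_N :=
  dgf (fun T : stab => ((initial n' (val T) == D) && (val T ord_max == x))%:R).

Lemma exchange_id D x : exchange D x x = last_sel D x.
Proof.
apply: ent_inj => T U; rewrite ent_mxf ent_dgf.
case: andP => [[_ /eqP <-]|_]; last by rewrite !mul0r.
by rewrite setlast_id (inj_eq val_inj).
Qed.

Lemma adj_not_last i i' : i' = i.+1 :> nat -> (i' < n')%N ->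
  i != ord_max /\ i' != ord_max.
Proof. by move=> ii' i'n; rewrite -!val_eqE /=; split; lia. Qed.

Lemma exchange_Ym D x y i i' : addable D y -> i' = i.+1 :> nat -> (i' < n')%N ->
  exchange D x y *m Ym i i' = Ym i i' *m exchange D x y.
Proof.
move=> ady ii' i'n; have [ni ni'] := adj_not_last ii' i'n.
have i_n : (i < n')%N by rewrite -ltnS -ii' ltnW.
rewrite -[in LHS](mulmx1 (Ym i i')); apply: ent_inj => T U.
rewrite rent_exchange // rent_Ym // !ffunE (negPf ni) (negPf ni').
rewrite -[RHS]rentE rent_Ym // rentE ent_mxf.
have sl : sw i i' (setlast (val T) y) = setlast (sw i i' (val T)) y.
  by apply/ffunP=> k; rewrite !ffunE; case: tpermP => [->|->|//]; rewrite (negPf ni) (negPf ni').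
have ste (V : tab) : std V -> initial n' V == D ->
    rent (1%:M : 'M[K]_N) (setlast V y) U = (setlast V y == val U)%:R.
  move=> stdV /eqP eV; have stdV' : std (setlast V y) by apply: setlast_std; rewrite ?eV.
  by rewrite -[setlast V y]/(val (exist _ (setlast V y) stdV' : stab)) rentE ent1.
rewrite sl; have [-> | nz] := eqVneq (coaxial K (val T i) (val T i')) 0.
  rewrite !mul0r !addr0; case: andP => [[eD _]|]; last by rewrite !mul0r mulr0.
  by rewrite ste ?mul1r //; exact: valP.
have stdT' : std (sw i i' (val T)) by apply: coaxial_std nz => //; exact: valP.
rewrite -[sw i i' (val T)]/(val (exist _ (sw i i' (val T)) stdT' : stab)) rentE.
rewrite ent_mxf /= initial_sw // ffunE tpermD //.
case: andP => [[eD _]|]; last by rewrite !mul0r !mulr0 addr0.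
by rewrite !ste ?initial_sw ?mul1r //; exact: valP.
Qed.

Lemma exchange_Dm D x y (d : 'I_n -> K) : addable D y ->
  d ord_max ^+ x.1 *: (exchange D x y *m Dm r d) =
  d ord_max ^+ y.1 *: (Dm r d *m exchange D x y).
Proof.
move=> ady; apply: ent_inj => T U; rewrite [LHS]entZ [RHS]entZ.
rewrite [in LHS]ent_mul_dgf.
rewrite [in RHS]ent_dgf_mul.
rewrite ent_mxf.
case: andP => [[_ /eqP ex]|_]; last by rewrite !mul0r !mulr0.
case: eqP => [<-|_]; last by rewrite !mulr0 mul0r mulr0.
rewrite !mul1r mulr1 /weight (bigD1 ord_max) //= [in RHS](bigD1 ord_max) //= ex.
rewrite setlast_last mulrCA; congr (_ * (_ * _)); apply: eq_bigr => i ni.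
by rewrite ffunE (negPf ni).
Qed.

(* Only the diagonal part of Young's orthogonal form contributes, because its
   off-diagonal part changes the set of the first n - 1 boxes. *)
Lemma exchange_kill D x (A : {set box}) (kappa : box -> K) i :
  i.+1 = n' -> {in A, forall y, addable D y} ->
  (forall z, z \in D -> ideal (D :\ z) -> \sum_(y in A) kappa y * axial K z y = 0) ->
  \sum_(y in A) kappa y *: (exchange D x y *m (Ym i ord_max *m exchange D y x)) = 0.
Proof.
move=> iN adA kz.
have iN' : (ord_max : 'I_n) = i.+1 :> nat by rewrite iN.
apply: ent_inj => T U.
rewrite ent0 ent_sum.
under eq_bigr => y yA.
  rewrite entZ (@rent_exchange _ _ _ _ _ _ _ (adA y yA)) (rent_Ym _ _ _ iN').
over.
case: andP => [[/eqP eD /eqP ex]|_]; last first.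
  by rewrite big1 // => y _; rewrite mul0r mulr0.
have i_n : (i < n')%N by lia.
have ni : i != ord_max by rewrite -val_eqE /= ltn_eqF.
transitivity (\sum_(y in A) kappa y * axial K (val T i) y * (T == U)%:R); last first.
  rewrite -mulr_suml kz ?mul0r //; first by rewrite -eD mem_initial.
  rewrite -eD; have := @initialSD r n (val T) i (std_inj (valP T)).
  by rewrite iN => <-; apply: std_ideal; exact: valP.
apply: eq_bigr => y yA; have ady := adA y yA.
have stdT' : std (setlast (val T) y) by apply: setlast_std; rewrite ?eD //; exact: valP.
rewrite !ffunE eqxx (negPf ni) mul1r -mulrA; congr (_ * _).
pose S1 : stab := exist _ (setlast (val T) y) stdT'.
have -> : rent (exchange D y x) (setlast (val T) y) U = ent (exchange D y x) S1 U.
  by rewrite -rentE.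
rewrite ent_mxf /= initial_setlast eD setlast_last !eqxx mul1r setlast2.
have -> : setlast (val T) x = val T by rewrite -ex setlast_id.
rewrite (inj_eq val_inj).
have [->|nz] := eqVneq (coaxial K (val T i) y) 0; first by rewrite mul0r addr0.
have stdT'' : std (sw i ord_max (setlast (val T) y)).
  by apply: (coaxial_std (K := K) iN' stdT'); rewrite !ffunE eqxx (negPf ni).
rewrite -[sw _ _ _]/(val (exist _ (sw i ord_max (setlast (val T) y)) stdT'' : stab)).
rewrite rentE ent_mxf /= [_ == D](_ : _ = false) ?mul0r ?mulr0 ?addr0 //.
apply/negP=> /eqP e; have /and3P[/negP yD _ _] := ady; apply: yD; rewrite -e.
by apply/initialP; exists i => //; rewrite ffunE tpermL setlast_last.
Qed.

End Exchange.

(** * Conjugates of an operator indexed by the positions *)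

Section Family.
Variables (K : numClosedFieldType) (r n' : nat).
Local Notation n := n'.+1.
Local Notation stab := (stab r n).
Local Notation box := (box r n).
Local Notation N := #|stab|.
Local Notation Ym := (@Ym K r n).
Implicit Types (th : 'M[K]_N) (i a b : 'I_n) (d : 'I_n -> K).

Fixpoint transport_rec k : 'M[K]_N :=
  if k is k'.+1 then transport_rec k' *m Ym (inord (n' - k'.+1)) (inord (n' - k'))
  else 1%:M.

(* The product s_(n-1) ... s_a, which carries the position a to the last one. *)
Definition transport a : 'M[K]_N := transport_rec (n' - a).

Definition fam th a : 'M[K]_N := (transport a)^T *m th *m transport a.

Lemma transport_last : transport ord_max = 1%:M.
Proof. by rewrite /transport subnn. Qed.

Lemma transportS i i' : i' = i.+1 :> nat -> transport i = transport i' *m Ym i i'.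
Proof.
move=> ii'; have i'n := ltn_ord i'.
have e : (n' - i = (n' - i').+1)%N by lia.
rewrite /transport e /=; congr (_ *m Ym _ _); apply/val_inj; rewrite /= inordK; lia.
Qed.

Lemma ord_adj i : i = ord_max \/ exists i' : 'I_n, i' = i.+1 :> nat.
Proof.
have [->|ne] := eqVneq i ord_max; [by left|right].
have lt : (i.+1 < n)%N.
  by move: ne (ltn_ord i); rewrite -val_eqE /=; lia.
by exists (Ordinal lt).
Qed.

Lemma ord_ind_down (P : 'I_n -> Prop) : P ord_max ->
  (forall i i', i' = i.+1 :> nat -> P i' -> P i) -> forall i, P i.
Proof.
move=> P0 PS i; move: {2}(n' - i)%N (erefl (n' - i)%N) => k.
elim: k i => [|k IH] i e; have [->//|[i' ii']] := ord_adj i.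
  by have := ltn_ord i'; rewrite ii' /=; lia.
by apply: PS (ii') _; apply: IH; rewrite ii'; lia.
Qed.

Lemma transport_mul a : transport a *m (transport a)^T = 1%:M.
Proof.
elim/ord_ind_down: a => [|i i' ii' IH]; first by rewrite transport_last trmx1 mulmx1.
rewrite (transportS ii') trmx_mul Ym_tr mulmxA -(mulmxA _ (Ym _ _) (Ym _ _)) YmK //.
by rewrite mulmx1.
Qed.

Lemma fam_last th : fam th ord_max = th.
Proof. by rewrite /fam transport_last trmx1 mul1mx mulmx1. Qed.

Lemma famS th i i' : i' = i.+1 :> nat -> fam th i = Ym i i' *m fam th i' *m Ym i i'.
Proof. by move=> ii'; rewrite /fam (transportS ii') trmx_mul Ym_tr !mulmxA. Qed.

Lemma fam_tr th a : (fam th a)^T = fam th^T a.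
Proof. by rewrite /fam !trmx_mul trmxK mulmxA. Qed.

Lemma fam_mul th th' a : fam th a *m fam th' a = fam (th *m th') a.
Proof.
rewrite /fam !mulmxA -[X in X *m _ *m _](mulmxA _ (transport a)).
by rewrite transport_mul mulmx1.
Qed.

Lemma famZ c th a : fam (c *: th) a = c *: fam th a.
Proof. by rewrite /fam -scalemxAr -scalemxAl. Qed.

Lemma fam_sum (I : Type) (s : seq I) (P : pred I) (F : I -> 'M[K]_N) a :
  fam (\sum_(i <- s | P i) F i) a = \sum_(i <- s | P i) fam (F i) a.
Proof. by rewrite /fam mulmx_sumr mulmx_suml. Qed.

Lemma trace_fam th a : \tr (fam th a) = \tr th.
Proof. by rewrite /fam mxtrace_mulC mulmxA transport_mul mul1mx. Qed.

Lemma fam_id th : (forall i i', i' = i.+1 :> nat -> th *m Ym i i' = Ym i i' *m th) ->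
  forall a, fam th a = th.
Proof.
move=> h; elim/ord_ind_down=> [|i i' ii' IH]; first exact: fam_last.
by rewrite (famS _ ii') IH -h // -mulmxA YmK // mulmx1.
Qed.

Local Opaque fam.

Section Covariance.
Variable th : 'M[K]_N.
Hypothesis th_comm : forall i i', i' = i.+1 :> nat -> (i' < n')%N ->
  th *m Ym i i' = Ym i i' *m th.

Lemma fam_comm_lt a i i' : i' = i.+1 :> nat -> (i' < a)%N ->
  fam th a *m Ym i i' = Ym i i' *m fam th a.
Proof.
move=> ii'; elim/ord_ind_down: a => [|a a' aa' IH] lt.
  by rewrite fam_last th_comm.
rewrite (famS _ aa'); have far := Ym_far K r ii' aa' lt.
have {}IH := IH (ltn_trans lt (_ : (a < a')%N)).
set s := Ym a a' in far *; set t := Ym i i' in far IH *; set f := fam th a' in IH *.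
rewrite -(mulmxA _ s t) -far (mulmxA _ t s) -(mulmxA s f t) IH ?aa' //.
by rewrite (mulmxA s t f) -far !mulmxA.
Qed.

(** Descending on [a], the factors commute by distance until [a] and [i] are adjacent; there the
    braid relation moves the swap through to one that [fam_comm_lt] already handles. *)
Lemma fam_comm_gt a i i' : i' = i.+1 :> nat -> (a < i)%N ->
  fam th a *m Ym i i' = Ym i i' *m fam th a.
Proof.
move=> ii'; elim/ord_ind_down: a => [|a a' aa' IH] lt.
  by have := ltn_ord i'; move: lt; rewrite ii' /=; lia.
have [lt'|] := ltnP a' i.
  rewrite (famS _ aa'); have far := Ym_far K r aa' ii' lt'.
  have {}IH := IH lt'.
  set s := Ym a a' in far *; set t := Ym i i' in far IH *; set f := fam th a' in IH *.
  by rewrite -(mulmxA _ s t) far (mulmxA _ t s) -(mulmxA s f t) IH (mulmxA s t f) far !mulmxA.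
move=> le; have e : i = a' by apply/val_inj; rewrite /= aa'; lia.
rewrite e in ii' *; rewrite (famS _ aa') (famS _ ii').
have braid := Ym_braid K r aa' ii'.
have cm := @fam_comm_lt i' a a' aa' (_ : (a' < i')%N).
set s := Ym a a' in braid cm *; set t := Ym a' i' in braid cm *; set f := fam _ _ in cm *.
have {}cm : f *m s = s *m f by apply: cm; rewrite ii'.
clearbody s t f; transitivity (s *m t *m f *m (t *m s *m t)); first by rewrite !mulmxA.
rewrite -braid !mulmxA -(mulmxA (s *m t) f s) cm (mulmxA (s *m t) s f).
by rewrite braid.
Qed.

(** An operator that commutes with the swaps of the first n - 1 positions has its conjugates indexed
    by the cosets of the stabilizer of the last position, that is, by the positions. *)
Lemma fam_cov a i i' : i' = i.+1 :> nat ->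
  Ym i i' *m fam th a *m Ym i i' = fam th (tperm i i' a).
Proof.
move=> ii'; case: tpermP => [->|->|/eqP ai /eqP ai'].
- by rewrite (famS _ ii') !mulmxA YmK // mul1mx -mulmxA YmK // mulmx1.
- by rewrite (famS _ ii').
suff e : fam th a *m Ym i i' = Ym i i' *m fam th a by rewrite -e -mulmxA YmK // mulmx1.
have [lt|le] := ltnP a i; first exact: fam_comm_gt.
by apply: fam_comm_lt => //; move: ai ai'; rewrite -!val_eqE /= ii'; lia.
Qed.

Lemma fam_swap a i i' : i' = i.+1 :> nat ->
  Ym i i' *m fam th a = fam th (tperm i i' a) *m Ym i i'.
Proof. by move=> ii'; rewrite -fam_cov // -(mulmxA _ (Ym i i') (Ym i i')) YmK // mulmx1. Qed.

End Covariance.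

(** The swapped part of [Ym] permutes the weights. The diagonal part survives only when both boxes
    lie in one component, and then the weight does not change when the two entries of [d] are
    exchanged. *)
Lemma Ym_Dm i i' d : i' = i.+1 :> nat ->
  Ym i i' *m Dm r d = Dm r (fun k => d (tperm i i' k)) *m Ym i i'.
Proof.
move=> ii'; apply: ent_inj => T U; rewrite [in LHS]ent_mul_dgf [in RHS]ent_dgf_mul.
have w (V : tab r n) : weight d (sw i i' V) = weight (fun k => d (tperm i i' k)) V.
  rewrite /weight (reindex_inj (@perm_inj _ (tperm i i'))) /=.
  by apply: eq_bigr => k _; rewrite ffunE tpermK.
rewrite ent_mxf mulrC !mulrDr; congr (_ + _); last first.
  by case: eqP => [<-|_]; [rewrite w|rewrite !mulr0].
case: eqP => [<-|_]; last by rewrite !mulr0.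
rewrite /axial; case: eqP => [ec|_]; last by rewrite mul0r !mulr0.
congr (_ * _); rewrite -w /weight; apply: eq_bigr => k _; congr (_ ^+ _).
by rewrite ffunE; case: tpermP => [->|->|//]; rewrite ec.
Qed.

Definition roots_of_unity d : Prop := forall i, d i ^+ r = 1.

Lemma fam_Dm th : (forall d, roots_of_unity d ->
     th *m Dm r d = d ord_max *: (Dm r d *m th)) ->
  forall a d, roots_of_unity d -> fam th a *m Dm r d = d a *: (Dm r d *m fam th a).
Proof.
move=> h; elim/ord_ind_down=> [|i i' ii' IH] d dr; first by rewrite fam_last h.
have e1 := Ym_Dm d ii'; set d' := fun k => _ in e1.
have d'r : roots_of_unity d' by move=> k; apply: dr.
have d'i : d' i' = d i by rewrite /d' tpermR.
have {}IH := IH d' d'r; rewrite d'i in IH.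
rewrite (famS _ ii'); have ss := YmK K r ii'.
move: (fam th i') (Ym i i') (Dm r d) (Dm r d') ss e1 IH => f s D D' ss e1 IH.
have e2 : s *m D' = D *m s.
  by rewrite -[LHS]mulmx1 -ss mulmxA -(mulmxA s D') -e1 !mulmxA ss mul1mx.
rewrite -(mulmxA _ s D) e1 (mulmxA _ D' s) -(mulmxA s f D') IH.
by rewrite -scalemxAr -scalemxAl (mulmxA s D' f) e2 !mulmxA.
Qed.

Lemma ord_add1_expr (c c' : 'I_r) (z : K) : c' = ord_add c 1 -> z ^+ r = 1 ->
  z ^+ c' = z * z ^+ c.
Proof. by move=> -> zr; rewrite /= addn1 expr_mod // exprS. Qed.

(** The factor [d a] is the weight of the basis vector v_a of V. This is where the rule of adding a
    box in the following component comes from; the wrap-around is absorbed by [d a ^+ r = 1]. *)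
Lemma fam_exchange_Dm D x y a d : addable D y -> y.1 = ord_add x.1 1 ->
  roots_of_unity d ->
  fam (exchange K D x y) a *m Dm r d = d a *: (Dm r d *m fam (exchange K D x y) a).
Proof.
move=> ady yx; apply: fam_Dm => {}d dr.
have nz : d ord_max ^+ x.1 != 0.
  apply: expf_neq0; apply/eqP=> z0; have := dr ord_max; rewrite z0 expr0n.
  rewrite gtn_eqF ?(leq_ltn_trans (leq0n _) (ltn_ord x.1)) // => /eqP.
  by rewrite eq_sym oner_eq0.
apply: (scalerI nz); rewrite exchange_Dm // (ord_add1_expr yx (dr _)).
by rewrite scalerA mulrC.
Qed.

Section Resolution.
Variables (D : {set box}) (x : box) (A : {set box}) (kappa : box -> K).
Hypotheses (A_addable : {in A, forall y, addable D y})
  (kappa_sum : \sum_(y in A) kappa y = 1)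
  (kappa_kill : forall z, z \in D -> ideal (D :\ z) ->
     \sum_(y in A) kappa y * axial K z y = 0).

(** The (a, b) block, on V (x) X, of the weighted sum over [y] of W_y W_y^T, where W_y stacks the
    maps [fam (exchange K D x y) a]. The weights are chosen to make this operator block diagonal. *)
Definition block a b : 'M[K]_N := \sum_(y in A)
  kappa y *: (fam (exchange K D x y) a *m (fam (exchange K D x y) b)^T).

Lemma block_tr a b : (block a b)^T = block b a.
Proof.
rewrite /block raddf_sum; apply: eq_bigr => y _ /=.
by rewrite linearZ /= trmx_mul trmxK.
Qed.

Lemma block_cov a b i i' : i' = i.+1 :> nat ->
  block (tperm i i' a) (tperm i i' b) = Ym i i' *m block a b *m Ym i i'.
Proof.
move=> ii'; rewrite /block mulmx_sumr mulmx_suml; apply: eq_bigr => y yA.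
have cm (j j' : 'I_n) : j' = j.+1 :> nat -> (j' < n')%N ->
    exchange K D x y *m Ym j j' = Ym j j' *m exchange K D x y.
  by move=> *; apply: exchange_Ym => //; exact: A_addable.
rewrite -!(fam_cov cm _ ii') -scalemxAr -scalemxAl; congr (_ *: _).
have ss := YmK K r ii'; have st : (Ym i i')^T = Ym i i' by exact: Ym_tr.
move: (fam _ a) (fam _ b) (Ym i i') ss st => f g s ss st.
rewrite (trmx_mul (s *m g) s) (trmx_mul s g).
rewrite st.
by rewrite !mulmxA -(mulmxA _ s s) ss mulmx1.
Qed.

Lemma block_diag a : block a a = fam (last_sel K D x) a.
Proof.
rewrite /block; under eq_bigr => y yA do
  rewrite fam_tr exchange_tr fam_mul (exchange_mul _ _ _ (A_addable yA)).
by rewrite -scaler_suml kappa_sum scale1r exchange_id.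
Qed.

(** Conjugation by adjacent swaps brings any pair a < b to the last two positions, where the block
    is the sum annihilated by [exchange_kill]. *)
Lemma block_off_lt a b : (a < b)%N -> block a b = 0.
Proof.
elim/ord_ind_down: b a => [|b b' bb' IH] a.
  elim/ord_ind_down: a => [|a a' aa' IH]; first by rewrite ltnn.
  move=> lt; have [e|[a'' aa'']] := ord_adj a'.
    rewrite e in aa'; have sN : (a.+1 = n')%N by rewrite -aa'.
    rewrite /block; under eq_bigr => y yA do
      rewrite fam_last (famS _ aa') fam_last exchange_tr -(mulmxA _ (Ym _ _))
        -(mulmxA _ (exchange _ _ _ _) (_ *m _)).
    under eq_bigr do rewrite scalemxAr.
    rewrite -mulmx_sumr (exchange_kill _ sN) ?mulmx0 //.
  rewrite -(tpermR a a') -[X in block _ X](@tpermD _ a a' ord_max).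
  - by rewrite block_cov // IH ?mulmx0 ?mul0mx //; have := ltn_ord a''; rewrite aa''.
  - by rewrite -val_eqE /= ltn_eqF.
  - by rewrite -val_eqE /=; have := ltn_ord a''; rewrite aa'' => ?; rewrite ltn_eqF.
move=> ab; rewrite -(tpermR b b') -[X in block X _](@tpermD _ b b' a).
- by rewrite block_cov // IH ?mulmx0 ?mul0mx // bb'; apply: ltn_trans ab _.
- by rewrite -val_eqE /= gtn_eqF.
- by rewrite -val_eqE /= bb' gtn_eqF // ltnS ltnW.
Qed.

Lemma blockE a b : block a b = (a == b)%:R *: fam (last_sel K D x) a.
Proof.
case: eqP => [<-|/eqP]; first by rewrite scale1r block_diag.
rewrite scale0r -val_eqE /= neq_ltn => /orP[] lt; first exact: block_off_lt.
by rewrite -block_tr block_off_lt ?trmx0.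
Qed.

End Resolution.

Definition shape_sel E : 'M[K]_N := dgf (fun T : stab => (initial n (val T) == E)%:R).

Lemma initial_last (T : stab) : initial n' (val T) = initial n (val T) :\ val T ord_max.
Proof. exact: (@initialSD r n (val T) ord_max (std_inj (valP T))). Qed.

Lemma shape_selE E : shape_sel E = \sum_(x in E) last_sel K (E :\ x) x.
Proof.
apply: ent_inj => T U; rewrite ent_sum ent_dgf.
under eq_bigr do rewrite ent_dgf; rewrite -mulr_suml; congr (_ * _).
have Tl : val T ord_max \in initial n (val T) by apply: mem_initial.
have [<-|ne] := eqVneq (initial n (val T)) E.
  rewrite (bigD1 (val T ord_max)) //= initial_last !eqxx big1 ?addr0 // => x /andP[_ ne].
  by rewrite [_ == x]eq_sym (negPf ne) andbF.
rewrite big1 // => x xE; case: andP => // -[/eqP e /eqP ex]; case/eqP: ne.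
by rewrite -(finset.setD1K Tl) -initial_last e ex finset.setD1K.
Qed.

Lemma shape_sel_Ym E i i' : i' = i.+1 :> nat ->
  shape_sel E *m Ym i i' = Ym i i' *m shape_sel E.
Proof.
move=> ii'; apply: esym; apply/commute_dgf => T U; rewrite ent_mxf => nz.
have [->//|ne] := eqVneq T U; rewrite (negPf ne) mulr0 add0r in nz.
suff -> : initial n (val U) = initial n (val T) by [].
case: (sw i i' (val T) =P val U) nz => [<- _|_]; last by rewrite mulr0 eqxx.
by rewrite initial_sw.
Qed.

Lemma fam_shape_sel E a : fam (shape_sel E) a = shape_sel E.
Proof. by apply: fam_id => *; exact: shape_sel_Ym. Qed.

Lemma dgf_mul (f g : stab -> K) : dgf f *m dgf g = dgf (fun T => f T * g T).
Proof. by apply: ent_inj => T U; rewrite ent_dgf_mul !ent_dgf mulrA. Qed.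

Lemma shape_sel_id E : shape_sel E *m shape_sel E = shape_sel E.
Proof. by rewrite dgf_mul; congr dgf; apply/funext=> T; case: eqP; rewrite ?mulr1 ?mulr0. Qed.

Lemma shape_sel_exchange D x y : addable D y ->
  shape_sel (x |: D) *m exchange K D x y = exchange K D x y.
Proof.
move=> ady; apply: ent_inj => T U; rewrite ent_dgf_mul ent_mxf.
case: andP => [[/eqP eD /eqP ex]|_]; last by rewrite mul0r mulr0.
rewrite -eD -ex initial_last finset.setD1K ?eqxx ?mul1r //; exact: mem_initial.
Qed.

Lemma exchange_shape_sel D x y : addable D y ->
  exchange K D x y *m shape_sel (y |: D) = exchange K D x y.
Proof.
move=> ady; apply: ent_inj => T U; rewrite ent_mul_dgf ent_mxf.
case: andP => [[/eqP eD /eqP ex]|_]; last by rewrite !mul0r.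
case: eqP => [e|_]; last by rewrite mulr0 mul0r.
have eU : initial n' (val U) = D by rewrite -e initial_setlast.
have lU : val U ord_max = y by rewrite -e setlast_last.
rewrite -eU -lU initial_last finset.setD1K ?eqxx ?mulr1 //; exact: mem_initial.
Qed.

Lemma fam_exchange_shape D x y a : addable D y ->
  fam (exchange K D x y) a *m shape_sel (y |: D) = fam (exchange K D x y) a.
Proof. by move=> ady; rewrite -(fam_shape_sel _ a) fam_mul exchange_shape_sel. Qed.

Lemma shape_fam_exchange D x y a : addable D y ->
  shape_sel (x |: D) *m fam (exchange K D x y) a = fam (exchange K D x y) a.
Proof. by move=> ady; rewrite -(fam_shape_sel _ a) fam_mul shape_sel_exchange. Qed.

End Family.

(** Take a monic polynomial [q] of degree #|A| - 1 divisible by the product over [B], and write it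
    by Lagrange interpolation at the points of [A]. Its leading coefficient gives the sum 1; its
    value 0 at c z, divided by the product over [A] there, gives the other equations. *)
Lemma interpolation_weights (K : fieldType) (I : finType) (A B : {set I}) (c : I -> K) :
  {in A &, injective c} -> {in A & B, forall y z, c y != c z} -> (#|B| < #|A|)%N ->
  exists kappa : I -> K, \sum_(y in A) kappa y = 1 /\
    forall z, z \in B -> \sum_(y in A) kappa y * (c y - c z)^-1 = 0.
Proof.
move=> c_inj cAB BA.
pose P (S : {set I}) : {poly K} := \prod_(y in S) ('X - (c y)%:P).
have szP S : size (P S) = #|S|.+1 by rewrite /P -big_enum /= size_prod_XsubC -cardE.
have monP S : P S \is monic by apply: monic_prod => i _; exact: monicXsubC.
have evP S x : (P S).[x] = \prod_(y in S) (x - c y).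
  by rewrite /P horner_prod; apply: eq_bigr => y _; rewrite !hornerE.
(* The strict inequality of cardinals leaves room for the product over [B]; the power of X only
   fills up the degree. *)
pose q := P B * 'X^(#|A|.-1 - #|B|).
have monq : q \is monic by rewrite monicMr ?monicXn // monP.
have szq : size q = #|A|.
  rewrite size_Mmonic ?monicXn ?monic_neq0 ?monP // szP size_polyXn; lia.
have Anz : (0 < #|A|)%N by apply: leq_ltn_trans BA.
pose l y := P (A :\ y).
have szl y : y \in A -> size (l y) = #|A|.
  by move=> yA; rewrite szP (cardsD1 y A) yA.
have lnz y : y \in A -> (l y).[c y] != 0.
  move=> yA; rewrite evP; apply/prodf_neq0 => y'; rewrite !inE => /andP[ne y'A].
  by rewrite subr_eq0; apply: contra ne => /eqP/c_inj ->.
pose kappa y := q.[c y] / (l y).[c y].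
pose L := \sum_(y in A) kappa y *: l y.
have szL : (size L <= #|A|)%N.
  apply: (leq_trans (size_sum _ _ _)); apply/bigmax_leqP => y yA.
  by rewrite (leq_trans (size_scale_leq _ _)) // szl.
have rootqL y : y \in A -> root (q - L) (c y).
  move=> yA; rewrite /root hornerD hornerN subr_eq0 /L horner_sum (bigD1 y) //=.
  rewrite big1 ?addr0 => [|y' /andP[y'A ne]].
    by rewrite hornerZ /kappa divfK ?lnz.
  rewrite hornerZ [X in _ * X](_ : _ = 0) ?mulr0 // evP.
  rewrite (bigD1 y) /=; first by rewrite subrr mul0r.
  by rewrite !inE eq_sym ne.
have eqL : q = L.
  apply/eqP; rewrite -subr_eq0; apply/negP=> /negP nz.
  have := max_poly_roots nz (rs := [seq c y | y <- enum A]).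
  rewrite size_map -cardE map_inj_in_uniq ?enum_uniq; last first.
    by move=> y y'; rewrite !mem_enum; exact: c_inj.
  have -> : all (root (q - L)) [seq c y | y <- enum A].
    by apply/allP=> _ /mapP[y + ->]; rewrite mem_enum => /rootqL.
  move=> /(_ isT isT); rewrite ltnNge => /negP[].
  by apply: leq_trans (size_polyD _ _) _; rewrite size_polyN geq_max szq leqnn szL.
exists kappa; split.
  have := congr1 (fun p : {poly K} => p`_#|A|.-1) eqL.
  have -> : q`_#|A|.-1 = 1 by have := monq; rewrite monicE lead_coefE szq => /eqP.
  rewrite /L coef_sum => {1}->; apply: eq_bigr => y yA; rewrite coefZ.
  have -> : (l y)`_#|A|.-1 = 1; last by rewrite mulr1.
  by have := monP (A :\ y); rewrite monicE lead_coefE -/(l y) szl // => /eqP.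
move=> z zB; have := congr1 (fun p : {poly K} => p.[c z]) eqL.
rewrite /q hornerM evP (bigD1 z) //= subrr !mul0r /L horner_sum => /esym h.
have Pnz : (P A).[c z] != 0.
  by rewrite evP; apply/prodf_neq0 => y yA; rewrite subr_eq0 eq_sym cAB.
apply: (mulfI Pnz); rewrite mulr0 -[RHS]oppr0 -[in RHS]h -sumrN mulr_sumr.
apply: eq_bigr => y yA; rewrite hornerZ !evP (bigD1 y) //=.
have nz : c z - c y != 0 by rewrite subr_eq0 eq_sym cAB.
rewrite [in RHS](eq_bigl (fun i => (i \in A) && (i != y))); last first.
  by move=> i; rewrite !inE andbC.
rewrite -[c y - c z]opprB invrN !mulrN; congr (- _).
move: (c z - c y) nz (kappa y) (\prod_(i in A | i != y) _) => u nz k v.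
by field.
Qed.

Lemma card_ord_lt n k : (k <= n)%N -> #|[set i : 'I_n | (i < k)%N]| = k.
Proof.
move=> kn; have inj : injective (widen_ord kn) by move=> i j /(congr1 val) /= /val_inj.
rewrite -[RHS]card_ord -(card_imset _ inj).
apply: eq_card => i; rewrite inE; apply/idP/imsetP=> [ik|[j _ ->] /=].
  by exists (Ordinal ik) => //; apply/val_inj.
exact: ltn_ord.
Qed.

(** * Addable and removable boxes of a diagram *)

Section Corners.
Variables (r n' : nat).
Local Notation n := n'.+1.
Local Notation box := (box r n).
Implicit Types (D : {set box}) (x y z : box) (c : 'I_r).

Definition len D c (a : 'I_n) : nat := #|[set b : 'I_n | (c, (a, b)) \in D]|.

Lemma mem_len D c a b : ideal D -> ((c, (a, b)) \in D) = (b < len D c a)%N.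
Proof.
move=> /idealP idD; apply/idP/idP=> [bD|].
  rewrite -[b.+1](@card_ord_lt n); last exact: ltn_ord.
  apply: subset_leq_card; apply/fintype.subsetP=> b'; rewrite !inE ltnS => b'b.
  by apply: idD bD _; rewrite /below /= eqxx leqnn.
rewrite -[X in (X < _)%N](@card_ord_lt n); last exact: ltnW.
move=> lt; have /fintype.subsetPn[b'] : ~~ ([set b' | (c, (a, b')) \in D] \subset [set i : 'I_n | (i < b)%N]).
  by apply/negP=> /subset_leq_card; rewrite leqNgt lt.
rewrite !inE -leqNgt => b'D bb'.
by apply: idD b'D _; rewrite /below /= eqxx leqnn.
Qed.

Lemma len_le D c a : #|D| = n' -> (len D c a <= n')%N.
Proof.
move=> cD; have inj : injective (fun b : 'I_n => (c, (a, b)) : box) by move=> b b' [].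
rewrite -[X in (_ <= X)%N]cD /len -(card_imset _ inj); apply: subset_leq_card.
by apply/fintype.subsetP=> _ /imsetP[b + ->]; rewrite inE.
Qed.

(** A box in row [a] forces [a + 1] boxes in its column, so with n - 1 boxes in all there is still a
    row index left for the next row. *)
Lemma row_lt D c a b : ideal D -> #|D| = n' -> (c, (a, b)) \in D -> (a < n')%N.
Proof.
move=> /idealP idD cD xD.
have inj : injective (fun a' : 'I_n => (c, (a', b)) : box) by move=> ? ? [].
rewrite -[X in (_ <= X)%N]cD -[a.+1](@card_ord_lt n); last exact: ltn_ord.
rewrite -(card_imset _ inj); apply: subset_leq_card.
apply/fintype.subsetP=> _ /imsetP[a' + ->]; rewrite inE ltnS => a'a.
by apply: idD xD _; rewrite /below /= eqxx leqnn a'a.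
Qed.

Lemma addable_row D c (a : 'I_n) (b : 'I_n) : ideal D -> b = len D c a :> nat ->
  (a = 0 :> nat) \/ (exists2 a0 : 'I_n, a = a0.+1 :> nat & (len D c a < len D c a0)%N) ->
  addable D (c, (a, b)).
Proof.
move=> idD eb h; have nD : (c, (a, b)) \notin D by rewrite mem_len // eb ltnn.
rewrite /addable nD idD; apply/idealP=> x z; rewrite !in_setU1.
case/orP=> [/eqP -> zb|xD zx]; last by rewrite (idealP _ idD _ _ xD zx) orbT.
case: z zb => c' [a' b'] /and3P[/= /eqP -> a'a b'b].
have [ea|na] := eqVneq a' a.
  rewrite ea mem_len // -eb; have [eb'|nb] := eqVneq b' b; first by rewrite eb' eqxx.
  by rewrite ltn_neqAle b'b andbT nb orbT.
case: h => [a0|[a0 ea0 lt]].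
  by case/eqP: na; apply/val_inj; rewrite /= a0; move: a'a; rewrite a0; case: (a' : nat).
have bD : (c, (a0, b)) \in D by rewrite mem_len // eb.
rewrite [X in _ || X](idealP _ idD _ _ bD) ?orbT // /below /= eqxx b'b andbT.
by move: na a'a; rewrite -val_eqE /= ea0; lia.
Qed.

Lemma same_ct_lt x z : x.1 = z.1 -> same_ct x z -> (x.2.1 < z.2.1)%N ->
  exists y, [/\ below y z, below x y, y != x & y != z].
Proof.
case: x z => c [a b] [c' [a' b']] /= ec /eqP /= e lt.
have hb : (b.+1 < n)%N by apply: leq_ltn_trans (ltn_ord b'); lia.
exists (c, (a, Ordinal hb)); rewrite /below /= ec !eqxx leqnn leqnSn /=; split.
- by rewrite (ltnW lt) /=; lia.
- by [].
- by apply/eqP=> -[] /eqP; rewrite -val_eqE /=; lia.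
- by apply/eqP=> -[e']; move: lt; rewrite e' ltnn.
Qed.

Lemma same_ct_row x z : x.1 = z.1 -> same_ct x z -> x.2.1 = z.2.1 -> x = z.
Proof.
case: x z => c [a b] [c' [a' b']] /= -> /eqP /= e ea; congr (_, (_, _)) => //.
by apply/val_inj; move: e; rewrite ea /=; lia.
Qed.

Lemma addable_below D y z : addable D y -> below z y -> z != y -> z \in D.
Proof.
case/and3P=> _ _ /idealP idy zy ne.
by have := idy y z (setU11 _ _) zy; rewrite in_setU1 (negPf ne).
Qed.

(** If the first of two boxes on a diagonal is higher, its right neighbour is [below] the second,
    hence in [D], which forces the first box into [D] as well. *)
Lemma addable_ct D y y' : addable D y -> addable D y' -> y.1 = y'.1 ->
  same_ct y y' -> y = y'.
Proof.
have lt (x z : box) : addable D x -> addable D z -> x.1 = z.1 -> same_ct x z ->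
    (x.2.1 < z.2.1)%N -> False.
  move=> /and3P[xD idD _] az ec sc /(same_ct_lt ec sc)[u [uz xu _ nuz]].
  by case/negP: xD; apply: (idealP _ idD u); rewrite // (addable_below az).
move=> ay ay' ec sc; case: (ltngtP y.2.1 y'.2.1) => [h|h|/val_inj].
- by case: (lt _ _ ay ay' ec sc h).
- by case: (lt _ _ ay' ay (esym ec) _ h); rewrite /same_ct eq_sym.
- exact: same_ct_row.
Qed.

Lemma addable_removable_ct D y z : addable D y -> z \in D -> ideal (D :\ z) ->
  y.1 = z.1 -> ~~ same_ct y z.
Proof.
move=> ay zD idDz ec; apply/negP=> sc; have /and3P[yD idD _] := ay.
case: (ltngtP y.2.1 z.2.1) => [h|h|/val_inj h].
- have [u [uz yu _ _]] := same_ct_lt ec sc h; case/negP: yD.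
  by apply: (idealP _ idD z) => //; exact: below_trans uz.
- have [|u [uy zu nuz nuy]] := same_ct_lt (esym ec) _ h; first by rewrite /same_ct eq_sym.
  have uD : u \in D :\ z by rewrite !inE nuz (addable_below ay).
  by have := idealP _ idDz _ _ uD zu; rewrite !inE eqxx.
- by case/negP: yD; rewrite (same_ct_row ec sc h).
Qed.

(* A removable box in row a yields an addable box in row a + 1; row 0 always has
   an addable box. *)
Lemma card_removable_addable D c : ideal D -> #|D| = n' ->
  (#|[set z in D | ideal (D :\ z) && (z.1 == c)]|
   < #|[set y | addable D y && (y.1 == c)]|)%N.
Proof.
move=> idD cD.
have rowP a : exists b : 'I_n, b = len D c a :> nat.
  have lt : (len D c a < n)%N by rewrite ltnS len_le.
  by exists (Ordinal lt).
have [b0 eb0] := rowP ord0.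
pose rowbox (a : 'I_n) : box := (c, (a, inord (len D c a))).
pose f (z : box) : box := rowbox (inord z.2.1.+1).
set B := [set z in D | _]; set A := [set y | _].
have inE' a : (inord (len D c a) : 'I_n) = len D c a :> nat by rewrite inordK // ltnS len_le.
have a0A : rowbox ord0 \in A.
  by rewrite inE eqxx andbT; apply: addable_row => //; left.
(* A removable box ends its row and the next row is strictly shorter, so the first free box of that
   row is addable. The last clause recovers the column of [z] from its row, for the injectivity of
   [f]. *)
have fB z : z \in B -> [/\ f z \in A, (f z).2.1 = z.2.1.+1 :> nat & z.2.2.+1 = len D c z.2.1].
  rewrite inE => /and3P[zD idz /eqP ec]; case: z zD idz ec => c' [a b] /= zD idz ec.
  have e1 : (inord a.+1 : 'I_n) = a.+1 :> nat.
    by rewrite inordK // ltnS; apply: row_lt zD.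
  rewrite ec in zD idz.
  have lb : (b < len D c a)%N by rewrite -mem_len.
  have ltlen : (len D c (inord a.+1) <= b)%N.
    rewrite leqNgt -mem_len //; apply/negP=> h.
    have : (c, (inord a.+1, b)) \in D :\ (c, (a, b)).
      rewrite !inE h andbT; apply/eqP=> -[] /(congr1 val); rewrite /= e1; lia.
    move=> uD; have := idealP _ idz _ (c, (a, b)) uD; rewrite /below /= eqxx e1 leqnSn leqnn !inE eqxx.
    by move=> /(_ isT).
  split=> //.
    rewrite inE eqxx andbT; apply: addable_row => //; right; exists a => //.
    exact: leq_ltn_trans ltlen lb.
  apply/eqP; rewrite eqn_leq lb /= leqNgt; apply/negP=> lt.
  have lt' : (b.+1 < n)%N by apply: leq_trans lt _; apply: leqW; exact: len_le.
  have : (c, (a, Ordinal lt')) \in D :\ (c, (a, b)).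
    rewrite !inE mem_len //= lt andbT; apply/eqP=> -[] /(congr1 val) /=; lia.
  move=> uD; have := idealP _ idz _ (c, (a, b)) uD; rewrite /below /= eqxx leqnn leqnSn !inE eqxx.
  by move=> /(_ isT).
have finj : {in B &, injective f}.
  move=> z z' zB z'B e; have [_ e1 e2] := fB z zB; have [_ e1' e2'] := fB z' z'B.
  have ea : z.2.1 = z'.2.1 by apply/val_inj; move: e1; rewrite e e1' => -[].
  move: zB z'B ea e2 e2'; rewrite !inE => /and3P[_ _ /eqP] + /and3P[_ _ /eqP].
  case: z z' {e e1 e1'} => c1 [a1 b1] [c2 [a2 b2]] /= -> -> -> e3.
  by rewrite -e3 => -[e4]; congr (_, (_, _)); apply/val_inj.
rewrite -(card_in_imset finj) (cardsD1 (rowbox ord0) A) a0A add1n ltnS.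
apply: subset_leq_card; apply/fintype.subsetP=> _ /imsetP[z zB ->].
have [fA e1 _] := fB z zB; rewrite !inE in fA *; rewrite fA andbT.
by apply/eqP=> h; move: e1; rewrite h.
Qed.

(** Interpolation at the contents within component [c]. A removable box of another component imposes
    nothing, because its axial coefficients with these boxes are 0. *)
Lemma corner_weights (K : numClosedFieldType) D c : ideal D -> #|D| = n' ->
  exists kappa : box -> K,
    \sum_(y in [set y | addable D y && (y.1 == c)]) kappa y = 1 /\
    forall z, z \in D -> ideal (D :\ z) ->
     \sum_(y in [set y | addable D y && (y.1 == c)]) kappa y * axial K z y = 0.
Proof.
move=> idD cD; set A := [set y | _].
have [|||kappa [k1 kz]] :=
  @interpolation_weights K _ A [set z in D | ideal (D :\ z) && (z.1 == c)] (@ct K r n).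
- move=> y y'; rewrite !inE => /andP[ay /eqP ec] /andP[ay' /eqP ec'] /eqP.
  by rewrite ct_eq; apply: (addable_ct ay ay'); rewrite ec ec'.
- move=> y z; rewrite !inE => /andP[ay /eqP ec] /and3P[zD idz /eqP ec'].
  by rewrite ct_eq; apply: (addable_removable_ct ay zD idz); rewrite ec ec'.
- exact: card_removable_addable.
exists kappa; split=> // z zD idz.
have [ec|nc] := eqVneq z.1 c; last first.
  rewrite big1 // => y; rewrite inE => /andP[_ /eqP ec].
  by rewrite /axial ec (negPf nc) mulr0.
rewrite -[RHS](kz z); last by rewrite !inE zD idz ec eqxx.
by apply: eq_bigr => y; rewrite inE => /andP[_ /eqP e]; rewrite /axial ec e eqxx.
Qed.

End Corners.

(** * Tensoring with V *)

Section TensorBlocks.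
Variables (K : comPzRingType) (n q N : nat).

(** A map from X to V (x) W given by its coordinates [U a] along the basis vectors v_a of V;
    [rowtens] is the same for maps in the other direction. *)
Definition coltens (U : 'I_n -> 'M[K]_(q, N)) : 'M[K]_(n * q, N) :=
  \matrix_(i, j) U (mxtens_unindex i).1 (mxtens_unindex i).2 j.

Definition rowtens (Q : 'I_n -> 'M[K]_(N, q)) : 'M[K]_(N, n * q) :=
  \matrix_(j, i) Q (mxtens_unindex i).1 j (mxtens_unindex i).2.

Lemma sum_tens (F : 'I_n -> 'I_q -> K) :
  \sum_(k < n * q) F (mxtens_unindex k).1 (mxtens_unindex k).2 = \sum_a \sum_l F a l.
Proof.
rewrite pair_big (reindex (@mxtens_index n q)).
  by apply: eq_bigr => -[a l] _; rewrite mxtens_indexK.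
by exists (@mxtens_unindex n q) => k _; [exact: mxtens_indexK|exact: mxtens_unindexK].
Qed.

Lemma tens_mul_coltens (g : 'M[K]_n) (h : 'M[K]_q) U :
  (g *t h) *m coltens U = coltens (fun a => \sum_b g a b *: (h *m U b)).
Proof.
apply/matrixP=> i j; rewrite !mxE summxE.
under eq_bigr do rewrite !mxE; rewrite (sum_tens (fun b l => g _ b * h _ l * U b l j)).
apply: eq_bigr => b _; rewrite !mxE mulr_sumr; apply: eq_bigr => l _.
by rewrite mulrA.
Qed.

Lemma rowtens_mul_tens (g : 'M[K]_n) (h : 'M[K]_q) Q :
  rowtens Q *m (g *t h) = rowtens (fun b => \sum_a g a b *: (Q a *m h)).
Proof.
apply/matrixP=> i j; rewrite !mxE summxE.
under eq_bigr do rewrite !mxE; rewrite (sum_tens (fun a l => Q a i l * (g a _ * h l _))).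
apply: eq_bigr => b _; rewrite !mxE mulr_sumr; apply: eq_bigr => l _.
by rewrite mulrCA.
Qed.

Lemma rowtens_mul_coltens Q U : rowtens Q *m coltens U = \sum_a Q a *m U a.
Proof.
apply/matrixP=> i j; rewrite !mxE summxE.
under eq_bigr do rewrite !mxE; rewrite (sum_tens (fun a l => Q a i l * U a l j)).
by apply: eq_bigr => a _; rewrite mxE.
Qed.

Lemma coltens_mul U (M : 'M[K]_N) : coltens U *m M = coltens (fun a => U a *m M).
Proof. by apply/matrixP=> i j; rewrite !mxE; apply: eq_bigr => k _; rewrite mxE. Qed.

Lemma mul_rowtens Q (M : 'M[K]_N) : M *m rowtens Q = rowtens (fun a => M *m Q a).
Proof. by apply/matrixP=> i j; rewrite !mxE; apply: eq_bigr => k _; rewrite mxE. Qed.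

Lemma eq_coltens U U' : (forall a, U a = U' a) -> coltens U = coltens U'.
Proof. by move=> e; apply/matrixP=> i j; rewrite !mxE e. Qed.

Lemma eq_rowtens Q Q' : (forall a, Q a = Q' a) -> rowtens Q = rowtens Q'.
Proof. by move=> e; apply/matrixP=> i j; rewrite !mxE e. Qed.

Lemma coltens_mul_rowtens_sum (I : Type) (s : seq I) (P : pred I)
    (U : I -> 'I_n -> 'M[K]_(q, N)) (Q : I -> 'I_n -> 'M[K]_(N, q)) (B : 'M[K]_q) :
  (forall a b, \sum_(t <- s | P t) U t a *m Q t b = (a == b)%:R *: B) ->
  \sum_(t <- s | P t) coltens (U t) *m rowtens (Q t) = 1%:M *t B.
Proof.
move=> h; apply/matrixP=> i j; rewrite summxE !mxE.
set a := (mxtens_unindex i).1; set b := (mxtens_unindex j).1.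
have := congr1 (fun M : 'M_q => M (mxtens_unindex i).2 (mxtens_unindex j).2) (h a b).
rewrite summxE mxE => <-; apply: eq_bigr => t _; rewrite !mxE.
by apply: eq_bigr => k _; rewrite !mxE.
Qed.

End TensorBlocks.

(** * Rotations as operators on the span of the tableaux *)

Section Rotation.
Variables (K : numClosedFieldType) (r n : nat).
Local Notation stab := (stab r n).
Local Notation N := #|stab|.
Local Notation Ym := (@Ym K r n).
Implicit Types (T U : stab) (s t : nat).

Definition shs s T : stab := exist _ (shiftt s (val T)) (shift_std s (valP T)).

Lemma shsD s t T : shs s (shs t T) = shs (t + s) T.
Proof. by apply/val_inj/ffunP=> i; rewrite !ffunE shiftD. Qed.

Lemma shs_mod s T : shs (s %% r) T = shs s T.
Proof. by apply/val_inj/ffunP=> i; rewrite !ffunE shift_mod. Qed.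

Lemma shs0 T : shs 0 T = T.
Proof. by apply/val_inj/ffunP=> i; rewrite !ffunE shift0. Qed.

Lemma shsK s T : shs (r - s %% r) (shs s T) = T.
Proof. by apply/val_inj/ffunP=> i; rewrite !ffunE shiftK. Qed.

Lemma shsKr s T : shs s (shs (r - s %% r) T) = T.
Proof. by apply/val_inj/ffunP=> i; rewrite !ffunE shiftKr. Qed.

Definition rotm s : 'M[K]_N := mxf (fun T U => (T == shs s U)%:R).

Lemma ent_mul_rotm s (J : finType) (B : 'M[K]_(#|J|, N)) (x : J) U :
  ent (B *m rotm s) x U = ent B x (shs s U).
Proof.
rewrite ent_mul (bigD1 (shs s U)) //= ent_mxf eqxx mulr1 big1 ?addr0 // => T ne.
by rewrite ent_mxf (negPf ne) mulr0.
Qed.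

Lemma ent_rotm_mul s (J : finType) (B : 'M[K]_(N, #|J|)) T (x : J) :
  ent (rotm s *m B) (shs s T) x = ent B T x.
Proof.
rewrite ent_mul (bigD1 T) //= ent_mxf eqxx mul1r big1 ?addr0 // => U ne.
rewrite ent_mxf (inj_eq (can_inj (shsK s))) eq_sym (negPf ne) mul0r //.
Qed.

Lemma rotmD s t : rotm s *m rotm t = rotm (t + s).
Proof. by apply: ent_inj => T U; rewrite ent_mul_rotm !ent_mxf shsD. Qed.

Lemma rotm_mod s : rotm (s %% r) = rotm s.
Proof. by apply: ent_inj => T U; rewrite !ent_mxf shs_mod. Qed.

Lemma rotm0 : rotm 0 = 1%:M.
Proof. by apply: ent_inj => T U; rewrite ent_mxf ent1 shs0. Qed.

Lemma rotmK s : rotm (r - s %% r) *m rotm s = 1%:M.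
Proof. by apply: ent_inj => T U; rewrite ent_mul_rotm ent_mxf shsK ent1. Qed.

Lemma rotmKr s : rotm s *m rotm (r - s %% r) = 1%:M.
Proof. by apply: ent_inj => T U; rewrite ent_mul_rotm ent_mxf shsKr ent1. Qed.

Lemma rotm_Ym s i i' : rotm s *m Ym i i' = Ym i i' *m rotm s.
Proof.
apply: ent_inj => T U; rewrite -[T](shsKr s); move: (shs _ T) => {}T.
rewrite ent_rotm_mul ent_mul_rotm !ent_mxf !ffunE axial_shift coaxial_shift.
rewrite (inj_eq (can_inj (shsK s))) sw_shift; congr (_ + _ * _%:R); congr nat_of_bool.
apply/eqP/eqP=> [->//|e]; apply/ffunP=> k; have := congr1 (fun f : tab r n => f k) e.
by rewrite !ffunE => /shift_inj.
Qed.

(** Rotating by [m * a] multiplies the weight by the [m * a]-th power of the product of the [d i],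
    which is 1 in G(r,p,n). Hence these rotations join the commutant. *)
Lemma weight_shift m a (d : 'I_n -> K) T : diag_cond r m d ->
  weight d (val (shs (m * a) T)) = weight d (val T).
Proof.
case=> dr dm; transitivity (weight d (val T) * ((\prod_i d i) ^+ m) ^+ a); last first.
  by rewrite dm expr1n mulr1.
rewrite -exprM -prodrXl /weight -big_split; apply: eq_bigr => i _ /=.
by rewrite ffunE /= expr_mod ?exprD // dr.
Qed.

Lemma rotm_Dm m a (d : 'I_n -> K) : diag_cond r m d ->
  rotm (m * a) *m Dm r d = Dm r d *m rotm (m * a).
Proof.
move=> dc; apply/commute_dgf => T U; rewrite ent_mxf.
by case: (T =P _) => [-> _|_]; rewrite ?weight_shift ?eqxx.
Qed.

Lemma rotm_commutes m a h : commutes m h (rotm (m * a)).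
Proof. by split=> *; [exact: rotm_Ym|exact: rotm_Dm]. Qed.

End Rotation.

(** * One tensor factor more: shapes that occur and shapes that suffice *)

Section Steps.
Variables (K : numClosedFieldType) (r m n' : nat).
Local Notation n := n'.+1.
Local Notation stab := (stab r n).
Local Notation box := (box r n).
Local Notation N := #|stab|.
Local Notation Ym := (@Ym K r n).
Local Notation sel := (@shape_sel K r n').
Implicit Types (E D : {set box}) (x y z : box).
Local Opaque fam.

(* Under [Ym] and [Dm] the matrices on standard tableaux form the direct sum of all
   irreducible representations of G(r,1,n), so a map from it to [tau] is tested on
   the generators only; for h = n - 1 those of L(r,p,n) remain. *)
Definition intertwines h q (tau : 'M[K]_n -> 'M[K]_q) (U : 'M[K]_(q, N)) : Prop :=
  (forall i i' : 'I_n, i' = i.+1 :> nat -> (i' < h)%N ->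
     tau (perm_mx (tperm i i')) *m U = U *m Ym i i') /\
  (forall d, diag_cond r m d -> tau (diag_mx (\row_i d i)) *m U = U *m Dm r d).

Definition cointertwines h q (tau : 'M[K]_n -> 'M[K]_q) (Q : 'M[K]_(N, q)) : Prop :=
  (forall i i' : 'I_n, i' = i.+1 :> nat -> (i' < h)%N ->
     Q *m tau (perm_mx (tperm i i')) = Ym i i' *m Q) /\
  (forall d, diag_cond r m d -> Q *m tau (diag_mx (\row_i d i)) = Dm r d *m Q).

(** The tensor module contains the whole component of shape [E] of X as a direct summand, [Q] being
    a left inverse of [U] on it. For p > 1 that component may still be reducible. *)
Definition summand q (tau : 'M[K]_n -> 'M[K]_q) E : Prop :=
  exists U Q, [/\ intertwines n tau U, cointertwines n tau Q & Q *m U = sel E].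

(** The identity is a sum of maps factoring through components with shapes in [L], so there are no
    constituents of other origin. *)
Definition spanned q (tau : 'M[K]_n -> 'M[K]_q) (L : {set box} -> Prop) : Prop :=
  sum_of (fun B : 'M[K]_q => exists E U Q,
    [/\ L E, intertwines n tau U, cointertwines n tau Q & B = U *m sel E *m Q]) 1%:M.

Definition tens q (tau : 'M[K]_n -> 'M[K]_q) (g : 'M[K]_n) : 'M[K]_(n * q) := g *t tau g.

Lemma perm_mx_row (s : 'S_n) (V : lmodType K) (F : 'I_n -> V) a :
  \sum_b (perm_mx s : 'M[K]_n) a b *: F b = F (s a).
Proof.
rewrite (bigD1 (s a)) //= !mxE eqxx scale1r big1 ?addr0 // => b ne.
by rewrite !mxE eq_sym (negPf ne) scale0r.
Qed.

Lemma perm_mx_col i i' (V : lmodType K) (F : 'I_n -> V) b :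
  \sum_a (perm_mx (tperm i i') : 'M[K]_n) a b *: F a = F (tperm i i' b).
Proof.
rewrite (bigD1 (tperm i i' b)) //= !mxE tpermK eqxx scale1r big1 ?addr0 // => a ne.
rewrite !mxE [_ == b](_ : _ = false) ?scale0r //.
by apply/negP=> /eqP e; move: ne; rewrite -e tpermK eqxx.
Qed.

Lemma diag_mx_row (d : 'I_n -> K) (V : lmodType K) (F : 'I_n -> V) a :
  \sum_b (diag_mx (\row_i d i) : 'M[K]_n) a b *: F b = d a *: F a.
Proof.
rewrite (bigD1 a) //= !mxE eqxx big1 ?addr0 // => b ne.
by rewrite !mxE eq_sym (negPf ne) scale0r.
Qed.

Lemma diag_mx_col (d : 'I_n -> K) (V : lmodType K) (F : 'I_n -> V) b :
  \sum_a (diag_mx (\row_i d i) : 'M[K]_n) a b *: F a = d b *: F b.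
Proof.
rewrite (bigD1 b) //= !mxE eqxx big1 ?addr0 // => a ne.
by rewrite !mxE (negPf ne) scale0r.
Qed.

Section Exchange.
Variables (D : {set box}) (x y : box).
Hypotheses (ady : addable D y) (yx : y.1 = ord_add x.1 1).
Local Notation th := (exchange K D x y).

Let th_comm (i i' : 'I_n) : i' = i.+1 :> nat -> (i' < n')%N ->
  th *m Ym i i' = Ym i i' *m th.
Proof. by move=> *; apply: exchange_Ym. Qed.

Lemma Dm_tr (d : 'I_n -> K) : (Dm r d)^T = Dm r d.
Proof.
apply: ent_inj => T U; rewrite /ent mxE -/(ent _ U T) -/(ent _ T U) !ent_dgf eq_sym.
by case: eqP => [->|_] //; rewrite !mulr0.
Qed.

(** The coordinate at v_a is [U] composed with [fam th a]: the family is permuted by the swaps and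
    acquires the factor [d a], just as the vectors v_a do. *)
Lemma intertwines_tens q (tau : 'M[K]_n -> 'M[K]_q) U : intertwines n tau U ->
  intertwines n (tens tau) (coltens (fun a => U *m fam th a)).
Proof.
case=> h1 h2; split=> [i i' ii' i'n|d dc].
  rewrite tens_mul_coltens coltens_mul; apply: eq_coltens => a.
  rewrite perm_mx_row mulmxA h1 // -(mulmxA U (Ym i i')) (fam_swap th_comm) // tpermK.
  by rewrite mulmxA.
rewrite tens_mul_coltens coltens_mul; apply: eq_coltens => a.
rewrite diag_mx_row mulmxA h2 // -(mulmxA U _ (Dm r d)).
by rewrite (fam_exchange_Dm _ ady yx dc.1) -scalemxAr (mulmxA U).
Qed.

Lemma cointertwines_tens q (tau : 'M[K]_n -> 'M[K]_q) Q : cointertwines n tau Q ->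
  cointertwines n (tens tau) (rowtens (fun a => (fam th a)^T *m Q)).
Proof.
case=> h1 h2; split=> [i i' ii' i'n|d dc].
  rewrite rowtens_mul_tens mul_rowtens; apply: eq_rowtens => b.
  rewrite perm_mx_col -mulmxA h1 // !mulmxA; congr (_ *m Q).
  have := congr1 trmx (fam_swap th_comm (tperm i i' b) ii').
  rewrite tpermK; have := Ym_tr K r i i'; move: (fam _ _) (fam _ _) (Ym i i') => f g s st.
  by rewrite ?(trmx_mul s f) ?(trmx_mul s g) ?(trmx_mul g s) ?(trmx_mul f s) st.
rewrite rowtens_mul_tens mul_rowtens; apply: eq_rowtens => b.
rewrite diag_mx_col -mulmxA h2 // !mulmxA scalemxAl; congr (_ *m Q).
have := congr1 trmx (fam_exchange_Dm b ady yx dc.1).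
have := Dm_tr d; move: (fam _ _) (Dm r d) => f D' Dt.
by rewrite linearZ /= (trmx_mul f D') (trmx_mul D' f) Dt => ->.
Qed.

End Exchange.

Section Schur1.
Variables (zeta : K).
Hypothesis zeta_prim : r.-primitive_root zeta.

(** Schur's lemma for G(r,1,n): with m = r the possible rotations are multiples of r, hence trivial,
    so [X] is diagonal, and its diagonal is constant on a shape by connectivity. *)
Lemma schur_shape (X : 'M[K]_N) E : commutes r n X ->
  exists c, X *m sel E = c *: sel E.
Proof.
move=> Xc; have r1 : r = (1 * r)%N by rewrite mul1n.
have diag T U : ent X T U != 0 -> T = U.
  move=> nz; have [a [_ h]] := support_partner r1 zeta_prim (leqnn n) Xc nz.
  apply/val_inj/ffunP=> i; rewrite h // -shift_mod modnMr shift0 //.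
have [T0 /eqP eT0|none] := pickP [pred T : stab | initial n (val T) == E]; last first.
  exists 0; rewrite scale0r; apply: ent_inj => T U; rewrite ent_mul_dgf ent0.
  by have /= -> := none U; rewrite mulr0.
exists (ent X T0 T0); apply: ent_inj => T U; rewrite ent_mul_dgf entZ ent_dgf.
have [->|ne] := eqVneq T U; last first.
  rewrite !mulr0; have [->|/diag e] := eqVneq (ent X T U) 0; first by rewrite mul0r.
  by rewrite e eqxx in ne.
rewrite mulr1; have [eU|_] := eqVneq (initial n (val U)) E; last by rewrite !mulr0.
congr (_ * _); apply: (ent_partner r1 zeta_prim (leqnn n) Xc (a := 0)).
- by move=> i _; rewrite muln0 shift0.
- by move=> i _; rewrite muln0 shift0.
- by move=> i; rewrite leqNgt ltn_ord.
- by move=> i; rewrite leqNgt ltn_ord.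
- by rewrite eT0 eU.
Qed.

Lemma trace_last_sel_neq0 D y : addable D y -> #|D| = n' -> \tr (last_sel K D y) != 0.
Proof.
move=> ady cD; have [T [e1 e2]] := std_exists ady cD.
rewrite mxtrace_ent; under eq_bigr do rewrite ent_dgf eqxx mulr1.
rewrite -natr_sum pnatr_eq0 sum_nat_eq0; apply/negP=> /forallP/(_ T).
by rewrite e1 e2 !eqxx.
Qed.

(** The composite [S] commutes with G(r,1,n) and is supported on the shape [y |: D], so it is a
    scalar [c] there. The trace of [S] is n times the number of tableaux that fill [D] first and [y]
    last; it is nonzero in characteristic 0, so [c] can be inverted. *)
Lemma summand_tens q (tau : 'M[K]_n -> 'M[K]_q) D x y :
  addable D x -> addable D y -> y.1 = ord_add x.1 1 -> #|D| = n' ->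
  summand tau (x |: D) -> summand (tens tau) (y |: D).
Proof.
move=> adx ady yx cD [U [Q [iU iQ QU]]].
pose th := exchange K D x y.
have cm (i i' : 'I_n) : i' = i.+1 :> nat -> (i' < n')%N -> th *m Ym i i' = Ym i i' *m th.
  by move=> *; apply: exchange_Ym.
pose S := \sum_a (fam th a)^T *m fam th a.
have SE : S = rowtens (fun a => (fam th a)^T *m Q) *m coltens (fun a => U *m fam th a).
  rewrite rowtens_mul_coltens; apply: eq_bigr => a _.
  by rewrite -mulmxA (mulmxA Q) QU shape_fam_exchange.
have Sc : commutes r n S.
  split=> [i i' ii' _|d dc].
    rewrite /S mulmx_suml mulmx_sumr [RHS](reindex_inj (@perm_inj _ (tperm i i'))) /=.
    apply: eq_bigr => a _.
    have := congr1 trmx (fam_swap cm a ii').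
    have := fam_swap cm (tperm i i' a) ii'; rewrite tpermK.
    have := Ym_tr K r i i'; move: (fam _ _) (fam _ _) (Ym i i') => f g s st e.
    by rewrite (trmx_mul s f) (trmx_mul g s) st (mulmxA s) => <-; rewrite -!mulmxA e.
  rewrite /S mulmx_suml mulmx_sumr; apply: eq_bigr => a _.
  have := fam_exchange_Dm a ady yx dc.1.
  have := congr1 trmx (fam_exchange_Dm a ady yx dc.1).
  have := Dm_tr d; rewrite -/th; move: (fam _ _) (Dm r d) => f D' Dt.
  rewrite linearZ /= (trmx_mul f D') (trmx_mul D' f) Dt => e1 e2.
  by rewrite (mulmxA D') e1 -(mulmxA _ f) e2 -scalemxAl -scalemxAr mulmxA.
have [c eS] := schur_shape (y |: D) Sc.
have {}eS : S = c *: sel (y |: D).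
  rewrite -eS /S mulmx_suml; apply: eq_bigr => a _.
  by rewrite -mulmxA fam_exchange_shape.
have fE a : (fam th a)^T *m fam th a = fam (last_sel K D y) a.
  by rewrite fam_tr fam_mul /th exchange_tr (exchange_mul _ _ _ adx) exchange_id.
have c_neq0 : c != 0.
  apply/eqP=> c0; have : \tr S = 0 by rewrite eS c0 scale0r mxtrace0.
  rewrite /S raddf_sum (eq_bigr (fun _ => \tr (last_sel K D y))); last first.
    by move=> a _; rewrite /= fE trace_fam.
  rewrite sumr_const card_ord => /eqP; rewrite mulrn_eq0 /=.
  by rewrite (negPf (trace_last_sel_neq0 ady cD)).
exists (coltens (fun a => U *m fam th a)), (c^-1 *: rowtens (fun a => (fam th a)^T *m Q)).
split; first exact: intertwines_tens.
  have [h1 h2] := cointertwines_tens ady yx iQ.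
  by split=> *; rewrite -scalemxAl -scalemxAr (h1, h2).
by rewrite -scalemxAl -SE eS scalerA mulVf // scale1r.
Qed.

End Schur1.

Lemma last_sel_eq0 D x : (forall T : stab, initial n' (val T) = D ->
  val T ord_max = x -> False) -> last_sel K D x = 0.
Proof.
move=> h; apply: ent_inj => T U; rewrite ent_dgf ent0.
by case: andP => [[/eqP e1 /eqP e2]|_]; [case: (h T)|rewrite mul0r].
Qed.

(** Each piece of shape [E] is split by its last box [x]; for every removable [x] the block identity
    resolves it through the boxes [y] addable to [E :\ x] in the following component. *)
Lemma spanned_tens q (tau : 'M[K]_n -> 'M[K]_q) (L L' : {set box} -> Prop) :
  (forall D x y, addable D x -> addable D y -> y.1 = ord_add x.1 1 -> #|D| = n' ->
     L (x |: D) -> L' (y |: D)) ->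
  spanned tau L -> spanned (tens tau) L'.
Proof.
move=> step [s [hs e1]]; rewrite /spanned.
have -> : (1%:M : 'M[K]_(n * q)) = \sum_(B <- s) (1%:M : 'M[K]_n) *t B.
  have -> : (1%:M : 'M[K]_(n * q)) = (1%:M : 'M[K]_n) *t (1%:M : 'M[K]_q).
    apply/matrixP=> i j; case: (mxtens_indexP i) => a l; case: (mxtens_indexP j) => b t.
    by rewrite tensmxE !mxE -natrM mulnb (inj_eq (can_inj (@mxtens_indexK n q))).
  rewrite e1; apply/matrixP=> i j; rewrite !mxE summxE mulr_sumr summxE.
  by apply: eq_bigr => B _; rewrite !mxE.
apply: sum_of_sum => _ /hs[E [U [Q [LE iU iQ ->]]]] _.
(* The boxes that can come last in a tableau of shape [E]. For the other boxes of [E] no such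
   tableau exists and [last_sel] is 0. *)
pose good x := [&& x \in E, addable (E :\ x) x & #|E :\ x| == n'].
pose A x := [set y : box | addable (E :\ x) y && (y.1 == ord_add x.1 1)].
have [kappa hk] : exists kappa : box -> box -> K, forall x, good x ->
    \sum_(y in A x) kappa x y = 1 /\ forall z, z \in E :\ x -> ideal (E :\ x :\ z) ->
      \sum_(y in A x) kappa x y * axial K z y = 0.
  suff /choice[f hf] : forall x, exists kx : box -> K, good x ->
      \sum_(y in A x) kx y = 1 /\ forall z, z \in E :\ x -> ideal (E :\ x :\ z) ->
        \sum_(y in A x) kx y * axial K z y = 0 by exists f.
  move=> x; have [/and3P[xE /and3P[_ idD _] /eqP cD]|_] := boolP (good x); last by exists (fun=> 0).
  by have [kx h] := @corner_weights r n' K (E :\ x) (ord_add x.1 1) idD cD; exists kx.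
have -> : (1%:M : 'M[K]_n) *t (U *m sel E *m Q) =
    \sum_(t : box * box | good t.1 && (t.2 \in A t.1))
      coltens (fun a => U *m fam (exchange K (E :\ t.1) t.1 t.2) a) *m
      rowtens (fun a => kappa t.1 t.2 *:
                 ((fam (exchange K (E :\ t.1) t.1 t.2) a)^T *m Q)).
  apply: esym; apply: coltens_mul_rowtens_sum => a b.
  rewrite -(pair_big_dep good (fun x y => y \in A x) (fun x y =>
     (U *m fam (exchange K (E :\ x) x y) a) *m (kappa x y *:
      ((fam (exchange K (E :\ x) x y) b)^T *m Q)))) /=.
  transitivity (\sum_(x | good x)
     (a == b)%:R *: (U *m fam (last_sel K (E :\ x) x) a *m Q)).
    apply: eq_bigr => x /hk[k1 kz].
    have adA : {in A x, forall y, addable (E :\ x) y} by move=> y; rewrite inE => /andP[].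
    have := blockE x adA k1 kz a b; rewrite /block => e.
    transitivity (U *m ((a == b)%:R *: fam (last_sel K (E :\ x) x) a) *m Q).
      rewrite -e mulmx_sumr mulmx_suml; apply: eq_bigr => y _.
      by rewrite -scalemxAr -[in RHS]scalemxAr -[in RHS]scalemxAl !mulmxA.
    by rewrite -scalemxAr -scalemxAl.
  rewrite -scaler_sumr; congr (_ *: _).
  rewrite -mulmx_suml -mulmx_sumr; congr (_ *m _ *m _).
  rewrite -[RHS](fam_shape_sel K E a) shape_selE fam_sum.
  rewrite [RHS](bigID good) /= [X in _ = _ + X]big1 ?addr0 => [|x /andP[xE ng]].
    by apply: eq_bigl => x; rewrite /good; case: (x \in E).
  rewrite last_sel_eq0; first by rewrite -(scale0r 0) famZ !scale0r.
  move=> T e2 e3; case/negP: ng; rewrite /good xE -e2 -{1}e3.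
  rewrite (std_addable ord_max (valP T)) /=; apply/eqP.
  by apply: std_card => //; exact: valP.
apply: sum_of_sum => -[x y] _ /= /andP[/and3P[xE adx /eqP cD]]; rewrite inE => /andP[ady /eqP yx].
apply: sum_of_gen.
exists (y |: (E :\ x)), (coltens (fun a => U *m fam (exchange K (E :\ x) x y) a)),
  (rowtens (fun a => kappa x y *: ((fam (exchange K (E :\ x) x y) a)^T *m Q))); split.
- by apply: step adx ady yx cD _; rewrite finset.setD1K.
- exact: intertwines_tens.
- have [h1 h2] := cointertwines_tens ady yx iQ.
  have -> : rowtens (fun a => kappa x y *: ((fam (exchange K (E :\ x) x y) a)^T *m Q)) =
      kappa x y *: rowtens (fun a => (fam (exchange K (E :\ x) x y) a)^T *m Q).
    by apply/matrixP=> i j; rewrite !mxE.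
  by split=> *; rewrite -scalemxAl -scalemxAr (h1, h2).
congr (_ *m _); rewrite coltens_mul; apply: eq_coltens => a.
by rewrite -mulmxA fam_exchange_shape.
Qed.

Lemma commutes_inv h (X Y : 'M[K]_N) : X *m Y = 1%:M ->
  commutes m h X -> commutes m h Y.
Proof.
move=> XY [c1 c2]; have YX := mulmx1C XY.
have gen M : X *m M = M *m X -> Y *m M = M *m Y.
  move=> XM; rewrite -[Y *m M]mulmx1 -XY (mulmxA _ X Y) -(mulmxA Y M X) -XM.
  by rewrite (mulmxA Y X) YX mul1mx.
by split=> *; apply: gen; [exact: c1|exact: c2].
Qed.

Lemma intertwines_mul h q (tau : 'M[K]_n -> 'M[K]_q) U (X : 'M[K]_N) :
  intertwines h tau U -> commutes m h X -> intertwines h tau (U *m X).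
Proof.
move=> [u1 u2] [c1 c2]; split=> *.
  by rewrite mulmxA u1 // -(mulmxA U) -c1 // mulmxA.
by rewrite mulmxA u2 // -(mulmxA U) -c2 // mulmxA.
Qed.

Lemma cointertwines_mul h q (tau : 'M[K]_n -> 'M[K]_q) Q (X : 'M[K]_N) :
  cointertwines h tau Q -> commutes m h X -> cointertwines h tau (X *m Q).
Proof.
move=> [u1 u2] [c1 c2]; split=> *.
  by rewrite -mulmxA u1 // (mulmxA X) c1 // mulmxA.
by rewrite -mulmxA u2 // (mulmxA X) c2 // mulmxA.
Qed.

Lemma rotm_sel s E : rotm K r n s *m sel E = sel (shift s @: E) *m rotm K r n s.
Proof.
apply: ent_inj => T U; rewrite -[T](shsKr s); move: (shs _ T) => {}T.
rewrite ent_rotm_mul ent_mul_rotm !ent_dgf (inj_eq (can_inj (shsK s))) /=.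
by rewrite initial_shift (inj_eq (imset_inj (@shift_inj _ _ s))).
Qed.

Lemma summand_rot q (tau : 'M[K]_n -> 'M[K]_q) E a :
  summand tau E -> summand tau (shift (m * a) @: E).
Proof.
case=> U [Q [iU iQ QU]]; have c1 := @rotm_commutes K r n m a n.
have c2 := commutes_inv (rotmKr K r n (m * a)) c1.
exists (U *m rotm K r n (r - (m * a) %% r)), (rotm K r n (m * a) *m Q); split.
- exact: intertwines_mul.
- exact: cointertwines_mul.
rewrite mulmxA -(mulmxA _ Q U) QU rotm_sel -mulmxA rotmKr mulmx1 //.
Qed.

End Steps.

(** * The commutant *)

Section TensorPower.
Variables (K : comPzRingType) (n : nat).

Lemma ntensmx_recM (A B : 'M[K]_n) k :
  ntensmx_rec (A *m B) k = ntensmx_rec A k *m ntensmx_rec B k.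
Proof. by elim: k => //= k ->; rewrite tensmx_mul. Qed.

Lemma ntensmxM (A B : 'M[K]_n) k : (A *m B) ^t k = A ^t k *m B ^t k.
Proof. by case: k => [|k]; [rewrite /ntensmx /= mulmx1|exact: ntensmx_recM]. Qed.

Lemma ntensmx_rec1 k : ntensmx_rec (1%:M : 'M[K]_n) k = 1%:M.
Proof.
elim: k => //= k ->; apply/matrixP=> i j.
case: (mxtens_indexP i) => a l; case: (mxtens_indexP j) => b t.
by rewrite tensmxE !mxE -natrM mulnb (inj_eq (can_inj (@mxtens_indexK n (n ^ k.+1)))).
Qed.

Lemma ntensmx1r k : (1%:M : 'M[K]_n) ^t k = 1%:M.
Proof. by case: k => [|k] //; exact: ntensmx_rec1. Qed.

End TensorPower.

Section Commutant.
Variables (K : numClosedFieldType) (r m n' k : nat) (h : nat) (H : pred 'M[K]_n'.+1).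
Local Notation n := n'.+1.
Local Notation stab := (stab r n).
Local Notation N := #|stab|.
Local Notation tau := (fun g : 'M[K]_n => g ^t k).
Hypotheses (h_le : (h <= n)%N)
  (H_perm : forall i i' : 'I_n, i' = i.+1 :> nat -> (i' < h)%N ->
     H (perm_mx (tperm i i')))
  (H_diag : forall d : 'I_n -> K, diag_cond r m d -> H (diag_mx (\row_i d i)))
  (H_dec : forall g, H g -> exists (d : 'I_n -> K) (s : 'S_n),
     [/\ diag_cond r m d, forall i : 'I_n, (h <= i)%N -> s i = i &
       g = diag_mx (\row_i d i) *m perm_mx s]).

Lemma adjacent_tperm_gen (P : 'S_n -> Prop) : P 1%g ->
  (forall s t, P s -> P t -> P (s * t)%g) ->
  (forall i i' : 'I_n, i' = i.+1 :> nat -> (i' < h)%N -> P (tperm i i')) ->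
  forall s : 'S_n, (forall i : 'I_n, (h <= i)%N -> s i = i) -> P s.
Proof.
move=> P1 PM Padj.
have Plt (i j : 'I_n) : (i < j)%N -> (j < h)%N -> P (tperm i j).
  case: j => j jn /=; elim: j jn => // j IH jn ij jh.
  have jn' : (j < n)%N by apply: ltnW.
  have adj : P (tperm (Ordinal jn') (Ordinal jn)) by apply: Padj.
  move: ij; rewrite ltnS leq_eqVlt => /orP[/eqP e|ij].
    by have -> : i = Ordinal jn' by exact/val_inj.
  have -> : tperm i (Ordinal jn) =
      (tperm (Ordinal jn') (Ordinal jn) * tperm i (Ordinal jn') *
       tperm (Ordinal jn') (Ordinal jn))%g.
    have := tpermJ i (Ordinal jn') (tperm (Ordinal jn') (Ordinal jn)).
    rewrite tpermL tpermD; last 2 first.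
    - by rewrite -val_eqE /= gtn_eqF.
    - by rewrite -val_eqE /= gtn_eqF // ltnS ltnW.
    by rewrite conjgE tpermV mulgA => <-.
  by apply: (PM _ _ _ adj); apply: (PM _ _ adj); apply: IH => //; exact: ltnW.
have Pt (i j : 'I_n) : (i < h)%N -> (j < h)%N -> P (tperm i j).
  move=> ih jh; case: (ltngtP i j) => [ij|ji|/val_inj ->].
  - exact: Plt.
  - by rewrite tpermC; exact: Plt.
  - by rewrite tperm1.
suff gen h' (s : 'S_n) : (h' <= h)%N -> (forall i : 'I_n, (h' <= i)%N -> s i = i) -> P s.
  by move=> s; exact: gen.
elim: h' s => [|h' IH] s h'h fix_s.
  by have -> : s = 1%g by apply/permP=> i; rewrite perm1 fix_s.
have h'n : (h' < n)%N by apply: leq_trans h_le.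
pose l := Ordinal h'n.
have sl : (s l <= h')%N.
  rewrite leqNgt; apply/negP=> lt; have := fix_s (s l) lt.
  by move/perm_inj => e; rewrite e /= ltnn in lt.
have -> : s = (s * tperm (s l) l * tperm (s l) l)%g by rewrite -mulgA tperm2 mulg1.
apply: PM; last by apply: Pt; [exact: leq_ltn_trans sl h'h|exact: h'h].
apply: IH; first exact: ltnW.
move=> i; rewrite permM leq_eqVlt => /orP[/eqP e|lt].
  by have -> : i = l; [exact/val_inj|rewrite tpermL].
rewrite (fix_s i lt) tpermD //.
  by rewrite -val_eqE /= ltn_eqF // (leq_ltn_trans sl).
by rewrite -val_eqE /= ltn_eqF.
Qed.

Lemma centralizingP (A : 'M[K]_(n ^ k)) :
  (forall i i' : 'I_n, i' = i.+1 :> nat -> (i' < h)%N ->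
     A *m tau (perm_mx (tperm i i')) = tau (perm_mx (tperm i i')) *m A) ->
  (forall d, diag_cond r m d ->
     A *m tau (diag_mx (\row_i d i)) = tau (diag_mx (\row_i d i)) *m A) ->
  A \in centralizing H (k := k).
Proof.
move=> cp cd; apply/asboolP=> g /H_dec[d [s [dc fs ->]]]; rewrite ntensmxM.
rewrite mulmxA cd // -!mulmxA; congr (_ *m _).
apply: (@adjacent_tperm_gen (fun s => A *m tau (perm_mx s) = tau (perm_mx s) *m A)) => //.
  by rewrite perm_mx1 ntensmx1r mulmx1 mul1mx.
by move=> u v eu ev; rewrite perm_mxM ntensmxM mulmxA eu -mulmxA ev mulmxA.
Qed.

(** With [mem_inter], passage between the two commutants: sandwiching by an equivariant pair carries
    the commutant of X into the centralizer and back. *)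
Lemma inter_mem (U : 'M[K]_(n ^ k, N)) X Q : intertwines m h tau U ->
  cointertwines m h tau Q -> commutes m h X ->
  U *m X *m Q \in centralizing H (k := k).
Proof.
move=> [u1 u2] [q1 q2] [x1 x2]; apply: centralizingP => *.
  by rewrite -!mulmxA q1 // !mulmxA u1 // -(mulmxA U X) x1 // mulmxA.
by rewrite -!mulmxA q2 // !mulmxA u2 // -(mulmxA U X) x2 // mulmxA.
Qed.

Lemma mem_inter (A : 'M[K]_(n ^ k)) (U : 'M[K]_(n ^ k, N)) Q : A \in centralizing H (k := k) ->
  intertwines m h tau U -> cointertwines m h tau Q -> commutes m h (Q *m A *m U).
Proof.
move=> /asboolP cA [u1 u2] [q1 q2]; split=> [i i' ii' i'h|d dc].
  rewrite -mulmxA -u1 // !mulmxA -(mulmxA Q A) cA; last exact: H_perm.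
  by rewrite mulmxA q1.
rewrite -mulmxA -u2 // !mulmxA -(mulmxA Q A) cA; last exact: H_diag.
by rewrite mulmxA q2.
Qed.

Lemma commutesM (X Y : 'M[K]_N) : commutes m h X -> commutes m h Y ->
  commutes m h (X *m Y).
Proof.
by move=> [x1 x2] [y1 y2]; split=> *; rewrite -mulmxA (y1, y2) // !mulmxA (x1, x2).
Qed.

Section Index.
Variables (I : Type) (Omega : set I) (Spec : I -> 'M[K]_N -> Prop).
Hypotheses
  (Spec_idem : forall w f, Spec w f -> [/\ commutes m h f, f *m f = f & f != 0])
  (Spec_hom : forall w w' f f' Z, Spec w f -> Spec w' f' -> commutes m h Z ->
     f' *m Z *m f != 0 -> w = w' /\
     exists2 Z', commutes m h Z' & Z' *m (f' *m Z *m f) = f)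
  (Spec_iso : forall w f f', Spec w f -> Spec w f' ->
     exists Z Z', [/\ commutes m h Z, commutes m h Z' & f' = Z *m f *m Z'])
  (Spec_summand : forall w, Omega w -> exists f U Q,
     [/\ Spec w f, intertwines m h tau U, cointertwines m h tau Q & Q *m U = f])
  (Spec_span : sum_of (fun B : 'M[K]_(n ^ k) => exists w f U Q,
     [/\ Omega w, Spec w f, intertwines m h tau U, cointertwines m h tau Q &
         B = U *m f *m Q]) 1%:M).

(** The idempotent of [w] is [U *m f *m Q] with [Q *m U = f]. Its products with elements of the
    centralizer reduce to products [f' *m Z *m f] on X, governed by [Spec_hom]; [Spec_iso] replaces
    the idempotents met in the span by the chosen ones. *)
Lemma indexed_by_spec : irreducibles_indexed_by (centralizer H k) Omega.
Proof.
pose P w (e : centralizer H k) := exists f U Q,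
  [/\ Spec w f, intertwines m h tau U, cointertwines m h tau Q, Q *m U = f &
      val e = U *m f *m Q].
have /choice[e he] : forall w, exists e, Omega w -> P w e.
  move=> w; have [Ow|nO] := pselect (Omega w); last by exists 0.
  have [f [U [Q [Sf iU iQ QU]]]] := Spec_summand Ow.
  have [cf _ _] := Spec_idem Sf.
  by exists (Centralizer (inter_mem iU iQ cf)) => _; exists f, U, Q.
have valM (a b : centralizer H k) : val (a * b) = val a *m val b by [].
have QeU w f (U : 'M[K]_(n ^ k, N)) (Q : 'M[K]_(N, n ^ k)) : Spec w f -> Q *m U = f -> Q *m (U *m f *m Q) *m U = f.
  move=> /Spec_idem[_ ff _] QU.
  by rewrite !mulmxA QU -!mulmxA QU ff ff.
apply: (@irreducibles_of_idempotents _ _ _ e).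
- move=> w /he[f [U [Q [Sf iU iQ QU ev]]]]; apply: val_inj; rewrite valM ev.
  have [_ ff _] := Spec_idem Sf.
  by rewrite !mulmxA -(mulmxA (U *m f) Q U) QU -(mulmxA U f f) ff -(mulmxA U f f) ff.
- move=> w /he[f [U [Q [Sf iU iQ QU ev]]]]; have [_ ff nf] := Spec_idem Sf.
  apply/eqP=> e0; have := QeU w f U Q Sf QU; rewrite -ev e0 /= mulmx0 mul0mx => f0.
  by rewrite -f0 eqxx in nf.
- move=> w a /he[f [U [Q [Sf iU iQ QU ev]]]] nz; have [cf ff nf] := Spec_idem Sf.
  have aUf : val a *m U *m f != 0.
    apply: contra nz => /eqP z; apply/eqP/val_inj; rewrite valM ev.
    by rewrite !mulmxA z mul0mx.
  (* The image of [a *m U *m f] may lie anywhere in the tensor power. Some piece of the resolution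
     of the identity does not kill it, and this brings the question back to X, where [Spec_hom]
     provides a left inverse. *)
  have [s [hs e1]] := Spec_span.
  have [B /hs[w' [f' [U' [Q' [_ Sf' iU' iQ' ->]]]]] nzB] :
      exists2 B, B \in s & B *m (val a *m U *m f) != 0.
    apply: contrapT => no; move: aUf; rewrite -[X in X != 0]mul1mx e1 mulmx_suml.
    rewrite big_seq big1 ?eqxx // => B Bs; apply/eqP/negPn/negP=> nzB.
    by apply: no; exists B.
  have nz' : f' *m (Q' *m val a *m U) *m f != 0.
    apply: contra nzB => /eqP z; apply/eqP.
    by rewrite -!mulmxA; move: z; rewrite -!mulmxA => ->; rewrite mulmx0.
  have cZ := mem_inter (valP a) iU iQ'.
  have [_ [Z' cZ' eZ']] := Spec_hom Sf Sf' (mem_inter (valP a) iU iQ') nz'.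
  have [cf' _ _] := Spec_idem Sf'.
  have cb : commutes m h (f *m Z' *m f') by apply: commutesM => //; apply: commutesM.
  exists (Centralizer (inter_mem iU iQ' cb)); apply: val_inj; rewrite !valM ev /=.
  rewrite !mulmxA; transitivity (U *m f *m (Z' *m (f' *m (Q' *m val a *m U) *m f)) *m Q).
    by rewrite !mulmxA.
  by rewrite eZ' -(mulmxA U f f) ff.
- move=> w w' a /he[f [U [Q [Sf iU iQ QU ev]]]] /he[f' [U' [Q' [Sf' iU' iQ' QU' ev']]]] ne.
  apply: val_inj; rewrite !valM ev ev'.
  transitivity (U *m (f *m (Q *m val a *m U') *m f') *m Q'); first by rewrite !mulmxA.
  have [->|nz] := eqVneq (f *m (Q *m val a *m U') *m f') 0; first by rewrite mulmx0 mul0mx.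
  by have [e' _] := Spec_hom Sf' Sf (mem_inter (valP a) iU' iQ) nz; case: ne.
have [s [hs e1]] := Spec_span.
have hs' B : B \in s -> exists w (x y : centralizer H k), Omega w /\ B = val (x * e w * y).
  move=> /hs[w [f' [U' [Q' [Ow Sf' iU' iQ' ->]]]]].
  have [f [U [Q [Sf iU iQ QU ev]]]] := he w Ow; have [Z [Z' [cZ cZ' ->]]] := Spec_iso Sf Sf'.
  exists w, (Centralizer (inter_mem iU' iQ cZ)), (Centralizer (inter_mem iU iQ' cZ')).
  split=> //; rewrite !valM ev /=.
  transitivity (U' *m Z *m (Q *m (U *m f *m Q) *m U) *m Z' *m Q'); last by rewrite !mulmxA.
  by rewrite (QeU _ _ _ _ Sf QU) !mulmxA.
(* Every [B] in [s] is the value of an element of the centralizer, so [insubd] never falls back on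
   its default 0. *)
have -> : (1 : centralizer H k) = \sum_(B <- s) insubd 0 B.
  apply: val_inj; rewrite raddf_sum /= -[LHS]/(1%:M) e1 !big_seq.
  apply: eq_bigr => B Bs; rewrite val_insubd.
  by have [w [x [y [_ ->]]]] := hs' B Bs; rewrite (valP (x * e w * y)).
apply: sum_of_sum => B Bs _; apply: sum_of_gen.
have [w [x [y [Ow ->]]]] := hs' B Bs; exists w, x, y; split=> //.
exact: valKd.
Qed.

End Index.
End Commutant.

Lemma prim_root_exists (K : numClosedFieldType) r : (0 < r)%N ->
  exists z : K, r.-primitive_root z.
Proof.
move=> r_gt0; pose p : {poly K} := 'X^r - 1.
have [rs def_p] := closed_field_poly_normal p.
have p_monic : p \is monic by rewrite monicXnsubC.
rewrite (monicP p_monic) scale1r in def_p.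
have rn1 : all r.-unity_root rs.
  by apply/allP=> x; rewrite -root_prod_XsubC -def_p.
have sz_r : (r < (size rs).+1)%N.
  by rewrite -(size_prod_XsubC rs id) -def_p size_XnsubC.
have [|z] := hasP (cyclic.has_prim_root r_gt0 rn1 _ sz_r); last by exists z.
rewrite -separable.separable_prod_XsubC -def_p; apply: cyclotomic.separable_Xn_sub_1.
by rewrite pnatr_eq0 -lt0n.
Qed.

(** * Elements of the groups as a diagonal matrix times a permutation *)

Section Monomial.
Variables (K : numClosedFieldType) (r p n' : nat).
Local Notation n := n'.+1.
Local Notation m := (r %/ p)%N.

Lemma perm_mxE (s : 'S_n) i j : (perm_mx s : 'M[K]_n) i j = (s i == j)%:R.
Proof. by rewrite !mxE. Qed.

Lemma diag_perm_entry (d : 'I_n -> K) (s : 'S_n) i j :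
  (diag_mx (\row_i d i) *m perm_mx s) i j = d i * (s i == j)%:R.
Proof. by rewrite mul_diag_mx !mxE. Qed.

Lemma Gr1n_decomp (g : 'M[K]_n) : Gr1n r g -> exists (d : 'I_n -> K) (s : 'S_n),
  [/\ forall i, d i != 0, forall i, d i ^+ r = 1 &
      g = diag_mx (\row_i d i) *m perm_mx s].
Proof.
case/andP=> /andP[/forallP rows /forallP cols] /forallP vals.
have rowP i : exists j, [set j | g i j != 0] = [set j].
  by apply/cards1P.
have /choice[s hs] := rowP; have nz i j : (g i j != 0) = (j == s i).
  by have := finset.in_set1 j (s i); rewrite -hs inE.
have s_inj : injective s.
  move=> i i' e; have /cards1P[i0 hi0] := cols (s i).
  have h x : s x = s i -> x = i0.
    move=> ex; have : x \in [set i' | g i' (s i) != 0] by rewrite inE nz ex.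
    by rewrite hi0 finset.in_set1 => /eqP.
  by rewrite (h i erefl) (h i' (esym e)).
exists (fun i => g i (s i)), (perm s_inj); split=> [i|i|].
- by rewrite nz.
- by apply/eqP; have /forallP/(_ (s i))/implyP := vals i; apply; rewrite nz.
apply/matrixP=> i j; rewrite diag_perm_entry permE; case: eqP => [->|ne].
  by rewrite mulr1.
rewrite mulr0; apply/eqP/negPn; rewrite nz; apply/eqP=> e; exact: ne.
Qed.

Lemma diag_perm_neq0 (d : 'I_n -> K) (s : 'S_n) i j : (forall i, d i != 0) ->
  ((diag_mx (\row_i d i) *m perm_mx s) i j != 0) = (s i == j).
Proof.
by move=> dnz; rewrite diag_perm_entry; case: (s i =P j); rewrite ?mulr1 ?dnz // mulr0 eqxx.
Qed.

Lemma prod_nonzero_diag_perm (d : 'I_n -> K) (s : 'S_n) : (forall i, d i != 0) ->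
  prod_nonzero (diag_mx (\row_i d i) *m perm_mx s) = \prod_i d i.
Proof.
move=> dnz; apply: eq_bigr => i _.
rewrite (eq_bigl (pred1 (s i))) ?big_pred1_eq ?diag_perm_entry ?eqxx ?mulr1 // => j.
by rewrite diag_perm_neq0 // eq_sym.
Qed.

Lemma diag_perm_Gr1n (d : 'I_n -> K) (s : 'S_n) : (0 < r)%N ->
  (forall i, d i ^+ r = 1) -> Gr1n r (diag_mx (\row_i d i) *m perm_mx s).
Proof.
move=> r_gt0 dr; have dnz i : d i != 0.
  apply/eqP=> d0; have := dr i; rewrite d0 expr0n gtn_eqF // => /eqP.
  by rewrite eq_sym oner_eq0.
apply/andP; split; [apply/andP; split|]; apply/forallP=> i.
- rewrite (_ : [set j | _] = [set s i]) ?cards1 //; apply/setP=> j.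
  by rewrite inE finset.in_set1 diag_perm_neq0 // eq_sym.
- rewrite (_ : [set j | _] = [set (s^-1)%g i]) ?cards1 //; apply/setP=> j.
  rewrite inE finset.in_set1 diag_perm_neq0 //; apply/eqP/eqP=> [<-|->].
    by rewrite permK.
  by rewrite permKV.
apply/forallP=> j; rewrite diag_perm_neq0 //; apply/implyP=> /eqP <-.
by rewrite diag_perm_entry eqxx mulr1 dr.
Qed.

Lemma Grpn_decomp (g : 'M[K]_n) : Grpn r p g -> exists (d : 'I_n -> K) (s : 'S_n),
  [/\ diag_cond r m d, forall i : 'I_n, (n <= i)%N -> s i = i &
      g = diag_mx (\row_i d i) *m perm_mx s].
Proof.
case/andP=> /Gr1n_decomp[d [s [dnz dr ->]]] /eqP gm; exists d, s; split=> //.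
  by split=> //; rewrite -[RHS]gm prod_nonzero_diag_perm.
by move=> i; rewrite leqNgt ltn_ord.
Qed.

Lemma Lrpn_decomp (g : 'M[K]_n) : Lrpn r p g -> exists (d : 'I_n -> K) (s : 'S_n),
  [/\ diag_cond r m d, forall i : 'I_n, (n' <= i)%N -> s i = i &
      g = diag_mx (\row_i d i) *m perm_mx s].
Proof.
case/andP=> /andP[/Gr1n_decomp[d [s [dnz dr ->]]] /eqP gm] /forallP fl; exists d, s.
split=> // [|i ni].
  by split=> //; rewrite -[RHS]gm prod_nonzero_diag_perm.
have /implyP := fl i; rewrite diag_perm_neq0 // eqSS => h; apply/eqP/h.
by rewrite eqn_leq ni -ltnS ltn_ord.
Qed.

Hypothesis r_gt0 : (0 < r)%N.

Lemma diag_perm_Grpn (d : 'I_n -> K) (s : 'S_n) : diag_cond r m d ->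
  Grpn r p (diag_mx (\row_i d i) *m perm_mx s).
Proof.
case=> dr dm; rewrite /Grpn diag_perm_Gr1n // prod_nonzero_diag_perm ?dm ?eqxx //.
move=> i; apply/eqP=> d0; have := dr i; rewrite d0 expr0n gtn_eqF // => /eqP.
by rewrite eq_sym oner_eq0.
Qed.

Lemma Grpn_perm (s : 'S_n) : Grpn r p (perm_mx s : 'M[K]_n).
Proof.
have := @diag_perm_Grpn (fun=> 1) s; rewrite (_ : diag_mx _ = 1%:M) ?mul1mx.
  by apply; split=> *; rewrite ?big1 ?expr1n.
by apply/matrixP=> i j; rewrite !mxE.
Qed.

Lemma Grpn_diag (d : 'I_n -> K) : diag_cond r m d -> Grpn r p (diag_mx (\row_i d i)).
Proof. by move=> /(diag_perm_Grpn 1%g); rewrite perm_mx1 mulmx1. Qed.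

Lemma Lrpn_perm (i i' : 'I_n) : i' = i.+1 :> nat -> (i' < n')%N ->
  Lrpn r p (perm_mx (tperm i i') : 'M[K]_n).
Proof.
move=> ii' i'n; rewrite /Lrpn Grpn_perm; apply/forallP=> l; apply/implyP; rewrite eqSS => /eqP ln.
by rewrite perm_mxE tpermD ?eqxx ?oner_eq0 // -val_eqE /= ln ltn_eqF // -ltnS -ii' ltnW.
Qed.

Lemma Lrpn_diag (d : 'I_n -> K) : diag_cond r m d -> Lrpn r p (diag_mx (\row_i d i)).
Proof.
move=> dc; rewrite /Lrpn Grpn_diag //; apply/forallP=> l; apply/implyP=> _.
rewrite !mxE eqxx mulr1n; apply/eqP=> d0; have := dc.1 l; rewrite d0 expr0n gtn_eqF // => /eqP.
by rewrite eq_sym oner_eq0.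
Qed.

End Monomial.

(** * Necklaces as sets of boxes *)

Section Youngs.
Implicit Types (y : young) (a b : nat).

Lemma row_len_mono y a b : (a <= b)%N -> (row_len y b <= row_len y a)%N.
Proof.
move=> ab; rewrite /row_len; have [hb|hb] := ltnP b (size (val y)); last by rewrite nth_default.
have /andP[srt _] := valP y.
have tr : transitive geq by move=> u v w; rewrite /geq /= => h1 h2; exact: leq_trans h2 h1.
have := sorted_leq_nth tr (leqnn : reflexive geq) 0%N srt.
by apply; rewrite ?inE //; exact: leq_ltn_trans hb.
Qed.

Lemma row_len_gt0 y a : (0 < row_len y a)%N = (a < size (val y))%N.
Proof.
rewrite /row_len; have [ha|ha] := ltnP a (size (val y)); last by rewrite nth_default.
have /andP[_ n0] := valP y; rewrite lt0n; apply: contra n0 => /eqP <-.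
exact: mem_nth.
Qed.

Lemma young_ext y y' : (forall a, row_len y a = row_len y' a) -> y = y'.
Proof.
move=> e; have sz u v : (forall a, row_len u a = row_len v a) ->
    (size (val u) <= size (val v))%N.
  move=> euv; rewrite leqNgt -row_len_gt0 euv row_len_gt0 ltnn //.
apply/val_inj/(@eq_from_nth _ 0%N) => [|i _]; last exact: e.
by apply/eqP; rewrite eqn_leq !sz.
Qed.

Lemma boxesE y k : (size (val y) <= k)%N -> boxes y = (\sum_(a < k) row_len y a)%N.
Proof.
move=> hk; rewrite /boxes sumnE (big_nth 0%N) big_mkord.
rewrite -/(row_len y) (big_ord_widen _ (fun a => row_len y a) hk) [RHS](bigID (fun a : 'I_k => (a < size (val y))%N)) /=.
rewrite [X in _ = (_ + X)%N]big1 ?addn0 // => a; rewrite -row_len_gt0; lia.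
Qed.

Lemma row_len_le y a : (row_len y a <= boxes y)%N.
Proof.
rewrite (@boxesE y (maxn (size (val y)) a.+1)) ?leq_maxl //.
have h : (a < maxn (size (val y)) a.+1)%N by rewrite leq_maxr.
by rewrite (bigD1 (Ordinal h)) //= leq_addr.
Qed.

Lemma size_le_boxes y : (size (val y) <= boxes y)%N.
Proof.
rewrite (@boxesE y (size (val y))) // -[X in (X <= _)%N]card_ord -sum1_card.
by apply: leq_sum => a _; rewrite row_len_gt0.
Qed.

Lemma delete_add y y' : delete_box y y' <-> add_box y' y.
Proof.
split=> -[a ca e]; exists a.
- rewrite /outer_corner; case: a ca e => //= a ca e.
  rewrite !e eqxx subn1 (negPf (_ : a != a.+1)) ?subn0; last by rewrite neq_ltn ltnSn.
  have := row_len_mono y (leqnSn a); move: ca; rewrite /inner_corner; lia.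
- move=> b; rewrite e; case: eqP => [->|_]; last by rewrite subn0 addn0.
  by move: ca; rewrite /inner_corner; lia.
- rewrite /inner_corner !e eqxx (negPf (_ : a.+1 != a)); last by rewrite neq_ltn ltnSn orbT.
  by have := row_len_mono y' (leqnSn a); lia.
- by move=> b; rewrite e addnK.
Qed.

Lemma nth_filter_pos (s : seq nat) a : sorted geq s ->
  nth 0%N (filter (fun x => 0 < x)%N s) a = nth 0%N s a.
Proof.
elim: s a => //= x s IH a px; have srt := path_sorted px.
have [x0|] := ltnP 0%N x; first by case: a => //= a; exact: IH.
rewrite leqn0 => /eqP x0; have all0 : all (eq_op^~ 0%N) s.
  have tr : transitive geq by move=> u v w; rewrite /geq /= => h1 h2; exact: leq_trans h2 h1.
  by have := order_path_min tr px; rewrite x0; apply: sub_all => u /=; rewrite leqn0.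
rewrite IH // x0; case: a => [|a] /=.
  by case: s all0 {IH px srt} => //= u s /andP[/eqP ->].
have [h|h] := ltnP a (size s); last by rewrite !nth_default // ltnW.
have /eqP -> := allP all0 _ (mem_nth 0%N h).
have [h'|h'] := ltnP a.+1 (size s); last by rewrite nth_default.
by have /eqP -> := allP all0 _ (mem_nth 0%N h').
Qed.

End Youngs.

Section Dictionary.
Variables (r n' : nat).
Local Notation n := n'.+1.
Local Notation box := (box r n).
Implicit Types (D : {set box}) (t : seq young) (c : 'I_r).

Definition boxset t : {set box} :=
  [set x : box | (x.2.2 < row_len (nth young0 t x.1) x.2.1)%N].

Lemma boxset_ideal t : ideal (boxset t).
Proof.
apply/idealP=> -[c [a b]] [c' [a' b']]; rewrite !inE /= => h /and3P[/= /eqP -> aa bb].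
exact: leq_trans (leq_ltn_trans bb h) (row_len_mono _ aa).
Qed.

(** The type of boxes has n rows and n columns only; under this bound [boxset] cuts nothing off.
    Diagrams with at most n boxes in all satisfy it. *)
Definition bounded t : Prop := forall c : nat,
  (size (val (nth young0 t c)) <= n)%N /\ (row_len (nth young0 t c) 0 <= n)%N.

Lemma bounded_row t c a : bounded t -> (row_len (nth young0 t c) a <= n)%N.
Proof. by move=> bt; apply: leq_trans (row_len_mono _ (leq0n a)) (bt c).2. Qed.

Lemma card_boxset t : bounded t ->
  #|boxset t| = (\sum_(c < r) boxes (nth young0 t c))%N.
Proof.
move=> bt; transitivity (\sum_(c < r) \sum_(a < n) row_len (nth young0 t c) a)%N; last first.
  by apply: eq_bigr => c _; rewrite (@boxesE _ n) //; case: (bt c).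
rewrite -sum1_card; under [RHS]eq_bigr do
  (under eq_bigr do rewrite -[row_len _ _](@card_ord_lt n) ?bounded_row // -sum1_card).
rewrite pair_big_dep /= pair_big_dep /=.
rewrite (reindex (fun u : 'I_r * 'I_n * 'I_n => (u.1.1, (u.1.2, u.2)) : box)) /=.
  by apply: eq_bigl => -[[c a] b]; rewrite !inE.
by exists (fun x : box => (x.1, x.2.1, x.2.2)) => [[[c a] b]|[c [a b]]].
Qed.

Lemma row_len0 t c a : bounded t -> (n <= a)%N -> row_len (nth young0 t c) a = 0%N.
Proof.
move=> bu an; apply/eqP; rewrite -leqn0 leqNgt row_len_gt0 -leqNgt.
exact: leq_trans (bu c).1 an.
Qed.

Definition young_seq D c : seq nat :=
  filter (fun x => 0 < x)%N [seq len D c a | a <- enum 'I_n].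

Lemma len_mono D c (a a' : 'I_n) : ideal D -> (a <= a')%N -> (len D c a' <= len D c a)%N.
Proof.
move=> idD aa; apply: subset_leq_card; apply/fintype.subsetP=> b; rewrite !inE => h.
by apply: (idealP _ idD _ _ h); rewrite /below /= eqxx aa leqnn.
Qed.

Lemma sorted_len D c : ideal D -> sorted geq [seq len D c a | a <- enum 'I_n].
Proof.
move=> idD; rewrite sorted_map; apply/(sortedP ord0) => i; rewrite size_enum_ord => lt.
apply: len_mono => //; rewrite !nth_enum_ord //; exact: ltnW.
Qed.

Lemma young_seqP D c : ideal D -> is_young (young_seq D c).
Proof.
move=> idD; rewrite /is_young mem_filter ltnn andbT sorted_filter ?sorted_len //.
by move=> u v w; rewrite /geq /= => h1 h2; exact: leq_trans h2 h1.
Qed.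

Lemma boxset_surj D q : ideal D -> #|D| = q -> (q <= n)%N ->
  exists l : multi r q, boxset (val l) = D.
Proof.
move=> idD cD qn.
pose Y c : young := exist _ (young_seq D c) (young_seqP c idD).
pose t : r.-tuple young := [tuple Y c | c < r].
have nthY c : nth young0 t c = Y c by rewrite -tnth_nth tnth_mktuple.
have rowE c (a : 'I_n) : row_len (nth young0 t c) a = len D c a.
  rewrite nthY /row_len /= nth_filter_pos ?sorted_len //.
  by rewrite (nth_map ord0) ?size_enum_ord // nth_ord_enum.
have eD : boxset t = D.
  by apply/setP=> -[c [a b]]; rewrite inE /= rowE mem_len.
have sizeY c : (size (val (Y c)) <= n)%N.
  by rewrite /= size_filter (leq_trans (count_size _ _)) // size_map size_enum_ord.
have bt : bounded t.
  move=> c; have [cr|cr] := ltnP c r; last by rewrite nth_default ?size_tuple.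
  rewrite -[c]/(val (Ordinal cr)); split; first by rewrite nthY; exact: sizeY.
  rewrite -[0%N]/(val (ord0 : 'I_n)) rowE /len; apply: leq_trans (max_card _) _.
  by rewrite card_ord.
have {}bt := card_boxset bt; rewrite eD in bt.
have pf : (\sum_(y <- t) boxes y == q)%N.
  by rewrite big_tuple -[X in _ == X]cD bt; apply/eqP/eq_bigr => c _; rewrite -tnth_nth.
by exists (exist _ t pf : multi r q).
Qed.

Lemma multi_bounded q (l : multi r q) : (q <= n)%N -> bounded (val l).
Proof.
move=> qn c; suff h : (boxes (nth young0 (val l) c) <= n)%N.
  by split; [exact: leq_trans (size_le_boxes _) h|exact: leq_trans (row_len_le _ _) h].
apply: leq_trans qn; have /eqP e := valP l.
rewrite -[X in (_ <= X)%N]e; have [cr|cr] := ltnP c r; last first.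
  by rewrite nth_default // size_tuple.
by rewrite big_tuple (bigD1 (Ordinal cr)) //= (tnth_nth young0) leq_addr.
Qed.

Lemma card_multi q (l : multi r q) : (q <= n)%N -> #|boxset (val l)| = q.
Proof.
move=> qn; rewrite card_boxset; last exact: multi_bounded.
have /eqP e := valP l; apply: etrans e; rewrite big_tuple; apply: eq_bigr => c _.
by rewrite -tnth_nth.
Qed.

Lemma eq_rows (a b : nat) : (a <= n)%N -> (b <= n)%N ->
  (forall i : 'I_n, (i < a)%N = (i < b)%N) -> a = b.
Proof.
move=> an bn h; rewrite -(@card_ord_lt n a) // -(@card_ord_lt n b) //.
by apply: eq_card => i; rewrite !inE h.
Qed.

Section Necklace.
Variable p : nat.
Local Notation m := (r %/ p)%N.
Hypothesis r_eq : r = (p * m)%N.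

Definition comp_of (d : 'I_m * 'I_p) : 'I_r :=
  cast_ord (esym r_eq) (mxtens_index (d.2, d.1)).

Definition coord_of (c : 'I_r) : 'I_m * 'I_p :=
  ((mxtens_unindex (cast_ord r_eq c)).2, (mxtens_unindex (cast_ord r_eq c)).1).

Lemma comp_ofK : cancel comp_of coord_of.
Proof. by case=> i j; rewrite /coord_of /comp_of cast_ordKV mxtens_indexK. Qed.

Lemma coord_ofK : cancel coord_of comp_of.
Proof.
by move=> c; apply/val_inj; rewrite /= -divn_eq.
Qed.

Lemma nodeE q (l : multi r q) (d : 'I_m * 'I_p) : node m l d.1 d.2 = nth young0 (val l) (comp_of d).
Proof. by []. Qed.

Lemma in_boxset t x : (x \in boxset t) = (x.2.2 < row_len (nth young0 t x.1) x.2.1)%N.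
Proof. by rewrite inE. Qed.

(** The corner condition disappears on the side of sets: if both box sets come from Young diagrams
    and differ by one box, that box automatically lies at an outer corner. *)
Lemma add_boxP (mu : multi r n') (nu : multi r n) (c : 'I_m * 'I_p) :
  change_node add_box c mu nu <->
  exists y, [/\ y \notin boxset (val mu), y.1 = comp_of c &
                boxset (val nu) = y |: boxset (val mu)].
Proof.
have bmu := multi_bounded mu (leqnSn n'); have bnu := multi_bounded nu (leqnn n).
split=> [h|[y [yn yc e]]].
  have := h c; rewrite eqxx /= => -[a _ ha].
  pose A := row_len (nth young0 (val mu) (comp_of c)) a.
  have hA : row_len (nth young0 (val nu) (comp_of c)) a = A.+1.
    by have := ha a; rewrite eqxx addn1.
  have An : (A < n)%N by rewrite -hA; exact: bounded_row.
  have an : (a < n)%N.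
    have : (0 < row_len (nth young0 (val nu) (comp_of c)) a)%N by rewrite hA.
    by rewrite row_len_gt0 => /leq_trans; apply; case: (bnu (comp_of c)).
  exists (comp_of c, (Ordinal an, Ordinal An)); split=> //; first by rewrite in_boxset ltnn.
  apply/setP=> -[c' [a' b']]; rewrite in_setU1 !in_boxset /=.
  have := h (coord_of c'); have [e|ne] := eqVneq (coord_of c') c.
    move=> _; have {e} -> : c' = comp_of c by rewrite -e coord_ofK.
    have -> : row_len (nth young0 (val nu) (comp_of c)) a' =
        (row_len (nth young0 (val mu) (comp_of c)) a' + (a' == a :> nat))%N by exact: ha.
    have [ea|na] := eqVneq (a' : nat) a.
      have -> : a' = Ordinal an by exact/val_inj.
      rewrite addn1 ltnS leq_eqVlt /= -/A; congr (_ || _).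
      by rewrite !xpair_eqE !eqxx.
    rewrite addn0 !xpair_eqE [a' == _](_ : _ = false) ?andbF //.
    by apply/negbTE; rewrite -val_eqE.
  rewrite !nodeE coord_ofK => ->; rewrite xpair_eqE [c' == _](_ : _ = false) //.
  by apply/negbTE; apply: contra ne => /eqP ->; rewrite comp_ofK.
have cell c' (a' b' : 'I_n) : (b' < row_len (nth young0 (val nu) c') a')%N =
    ((c', (a', b')) == y :> box) || (b' < row_len (nth young0 (val mu) c') a')%N.
  by have := in_boxset (val nu) (c', (a', b')); rewrite e in_setU1 in_boxset.
case: y yn yc e cell => c0 [a0 b0] yn /= yc e cell.
(* The new box comes right after the end of its row in [mu]: if that row were shorter, its first
   free cell would be a second new box. *)
have rb : row_len (nth young0 (val mu) c0) a0 = b0.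
  apply/eqP; rewrite eqn_leq; rewrite in_boxset /= -leqNgt in yn; rewrite yn /=.
  rewrite leqNgt; apply/negP=> lt.
  have lt' : (row_len (nth young0 (val mu) c0) a0 < n)%N by apply: ltn_trans (ltn_ord b0).
  have := cell c0 a0 (Ordinal lt'); rewrite /= ltnn orbF.
  have -> : ((c0, (a0, Ordinal lt')) == (c0, (a0, b0)) :> box) = false.
    by rewrite !xpair_eqE !eqxx -val_eqE /= ltn_eqF.
  have := cell c0 a0 b0; rewrite eqxx /= => h.
  by rewrite (ltn_trans lt h).
have row_nu (c' : 'I_r) (a' : 'I_n) : row_len (nth young0 (val nu) c') a' =
    (row_len (nth young0 (val mu) c') a' + ((c', a') == (c0, a0)))%N.
  have [e'|ne] := eqVneq (c', a') (c0, a0).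
    case: e' => -> ->; apply: eq_rows => [||i]; first exact: bounded_row.
      by rewrite rb addn1.
    by rewrite cell rb addn1 ltnS [in RHS]leq_eqVlt !xpair_eqE !eqxx -val_eqE.
  rewrite addn0; apply: eq_rows => [||i]; try exact: bounded_row.
  rewrite cell [_ == _](_ : _ = false) //; apply/negP=> /eqP[ec ea _].
  by case/eqP: ne; rewrite ec ea.
move=> d; rewrite /= !nodeE; case: eqP => [->|nd].
  rewrite -yc; exists (a0 : nat).
    have := row_len_mono (nth young0 (val nu) c0) (leq_pred a0).
    rewrite /outer_corner; have [-> //|nz] := eqVneq (a0 : nat) 0%N.
    have pn : (a0.-1 < n)%N by apply: leq_ltn_trans (leq_pred _) (ltn_ord a0).
    have := row_nu c0 (Ordinal pn); have := row_nu c0 a0; rewrite eqxx /= => -> ->.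
    rewrite xpair_eqE eqxx -val_eqE /=; have -> : (a0.-1 == a0)%N = false by lia.
    by rewrite addn0 addn1.
  move=> b; have [bn|bn] := ltnP b n.
    by rewrite (row_nu c0 (Ordinal bn)) xpair_eqE eqxx -val_eqE.
  rewrite !row_len0 // addnC; case: eqP => // eb.
  by have := ltn_ord a0; rewrite -eb ltnNge bn.
apply: young_ext => b; have [bn|bn] := ltnP b n; last by rewrite !row_len0.
rewrite (row_nu (comp_of d) (Ordinal bn)) xpair_eqE [comp_of d == _](_ : _ = false) ?addn0 //.
by apply/eqP=> ed; apply: nd; rewrite -(comp_ofK d) ed yc comp_ofK.
Qed.

Lemma delete_boxP (l : multi r n) (mu : multi r n') (c : 'I_m * 'I_p) :
  change_node delete_box c l mu <-> change_node add_box c mu l.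
Proof.
split=> h d; have := h d; rewrite /=; case: eqP => // _; try by move=> ->.
  by move/delete_add.
by move/delete_add.
Qed.

(** Both cases of the recursion, including the passage from component m of a node to component 1 of
    the next node, are the addition of 1 modulo r to the component number. *)
Lemma comp_next (c : 'I_m * 'I_p) : comp_of (next_node c) = ord_add (comp_of c) 1.
Proof.
case: c => i j; apply/val_inj; rewrite /next_node /=; case: ifP => [lt|ge] /=.
  rewrite modn_small // addn1 -addnS [RHS]modn_small // [X in (_ < X)%N]r_eq.
  by rewrite (leq_trans (_ : _ < j.+1 * m)%N) ?leq_mul2r ?ltn_ord ?orbT // mulSn addnC ltn_add2r.
have ei : i.+1 = m by apply/eqP; rewrite eqn_leq ltn_ord leqNgt ge.
have -> : (j * m + i + 1 = j.+1 * m)%N by rewrite -addnA addn1 ei mulSn addnC.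
by rewrite ei modnn addn0 muln_modl -r_eq.
Qed.

Lemma node_shift (i j t : nat) : (i < m)%N -> (j < p)%N ->
  (((j + t) %% p) * m + i = (j * m + i + m * t) %% r)%N.
Proof.
move=> im jp; have m0 : (0 < m)%N by apply: leq_ltn_trans im.
have p0 : (0 < p)%N by apply: leq_ltn_trans jp.
rewrite addnAC [(m * t)%N]mulnC -mulnDl.
have lt : (((j + t) %% p) * m + i < r)%N.
  rewrite [X in (_ < X)%N]r_eq (leq_trans (_ : _ < ((j + t) %% p).+1 * m)%N) //.
    by rewrite mulSn addnC ltn_add2r.
  by rewrite leq_mul2r ltn_mod p0 orbT.
rewrite -[LHS](modn_small lt) muln_modl -r_eq modnDml //.
Qed.

Lemma rotated_nth q (l l' : multi r q) (t : nat) : rotated p l l' t <->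
  forall c : 'I_r, nth young0 (val l') (ord_add c (m * t)) = nth young0 (val l) c.
Proof.
split=> h.
  move=> c; rewrite -(coord_ofK c); case: (coord_of c) => i j.
  rewrite /= -node_shift ?ltn_ord //; exact/esym/h.
move=> i j im jp; have := h (comp_of (Ordinal im, Ordinal jp)).
by rewrite /= -node_shift.
Qed.

Lemma shift_imset s (A : {set box}) x : (shift s x \in shift s @: A) = (x \in A).
Proof. by rewrite mem_imset //; exact: shift_inj. Qed.

Lemma rotatedP q (l l' : multi r q) (t : nat) : (q <= n)%N ->
  rotated p l l' t <-> boxset (val l') = shift (m * t) @: boxset (val l).
Proof.
move=> qn; have bl := multi_bounded l qn; have bl' := multi_bounded l' qn.
rewrite rotated_nth; split=> [h|e c].
  apply/setP=> x; rewrite -(shiftKr (m * t) x) shift_imset !in_boxset.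
  case: (shift (r - _) x) => c [a b]; have := h c.
  by rewrite /= => ->.
apply: young_ext => a; have [an|an] := ltnP a n; last by rewrite !row_len0.
apply: eq_rows => [||i]; try exact: bounded_row.
have := shift_imset (m * t) (boxset (val l)) (c, (Ordinal an, i)).
by rewrite -e !in_boxset /=.
Qed.

Lemma nth_rotr1 (T : Type) (x0 : T) (s : seq T) i : (i < size s)%N ->
  nth x0 (rotr 1 s) (i.+1 %% size s) = nth x0 s i.
Proof.
case/lastP: s => // s x; rewrite rotr1_rcons size_rcons ltnS leq_eqVlt => /orP[/eqP ->|lt].
  by rewrite modnn /= nth_rcons ltnn eqxx.
by rewrite modn_small // /= nth_rcons lt.
Qed.

Lemma nth_iter_rotr (T : Type) (x0 : T) (s : seq T) k i : (i < size s)%N ->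
  nth x0 (iter k (rotr 1) s) ((i + k) %% size s) = nth x0 s i.
Proof.
move=> lt; have sz j : size (iter j (rotr 1) s) = size s.
  by elim: j => //= j IH; rewrite size_rotr.
have s0 : (0 < size s)%N by apply: leq_ltn_trans lt.
elim: k => [|k IH]; first by rewrite addn0 modn_small.
have lt' : ((i + k) %% size s < size (iter k (rotr 1) s))%N by rewrite sz ltn_mod.
have := nth_rotr1 x0 lt'; rewrite IH sz => <-.
by congr nth; rewrite addnS -[((_ %% _).+1)%N]addn1 modnDml addn1.
Qed.

Lemma iter_rotr_fix q (l : multi r q) (t : nat) :
  iter t (iter m (rotr 1)) (val (val l)) = val (val l) <-> rotated p l l t.
Proof.
have e : iter t (iter m (rotr 1)) (val (val l)) = iter (m * t) (rotr 1) (val (val l)).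
  by elim: t => [|t IH]; rewrite ?muln0 //= IH mulnS iterD.
have sz : size (val (val l)) = r by rewrite size_tuple.
have szi j : size (iter j (rotr 1) (val (val l))) = r.
  by elim: j => //= j IH; rewrite size_rotr.
rewrite e rotated_nth; split=> [h c|h].
  by have := @nth_iter_rotr _ young0 (val (val l)) (m * t) c; rewrite sz h => ->.
apply: (@eq_from_nth _ young0) => [|i]; rewrite szi // => ir.
pose c := Ordinal ir; pose c' := ord_add c (r - (m * t) %% r).
have ec : ord_add c' (m * t) = c.
  rewrite ord_addD addnC -ord_addD; exact: ord_addK.
have := @nth_iter_rotr _ young0 (val (val l)) (m * t) c'; rewrite sz => /(_ (ltn_ord c')).
rewrite -[((c' + _) %% r)%N]/(val (ord_add c' (m * t))) ec => e1.
by have e2 := h c'; rewrite ec in e2; exact: etrans e1 (esym e2).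
Qed.

End Necklace.
End Dictionary.

(** * The recursive index sets in terms of shapes *)

Section OmegaSide.
Variables (K : numClosedFieldType) (r p n' : nat).
Local Notation n := n'.+1.
Local Notation m := (r %/ p)%N.
Local Notation box := (box r n).
Local Notation stab := (stab r n).
Local Notation bset := (@boxset r n').
Local Notation Om := (@Omega K r p n).
Hypotheses (r_gt0 : (0 < r)%N) (r_eq : r = (p * m)%N).
Implicit Types (l : multi r n) (delta : @character K r n).

Lemma necklace_classP q (l l' : multi r q) : necklace_class p l = necklace_class p l' <->
  exists t, rotated p l l' t.
Proof.
split=> [h|h]; first by have /eqmodP/asboolP := h.
by apply/eqmodP/asboolP.
Qed.

Lemma colored_classP q (mu mu' : multi r q) (c c' : 'I_m * 'I_p) :
  colored_class mu c = colored_class mu' c' <->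
  exists t, [/\ rotated p mu mu' t, c.1 = c'.1 & c'.2 = (c.2 + t) %% p :> nat]%N.
Proof.
split=> [h|h]; first by have /eqmodP/asboolP := h.
by apply/eqmodP/asboolP.
Qed.

Lemma necklace_classK (w : necklace r p n) : exists l, w = necklace_class p l.
Proof. by exists (generic_quotient.repr w); rewrite /necklace_class reprK. Qed.

Definition chi t : @character K r n := fun g => (delta0 g ^+ m) ^+ t.

Lemma delta0_expr g : @delta0 K r n g ^+ r = 1.
Proof.
rewrite /delta0; have [d [s [dnz dr ->]]] := Gr1n_decomp (valP g).
by rewrite prod_nonzero_diag_perm // -prodrXl big1 // => i _.
Qed.

Lemma chi_mod t : chi (t %% p) = chi t.
Proof.
apply/funext=> g; rewrite /chi {2}(divn_eq t p) exprD [(t %/ p * p)%N]mulnC exprM -(exprM _ m p).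
by rewrite [(m * p)%N]mulnC -r_eq delta0_expr expr1n mul1r.
Qed.

Lemma stabilizerP l delta : @stabilizer K r p n l delta <->
  exists2 t, delta = chi t & rotated p l l t.
Proof. by split=> -[t e /(iter_rotr_fix r_eq) h]; exists t. Qed.

(** Rotations commute with each other, so all representatives of a necklace have the same
    stabilizer. *)
Lemma rotated_conj q (l l' : multi r q) (t u : nat) : rotated p l l' u ->
  rotated p l l t -> rotated p l' l' t.
Proof.
move=> lu lt i j im jp; have p0 : (0 < p)%N by apply: leq_ltn_trans jp.
have h := rotatedN lu; rewrite h // lt ?ltn_mod // lu ?ltn_mod //.
rewrite modnDml -addnA modnDml; congr (node _ l' _ _).
have -> : (j + u * p.-1 + (t + u) = u * p + (j + t))%N.
  by rewrite -[in RHS](prednK p0) mulnS; lia.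
by rewrite modnMDl.
Qed.

Lemma rotated_bset l l' t : rotated p l l' t <-> bset (val l') = shift (m * t) @: bset (val l).
Proof. exact: rotatedP. Qed.

Lemma Omega_stabilizer k l delta : Om k (necklace_class p l, delta) ->
  stabilizer p l delta.
Proof.
case: k => [|k] /=.
  case=> l0 _ [_ ->]; apply/stabilizerP; exists 0%N; last exact: rotated0.
  by apply/funext.
case=> mu [c [nu [delta' [_ _ /stabilizerP[t et ht] [e ->]]]]].
apply/stabilizerP; exists t => //; have [u hu] := (necklace_classP _ _).1 (esym e).
exact: rotated_conj hu ht.
Qed.

Lemma start_row l : [seq val y | y <- val l] = [:: n] :: nseq r.-1 [::] ->
  forall x, (x \in bset (val l)) = (x.1 == 0%N :> nat) && (x.2.1 == 0%N :> nat).
Proof.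
move=> e x; have row c a : row_len (nth young0 (val l) c) a = if c is 0 then nth 0%N [:: n] a else 0%N.
  have := congr1 (fun s => nth [::] s c) e; have [cr|cr] := ltnP c r; last first.
    rewrite [nth young0 _ _]nth_default ?size_tuple // /row_len nth_nil.
    by case: c cr => // cr; have := r_gt0; rewrite ltnNge cr.
  rewrite (nth_map young0) ?size_tuple // /row_len => ->; case: c {cr} => //= c.
  by rewrite nth_nseq; case: ifP; rewrite nth_nil.
rewrite in_boxset row; case: x => [[[|c] hc] [[[|a] ha] b]] //=.
  by rewrite ltn_ord.
by rewrite nth_nil.
Qed.

(** After at least one step the recursion admits every character of the stabilizer. At the start
    only the trivial character occurs, and the stabilizer is trivial because a single component is
    nonempty. *)
Lemma Omega_stab_closed k l delta delta' : Om k (necklace_class p l, delta) ->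
  stabilizer p l delta' -> Om k (necklace_class p l, delta').
Proof.
case: k => [|k] /=.
  case=> l0 e0 [el _] /stabilizerP[t -> ht]; exists l0 => //; rewrite el; congr (_, _).
  have [u hu] := (necklace_classP _ _).1 el.
  have /rotated_bset ht0 := rotated_conj hu ht.
  (* The top left corner of the only nonempty component: a rotation that fixes the shape must return
     it to component 0, so p divides [t] and the character is trivial. *)
  pose x : box := (Ordinal r_gt0, (ord0, ord0)).
  have xl : x \in bset (val l0) by rewrite (start_row e0).
  have : shift (m * t) x \in bset (val l0) by rewrite ht0 shift_imset.
  rewrite (start_row e0) /= add0n andbT => rt.
  rewrite -[RHS]/(fun=> 1) -(chi_mod t); apply/funext=> g.
  have mt0 : (m * (t %% p) = 0)%N.
    by rewrite muln_modr [(m * p)%N]mulnC -r_eq; exact/eqP.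
  have mgt : (0 < m)%N by have := r_gt0; rewrite [X in (0 < X)%N]r_eq muln_gt0 => /andP[].
  by move/eqP: mt0; rewrite muln_eq0 eqn0Ngt mgt => /eqP ->.
case=> mu [c [nu [delta'' [S a st [e _]]]]] /stabilizerP[t et ht].
exists mu, c, nu, delta'; split=> //; last by rewrite e.
apply/stabilizerP; exists t => //; have [u hu] := (necklace_classP _ _).1 e.
exact: rotated_conj hu ht.
Qed.

(** The shapes over the necklaces of level [k], for any character and any choice of representative;
    hence closed under rotation by multiples of m. *)
Definition Lam k (E : {set box}) : Prop :=
  exists l delta, bset (val l) = E /\ Om k (necklace_class p l, delta).

Lemma Lam_step k (D : {set box}) x y : addable D x -> addable D y ->
  y.1 = ord_add x.1 1 -> #|D| = n' -> Lam k (x |: D) -> Lam k.+1 (y |: D).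
Proof.
move=> /and3P[xD idD _] /and3P[yD _ idyD] yx cD [l [delta [el Ol]]].
have [mu emu] := boxset_surj idD cD (leqnSn n').
have cyD : #|y |: D| = n by rewrite cardsU1 yD cD.
have [nu enu] := boxset_surj idyD cyD (leqnn n).
exists nu, (chi 0); split=> //=; exists mu, (coord_of r_eq x.1), nu, (chi 0); split=> //.
- exists l, delta, mu, (coord_of r_eq x.1); split=> //.
  apply/delete_boxP/(add_boxP r_eq); exists x; rewrite emu coord_ofK; split=> //.
- by apply/(add_boxP r_eq); exists y; rewrite emu (comp_next r_eq) coord_ofK; split.
apply/stabilizerP; exists 0%N => //; exact: rotated0.
Qed.

Lemma half_intro k (D : {set box}) x : addable D x -> #|D| = n' -> Lam k (x |: D) ->
  exists (mu : multi r n') (c : 'I_m * 'I_p), [/\ bset (val mu) = D, x.1 = comp_of r_eq c &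
    @Omega_half K r p n k (colored_class mu c)].
Proof.
move=> /and3P[xD idD _] cD [l [delta [el Ol]]].
have [mu emu] := boxset_surj idD cD (leqnSn n').
exists mu, (coord_of r_eq x.1); split=> //; first by rewrite coord_ofK.
exists l, delta, mu, (coord_of r_eq x.1); split=> //.
by apply/delete_boxP/(add_boxP r_eq); exists x; rewrite emu coord_ofK; split.
Qed.

Lemma half_elim k (w : colored_necklace r p n') : @Omega_half K r p n k w ->
  exists (mu : multi r n') (c : 'I_m * 'I_p) x, [/\ w = colored_class mu c,
    addable (bset (val mu)) x, x.1 = comp_of r_eq c & Lam k (x |: bset (val mu))].
Proof.
case=> l [delta [mu [c [Ol ch ->]]]].
have [x [xD xc el]] := (add_boxP r_eq mu l c).1 ((delete_boxP l mu c).1 ch).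
exists mu, c, x; split=> //; last by exists l, delta.
by rewrite /addable xD boxset_ideal -el boxset_ideal.
Qed.

Lemma colored_bset (mu mu' : multi r n') (c c' : 'I_m * 'I_p) :
  colored_class mu c = colored_class mu' c' -> exists t,
  bset (val mu') = shift (m * t) @: bset (val mu) /\
  comp_of r_eq c' = ord_add (comp_of r_eq c) (m * t).
Proof.
case/colored_classP=> t [h e1 e2]; exists t; split.
  by apply/rotatedP => //; exact: leqnSn.
apply/val_inj; rewrite /= -node_shift ?ltn_ord // e2.
by rewrite -[X in (_ + X)%N]/(val c'.1) -e1.
Qed.

Lemma bset_colored (mu mu' : multi r n') (c c' : 'I_m * 'I_p) t :
  bset (val mu') = shift (m * t) @: bset (val mu) ->
  comp_of r_eq c' = ord_add (comp_of r_eq c) (m * t) ->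
  colored_class mu c = colored_class mu' c'.
Proof.
move=> e ec; apply/colored_classP; exists t.
have [e1 e2] : (val c'.1 = val c.1) /\ (val c'.2 = (c.2 + t) %% p)%N.
  have := congr1 val ec; rewrite /= -node_shift ?ltn_ord // => h.
  by move/eqP: h; rewrite eq_addl_mul ?ltn_ord // => /eqP[-> ->].
split=> //; last exact/esym/val_inj.
by apply/rotatedP => //; exact: leqnSn.
Qed.

Local Notation pow := (fun k => (fun g : 'M[K]_n => g ^t k)).

(** The first tensor power is defined as [g] itself and not as [g] tensored with a 1 by 1 identity,
    so the step from 0 to 1 needs a cast; the later steps agree by conversion. *)
Lemma tens_pow0 (g : 'M[K]_n) :
  castmx (muln1 n, muln1 n) (tens (pow 0) g) = g ^t 1.
Proof.
rewrite /tens -[g ^t 0]/(1%:M) tens_mx_scalar castmx_comp castmx_id scale1r //.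
Qed.

Lemma summand_pow k (E : {set box}) : summand m (tens (pow k)) E -> summand m (pow k.+1) E.
Proof.
case: k => [|k] //.
have cast q q' (e : q = q') (tau : 'M[K]_n -> 'M[K]_q) :
    summand m tau E -> summand m (fun g => castmx (e, e) (tau g)) E.
  case: q' / e; have -> // : (fun g => castmx (erefl q, erefl q) (tau g)) = tau.
  by apply/funext=> g; rewrite castmx_id.
move=> /(cast _ _ (muln1 n)).
by have -> : (fun g => castmx (muln1 n, muln1 n) (tens (pow 0) g)) = pow 1
  by apply/funext=> g; rewrite tens_pow0.
Qed.

Lemma spanned_pow k (L : {set box} -> Prop) :
  spanned m (tens (pow k)) L -> spanned m (pow k.+1) L.
Proof.
case: k => [|k] //.
have cast q q' (e : q = q') (tau : 'M[K]_n -> 'M[K]_q) :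
    spanned m tau L -> spanned m (fun g => castmx (e, e) (tau g)) L.
  case: q' / e; have -> // : (fun g => castmx (erefl q, erefl q) (tau g)) = tau.
  by apply/funext=> g; rewrite castmx_id.
move=> /(cast _ _ (muln1 n)).
by have -> : (fun g => castmx (muln1 n, muln1 n) (tens (pow 0) g)) = pow 1
  by apply/funext=> g; rewrite tens_pow0.
Qed.

(** The tensor power of exponent 0 is the trivial module. Its counterpart in X is the line of the
    only standard tableau of shape ((n), empty, ..., empty), all of whose axial coefficients at
    consecutive steps are 1. *)
Definition row_box (i : 'I_n) : box := (Ordinal r_gt0, (ord0, i)).

Definition row_tab : tab r n := [ffun i => row_box i].

Lemma row_tab_std : std row_tab.
Proof.
apply/stdP; split=> [i j|i [c [a b]]]; first by rewrite !ffunE => -[].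
rewrite ffunE => /and3P[/= /eqP -> a0 bi]; exists b => //; rewrite ffunE.
by congr (_, (_, _)); apply/val_inj/eqP; rewrite /= eq_sym -leqn0.
Qed.

Definition row_stab : stab := exist _ row_tab row_tab_std.

Lemma row_tab_uniq (T : stab) : (forall i, (val T i).1 = 0%N :> nat /\
  (val T i).2.1 = 0%N :> nat) -> T = row_stab.
Proof.
move=> h; apply/val_inj/ffunP=> i; rewrite ffunE.
suff hc (k : nat) (kn : (k < n)%N) : (val T (Ordinal kn)).2.2 = k :> nat.
  have [h1 h2] := h i; have := hc i (ltn_ord i); rewrite (_ : Ordinal _ = i); last exact/val_inj.
  case: (val T i) h1 h2 => c [a b] /= h1 h2 h3.
  by congr (_, (_, _)); apply/val_inj.
elim: k kn => [|k IH] kn.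
  have [_ h2] := h (Ordinal kn).
  have := @ct_first K r n T (Ordinal kn) erefl; rewrite /ct h2 subr0 => /eqP.
  by rewrite pnatr_eq0 => /eqP.
have kn' : (k < n)%N by apply: ltnW.
have [c1 r1] := h (Ordinal kn'); have [c2 r2] := h (Ordinal kn).
have b : below (val T (Ordinal kn')) (val T (Ordinal kn)).
  apply/negPn/negP=> nb; have := sw_std (erefl : val (Ordinal kn) = (Ordinal kn').+1) (valP T) nb.
  have b' : below (val T (Ordinal kn)) (val T (Ordinal kn')).
    move: nb; rewrite /below r1 r2 leqnn (_ : _ == _) ?andTb; last first.
      by rewrite -val_eqE /= c1 c2.
    by rewrite -ltnNge (_ : (_ == _) = true) => [/ltnW|]; rewrite // -val_eqE /= c1 c2.
  by have := std_below (valP T) b'; rewrite /= ltnn.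
have := below_adj (valP T) (erefl : val (Ordinal kn) = (Ordinal kn').+1) b.
by rewrite r1 r2 andbF orbF IH andbT => /eqP.
Qed.

Lemma row_Ym_fixed (i i' : 'I_n) : i' = i.+1 :> nat ->
  coaxial K (row_tab i) (row_tab i') = 0 /\ axial K (row_tab i) (row_tab i') = 1.
Proof.
move=> ii'; rewrite !ffunE /coaxial.
have a1 : axial K (row_box i) (row_box i') = 1.
  by rewrite /axial eqxx /ct /= ii' !subr0 -natr1 addrAC subrr add0r invr1.
by rewrite a1 expr1n subrr sqrtC0.
Qed.

Definition row_set : {set box} := initial n row_tab.

Lemma mem_row_set x : (x \in row_set) = (x.1 == 0%N :> nat) && (x.2.1 == 0%N :> nat).
Proof.
apply/initialP/idP=> [[i _ <-]|]; first by rewrite ffunE.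
case: x => c [a b] /andP[/= /eqP c0 /eqP a0]; exists b => //; rewrite ffunE.
by congr (_, (_, _)); apply/val_inj.
Qed.

Lemma shape_sel_row : shape_sel K row_set =
  delta_mx (enum_rank row_stab) (enum_rank row_stab).
Proof.
apply: ent_inj => T U; rewrite ent_dgf /ent mxE !(inj_eq enum_rank_inj) -natrM mulnb.
congr (_%:R); congr nat_of_bool; have [eT|neT] := eqVneq T row_stab.
  by rewrite eT eqxx /= eq_sym.
rewrite [_ == row_set](_ : _ = false) //; apply/negP=> /eqP e; case/eqP: neT.
apply: row_tab_uniq => i; have : val T i \in row_set by rewrite -e mem_initial.
by rewrite mem_row_set => /andP[/eqP-> /eqP->].
Qed.

Definition row_vec : 'M[K]_(1, #|stab|) := delta_mx 0 (enum_rank row_stab).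

Lemma row_vec_Ym (i i' : 'I_n) : i' = i.+1 :> nat -> row_vec *m Ym K r i i' = row_vec.
Proof.
move=> ii'; rewrite /row_vec -rowE; apply/rowP=> j; rewrite mxE -(enum_valK j).
rewrite -[LHS]/(ent (Ym K r i i') row_stab (enum_val j)) ent_mxf.
have [-> ->] := row_Ym_fixed ii'; rewrite mul0r addr0 mul1r mxE eqxx /=.
by rewrite (inj_eq enum_rank_inj) eq_sym.
Qed.

Lemma row_vec_Dm (d : 'I_n -> K) : row_vec *m Dm r d = row_vec.
Proof.
rewrite /row_vec -rowE; apply/rowP=> j; rewrite mxE -(enum_valK j).
rewrite -[LHS]/(ent (Dm r d) row_stab (enum_val j)) ent_dgf mxE eqxx /=.
rewrite (inj_eq enum_rank_inj) eq_sym [weight _ _](_ : _ = 1) ?mul1r //.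
by rewrite /weight big1 // => i _; rewrite ffunE.
Qed.

Lemma row_vec_tr_Ym (i i' : 'I_n) : i' = i.+1 :> nat ->
  Ym K r i i' *m row_vec^T = row_vec^T.
Proof. by move=> ii'; rewrite -[in RHS](row_vec_Ym ii') trmx_mul Ym_tr. Qed.

Lemma row_vec_tr_Dm (d : 'I_n -> K) : Dm r d *m row_vec^T = row_vec^T.
Proof. by rewrite -[in RHS](row_vec_Dm d) trmx_mul Dm_tr. Qed.

Lemma row_intertwines h : intertwines m h (pow 0) row_vec.
Proof.
by split=> *; rewrite -[_ ^t 0]/(1%:M) mul1mx ?row_vec_Ym ?row_vec_Dm.
Qed.

Lemma row_cointertwines h : cointertwines m h (pow 0) row_vec^T.
Proof.
by split=> *; rewrite -[_ ^t 0]/(1%:M) mulmx1 ?row_vec_tr_Ym ?row_vec_tr_Dm.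
Qed.

Lemma row_vec_mul : row_vec^T *m row_vec = shape_sel K row_set.
Proof. by rewrite shape_sel_row /row_vec trmx_delta mul_delta_mx. Qed.

Lemma Lam0 E : Lam 0 E -> exists t, E = shift (m * t) @: row_set.
Proof.
case=> l [delta [<- /= [l0 e0 [el _]]]]; have [t /rotatedN /rotated_bset ht] := (necklace_classP _ _).1 el.
exists (t * p.-1)%N; have -> // : row_set = bset (val l0).
by apply/setP=> x; rewrite (start_row e0) mem_row_set.
Qed.

Lemma row_set_Lam : Lam 0 row_set.
Proof.
have y0 : is_young [::] by [].
have yn : is_young [:: n] by [].
pose t : r.-tuple young := [tuple (if i == 0%N :> nat then exist _ [:: n] yn else young0) | i < r].
have vt : [seq val y | y <- t] = [:: n] :: nseq r.-1 [::].
  apply: (@eq_from_nth _ [::]) => [|i]; rewrite size_map size_tuple /=.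
    by rewrite size_nseq prednK.
  move=> ir; rewrite (nth_map young0) ?size_tuple ?card_ord //.
  have -> : nth young0 t i = (if i == 0%N then exist _ [:: n] yn else young0).
    by have := tnth_nth young0 t (Ordinal ir); rewrite tnth_mktuple /= => <-.
  by case: i ir => //= i ir; rewrite nth_nseq if_same.
have bt : (\sum_(y <- t) boxes y == n)%N.
  rewrite (eq_bigr (fun y : young => sumn (val y))) // -(big_map val xpredT sumn) vt.
  by rewrite big_cons /= addn0 big_nseq iter_addn_0 mul0n addn0.
pose l : multi r n := exist _ t bt.
exists l, (fun=> 1); split; last by exists l.
by apply/setP=> x; rewrite (start_row (l := l) vt) mem_row_set.
Qed.

Variable zeta : K.
Hypothesis zeta_prim : r.-primitive_root zeta.

(** Membership in the recursive sets is known only for classes, so the representatives met at the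
    two half-steps differ by rotations. [summand_rot] absorbs these, and [summand_tens] performs the
    step itself. *)
Lemma summand_Lam k E : Lam k E -> summand m (pow k) E.
Proof.
elim: k E => [|k IH] E.
  move=> /Lam0[t ->]; apply: summand_rot; exists row_vec, row_vec^T; split.
  - exact: row_intertwines.
  - exact: row_cointertwines.
  - exact: row_vec_mul.
case=> l [delta [<- /= [mu [c [nu [delta' [S a _ [el _]]]]]]]].
have [mu0 [c0 [x [ec adx xc L]]]] := half_elim S.
have [t [emu ecc]] := colored_bset (esym ec).
have [y [yD yc enu]] := (add_boxP r_eq _ _ _).1 a.
have [u /rotatedN/rotated_bset ->] := (necklace_classP _ _).1 el.
apply: summand_rot; rewrite enu; apply: summand_pow.
have sx : shift (m * t) @: (x |: bset (val mu0)) = shift (m * t) x |: bset (val mu).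
  by rewrite imsetU1 -emu.
have idx : ideal (shift (m * t) x |: bset (val mu)).
  rewrite -sx; apply/idealP=> z w /imsetP[z' z'D ->].
  rewrite -(shiftKr (m * t) w) below_shift => bw; apply/imset_f.
  have /and3P[_ _ /idealP idE] := adx; exact: idE bw.
apply: (@summand_tens K r m n' zeta zeta_prim _ _ (bset (val mu)) (shift (m * t) x) y).
- rewrite /addable idx boxset_ideal emu mem_imset; last exact: shift_inj.
  by have /and3P[-> _ _] := adx.
- by rewrite /addable yD boxset_ideal -enu boxset_ideal.
- by rewrite yc (comp_next r_eq) /= xc ecc.
- by rewrite card_multi.
by rewrite -sx; apply: summand_rot; exact: IH.
Qed.

Lemma spanned_Lam k : spanned m (pow k) (Lam k).
Proof.
elim: k => [|k IH].
  apply: sum_of_gen; exists row_set, row_vec, row_vec^T; split.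
  - exact: row_set_Lam.
  - exact: row_intertwines.
  - exact: row_cointertwines.
  rewrite shape_sel_row /row_vec trmx_delta !mul_delta_mx; apply/matrixP=> i j.
  by rewrite !mxE !ord1.
apply: spanned_pow; apply: (spanned_tens _ IH) => D x y adx ady yx cD.
exact: Lam_step adx ady yx cD.
Qed.

End OmegaSide.

(** * The irreducible constituents *)

Lemma geometric_root_sum (K : fieldType) (z : K) u : z ^+ u = 1 -> z != 1 ->
  \sum_(b < u) z ^+ b = 0.
Proof.
move=> zu z1; apply: (mulfI (_ : z - 1 != 0)); first by rewrite subr_eq0.
by rewrite mulr0 -subrX1 zu subrr.
Qed.

Lemma sum_cyclic (V : zmodType) (F : nat -> V) u : F u = F 0 ->
  \sum_(b < u) F b.+1 = \sum_(b < u) F b.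
Proof.
move=> Fu; apply: (addrI (F 0)); transitivity (\sum_(b < u.+1) F b).
  by rewrite big_ord_recl.
by rewrite big_ord_recr /= Fu addrC.
Qed.

Section Isotypic.
Variables (K : numClosedFieldType) (r p n' : nat).
Local Notation n := n'.+1.
Local Notation m := (r %/ p)%N.
Local Notation box := (box r n).
Local Notation stab := (stab r n).
Local Notation N := #|stab|.
Local Notation sel := (@shape_sel K r n').
Local Notation rotm := (rotm K r n).
Hypotheses (r_gt0 : (0 < r)%N) (r_eq : r = (p * m)%N).
Variable zeta : K.
Hypothesis zeta_prim : r.-primitive_root zeta.

Let p_gt0 : (0 < p)%N.
Proof. by have := r_gt0; rewrite r_eq muln_gt0 => /andP[]. Qed.

Let m_gt0 : (0 < m)%N.
Proof. by have := r_gt0; rewrite [X in (0 < X)%N]r_eq muln_gt0 => /andP[]. Qed.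

Section Period.
Variable D : {set box}.

Lemma shift_imsetD s t (E : {set box}) : shift t @: (shift s @: E) = shift (s + t) @: E.
Proof.
rewrite -imset_comp; apply: eq_imset => x; exact: shiftD.
Qed.

Lemma shift_imset_mod s (E : {set box}) : shift (s %% r) @: E = shift s @: E.
Proof. by apply: eq_imset => x; exact: shift_mod. Qed.

Lemma shift_imset0 (E : {set box}) : shift 0 @: E = E.
Proof. by rewrite -[RHS]imset_id; apply: eq_imset => x; exact: shift0. Qed.

Definition fixes a : bool := shift (m * a) @: D == D.

Lemma fixes_p : fixes p.
Proof. by rewrite /fixes mulnC -r_eq -shift_imset_mod modnn shift_imset0. Qed.

Fact period_ex : exists g, (0 < g)%N && fixes g.
Proof. by exists p; rewrite p_gt0 fixes_p. Qed.

Definition period := ex_minn period_ex.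

Lemma period_gt0 : (0 < period)%N.
Proof. by rewrite /period; case: ex_minnP => g /andP[]. Qed.

Lemma fixesD a b : fixes a -> fixes (a + b) = fixes b.
Proof. by move=> /eqP fa; rewrite /fixes mulnDr -shift_imsetD fa. Qed.

Lemma fixesP a : fixes a = (period %| a)%N.
Proof.
have fg : fixes period by rewrite /period; case: ex_minnP => g /andP[].
have red q b : fixes (q * period + b) = fixes b.
  by elim: q => [|q IH] //; rewrite mulSn -addnA fixesD.
rewrite {1}(divn_eq a period) red /dvdn; apply/idP/eqP=> [fb|->]; last first.
  by rewrite /fixes muln0 shift_imset0.
apply/eqP; rewrite -leqn0 leqNgt; apply/negP=> b0.
have := ltn_pmod a period_gt0; rewrite ltnNge => /negP; apply.
by rewrite {1}/period; case: ex_minnP => g _; apply; rewrite b0.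
Qed.

Definition stab_order : nat := (p %/ period)%N.

Lemma stab_orderE : (stab_order * period)%N = p.
Proof. by apply: divnK; rewrite -fixesP fixes_p. Qed.

Lemma stab_order_gt0 : (0 < stab_order)%N.
Proof. by have := p_gt0; rewrite -{1}stab_orderE muln_gt0 => /andP[]. Qed.

Definition omega : K := zeta ^+ (m * period).

Lemma omega_prim : stab_order.-primitive_root omega.
Proof.
have e : (r = stab_order * (m * period))%N.
  by rewrite [LHS]r_eq -[X in (X * m)%N]stab_orderE -mulnA [(period * m)%N]mulnC.
have := dvdn_prim_root zeta_prim (_ : (stab_order %| r)%N).
rewrite [X in (_ ^+ (X %/ _)%N)]e mulKn ?stab_order_gt0 //; apply.
by rewrite [X in (_ %| X)%N]e dvdn_mulr.
Qed.

Definition rotsel b : 'M[K]_N := rotm (m * period * b) *m sel D.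

(* The projector on the eigenspace of the rotation by one period, with eigenvalue
   [omega ^+ s], in the span of the tableaux of shape [D]. *)
Definition isotypic s : 'M[K]_N :=
  stab_order%:R^-1 *: \sum_(b < stab_order) (omega ^+ s) ^- b *: rotsel b.

Lemma period_fix b : shift (m * period * b) @: D = D.
Proof. by apply/eqP; rewrite -mulnA -/(fixes _) fixesP dvdn_mulr. Qed.

Lemma sel_rotm b : sel D *m rotm (m * period * b) = rotm (m * period * b) *m sel D.
Proof. by rewrite rotm_sel period_fix. Qed.

Lemma shape_sel_commutes h E : commutes m h (sel E).
Proof.
split=> [i i' ii' _|d _]; first exact: shape_sel_Ym.
apply/commute_dgf => T U; rewrite ent_dgf; case: (T =P U) => [->|_] //.
by rewrite mulr0 eqxx.
Qed.

Lemma rotsel_commutes h b : commutes m h (rotsel b).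
Proof.
by apply: commutesM; [rewrite -mulnA; exact: rotm_commutes|exact: shape_sel_commutes].
Qed.

Lemma commutes_sum h (I : Type) (s : seq I) (P : pred I) (F : I -> 'M[K]_N) :
  (forall i, P i -> commutes m h (F i)) -> commutes m h (\sum_(i <- s | P i) F i).
Proof.
move=> hF; split=> *; rewrite mulmx_suml mulmx_sumr; apply: eq_bigr => i /hF[h1 h2];
  by rewrite (h1, h2).
Qed.

Lemma commutesZ h c (X : 'M[K]_N) : commutes m h X -> commutes m h (c *: X).
Proof. by move=> [h1 h2]; split=> *; rewrite -scalemxAl -scalemxAr (h1, h2). Qed.

Lemma isotypic_commutes h s : commutes m h (isotypic s).
Proof.
by apply/commutesZ/commutes_sum => b _; apply: commutesZ; exact: rotsel_commutes.
Qed.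

Lemma rotselS b : rotm (m * period) *m rotsel b = rotsel b.+1.
Proof. by rewrite /rotsel mulmxA rotmD mulnSr. Qed.

Lemma rotsel0 : rotsel 0 = sel D.
Proof. by rewrite /rotsel muln0 rotm0 mul1mx. Qed.

Lemma rotsel_order : rotsel stab_order = sel D.
Proof.
rewrite /rotsel -mulnA [(period * _)%N]mulnC stab_orderE mulnC -r_eq.
by rewrite -rotm_mod modnn rotm0 mul1mx.
Qed.

Lemma sel_rotsel b : sel D *m rotsel b = rotsel b.
Proof. by rewrite /rotsel mulmxA sel_rotm -mulmxA shape_sel_id. Qed.

Lemma sel_isotypic s : sel D *m isotypic s = isotypic s.
Proof.
rewrite /isotypic -scalemxAr mulmx_sumr; congr (_ *: _); apply: eq_bigr => b _.
by rewrite -scalemxAr sel_rotsel.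
Qed.

Lemma isotypic_sel s : isotypic s *m sel D = isotypic s.
Proof.
rewrite /isotypic -scalemxAl mulmx_suml; congr (_ *: _); apply: eq_bigr => b _.
by rewrite -scalemxAl /rotsel -mulmxA shape_sel_id.
Qed.

Lemma omega_neq0 : omega != 0.
Proof.
apply: expf_neq0; apply/eqP=> z0; have := prim_expr_order zeta_prim.
by rewrite z0 expr0n gtn_eqF // => /eqP; rewrite eq_sym oner_eq0.
Qed.

Lemma omega_order : omega ^+ stab_order = 1.
Proof. exact: prim_expr_order omega_prim. Qed.

Lemma rotm_isotypic s : rotm (m * period) *m isotypic s = omega ^+ s *: isotypic s.
Proof.
rewrite /isotypic -scalemxAr [RHS]scalerA [X in _ = X *: _]mulrC -[RHS]scalerA; congr (_ *: _).
have os : omega ^+ s != 0 by rewrite expf_neq0 // omega_neq0.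
pose F b := (omega ^+ s) ^- b *: rotsel b.
rewrite mulmx_sumr scaler_sumr.
transitivity (\sum_(b < stab_order) omega ^+ s *: F b.+1).
  apply: eq_bigr => b _; rewrite /F -scalemxAr rotselS scalerA; congr (_ *: _).
  by rewrite exprS invfM mulrA mulfV // mul1r.
apply: (@sum_cyclic _ (fun b => omega ^+ s *: F b)).
by rewrite /F rotsel_order rotsel0 exprAC omega_order expr1n expr0.
Qed.

Lemma rotsel_isotypic s b : rotsel b *m isotypic s = (omega ^+ s) ^+ b *: isotypic s.
Proof.
rewrite /rotsel -mulmxA sel_isotypic; elim: b => [|b IH].
  by rewrite muln0 rotm0 mul1mx expr0 scale1r.
rewrite mulnSr -rotmD -mulmxA IH -scalemxAr rotm_isotypic scalerA exprSr //.
Qed.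

Lemma isotypic_mul s s' : isotypic s' *m isotypic s =
  (stab_order%:R^-1 * \sum_(b < stab_order) (omega ^+ s / omega ^+ s') ^+ b) *: isotypic s.
Proof.
rewrite {1}/isotypic -scalemxAl mulmx_suml -scalerA scaler_suml; congr (_ *: _).
apply: eq_bigr => b _; rewrite -scalemxAl rotsel_isotypic scalerA; congr (_ *: _).
by rewrite mulrC exprMn exprVn.
Qed.

Lemma stab_order_neq0 : (stab_order%:R : K) != 0.
Proof. by rewrite pnatr_eq0 -lt0n stab_order_gt0. Qed.

Lemma isotypic_idem s : isotypic s *m isotypic s = isotypic s.
Proof.
have os : omega ^+ s != 0 by rewrite expf_neq0 // omega_neq0.
rewrite isotypic_mul mulfV //.
under eq_bigr do rewrite expr1n.
by rewrite sumr_const card_ord mulVf ?stab_order_neq0 // scale1r.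
Qed.

Lemma isotypic_orth s s' : isotypic s' *m isotypic s != 0 -> s = s' %[mod stab_order].
Proof.
rewrite isotypic_mul => nz; apply/eqP; rewrite -(eq_prim_root_expr omega_prim).
apply: contraNT nz => ne; rewrite geometric_root_sum ?mulr0 ?scale0r //.
  by rewrite expr_div_n (exprAC omega s) (exprAC omega s') omega_order !expr1n divr1.
apply: contra ne => /eqP e; rewrite -[X in _ == X]mul1r -e divfK //.
by rewrite expf_neq0 // omega_neq0.
Qed.

Lemma isotypic_mod s : isotypic (s %% stab_order) = isotypic s.
Proof. by rewrite /isotypic expr_mod // omega_order. Qed.

Lemma sum_isotypic : \sum_(s < stab_order) isotypic s = sel D.
Proof.
rewrite -scaler_sumr exchange_big /= (bigD1 (Ordinal stab_order_gt0)) //=.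
rewrite [X in _ + X]big1 => [|b nb].
  under eq_bigr do rewrite expr0 invr1 scale1r.
  rewrite addr0 sumr_const card_ord rotsel0 -scaler_nat scalerA mulVf ?scale1r //.
  exact: stab_order_neq0.
rewrite -scaler_suml; under eq_bigr do rewrite exprAC -exprVn.
rewrite geometric_root_sum ?scale0r //.
  by rewrite exprVn exprAC omega_order expr1n invr1.
rewrite invr_eq1 -(expr0 omega) (eq_prim_root_expr omega_prim) mod0n modn_small //.
Qed.

(** A rotation may fix a shape but no tableau, unless it is trivial, because it moves the component
    of the first box. *)
Lemma rot_fix_eq0 (T : stab) a : shs (m * a) T = T -> (p %| a)%N.
Proof.
move=> e; have := congr1 (fun V : stab => val (val V ord0).1) e.
rewrite /= ffunE /= => h; have {}h : ((val T ord0).1 + m * a = (val T ord0).1 + 0 %[mod r])%N.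
  by rewrite h addn0 modn_small.
move/eqP: h; rewrite eqn_modDl mod0n => h.
by rewrite -(dvdn_pmul2l m_gt0) [(m * p)%N]mulnC -r_eq.
Qed.

Lemma isotypic_neq0 s (T : stab) : initial n (val T) = D -> isotypic s != 0.
Proof.
move=> eT; apply/eqP=> e0; have := congr1 (fun A => ent A T T) e0.
rewrite ent0 entZ ent_sum (bigD1 (Ordinal stab_order_gt0)) //= big1 => [|b nb].
  rewrite addr0 entZ rotsel0 ent_dgf eT !eqxx expr0 invr1 !mulr1 => /eqP.
  by rewrite invr_eq0 (negPf stab_order_neq0).
rewrite entZ /rotsel ent_mul_dgf ent_mxf.
case: eqP => [/esym e|]; last by rewrite mul0r mulr0.
case/eqP: nb; apply/val_inj => /=; move: e; rewrite -mulnA => /rot_fix_eq0.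
rewrite -[X in (X %| _)%N]stab_orderE [(_ * period)%N]mulnC dvdn_pmul2l ?period_gt0 //.
by move=> /dvdnP[q hq]; have := ltn_ord b; rewrite hq; case: q hq => // q _; rewrite mulSn; lia.
Qed.

(** A nonzero entry relates a tableau to a rotation of itself, and the rotation must fix the shape.
    The entry depends on the rotation only, so it may be read off at one tableau [T0]. *)
Lemma commutant_shape Y : commutes m n Y -> sel D *m Y *m sel D = Y ->
  exists c : nat -> K, Y = \sum_(b < stab_order) c b *: rotsel b.
Proof.
move=> cY eY; have zero T U : initial n (val T) != D \/ initial n (val U) != D -> ent Y T U = 0.
  by rewrite -eY ent_mul_dgf ent_dgf_mul => -[/negPf -> | /negPf ->];
    rewrite ?mul0r ?mulr0.
have [T0 /eqP eT0|none] := pickP [pred T : stab | initial n (val T) == D]; last first.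
  exists (fun=> 0); rewrite big1 => [|b _]; last by rewrite scale0r.
  apply: ent_inj => T U; rewrite ent0 zero //; left.
  by apply/negP=> h; have := none T; rewrite /= h.
exists (fun b => ent Y (shs (m * period * b) T0) T0).
apply: ent_inj => T U; rewrite ent_sum.
have [eU|nU] := eqVneq (initial n (val U)) D; last first.
  rewrite zero ?big1 //; last by right.
  by move=> b _; rewrite entZ /rotsel ent_mul_dgf (negPf nU) !mulr0.
have const b : ent Y (shs (m * period * b) T0) T0 = ent Y (shs (m * period * b) U) U.
  rewrite -mulnA; apply: (ent_partner r_eq zeta_prim (leqnn n) cY (a := (period * b)%N)).
  - by move=> i _; rewrite ffunE.
  - by move=> i _; rewrite ffunE.
  - by move=> i; rewrite leqNgt ltn_ord.
  - by move=> i; rewrite leqNgt ltn_ord.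
  - by rewrite eU eT0.
transitivity (\sum_(b < stab_order) ent Y T U * (T == shs (m * period * b) U)%:R); last first.
  apply: eq_bigr => b _; rewrite entZ const /rotsel ent_mul_dgf ent_mxf eU eqxx mulr1.
  by case: eqP => [->|_]; rewrite ?mulr1 ?mulr0.
rewrite -mulr_sumr; have [->|nz] := eqVneq (ent Y T U) 0; first by rewrite mul0r.
have [a [_ ha]] := support_partner r_eq zeta_prim (leqnn n) cY nz.
have eT : T = shs (m * a) U by apply/val_inj/ffunP=> i; rewrite ffunE ha.
have fa : fixes a.
  have : initial n (val T) == D by apply: contraNT nz => h; rewrite zero ?eqxx //; left.
  by rewrite eT /= initial_shift eU.
(* Since [a] fixes the shape it is a multiple of the period, and the number of periods only matters
   modulo the order of the stabilizer. *)
pose b := ((a %/ period) %% stab_order)%N; have bu : (b < stab_order)%N.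
  by rewrite ltn_mod stab_order_gt0.
have eb : shs (m * period * b) U = T.
  rewrite eT -shs_mod -[RHS]shs_mod; congr shs.
  have -> : (m * a = m * period * (a %/ period))%N.
    by rewrite -mulnA [(period * _)%N]mulnC divnK // -fixesP.
  have er : r = (m * period * stab_order)%N.
    by rewrite -mulnA [(period * _)%N]mulnC stab_orderE mulnC -r_eq.
  have h : (m * period * b = m * period * (a %/ period) %[mod m * period * stab_order])%N.
    by rewrite -!muln_modr modn_mod.
  by rewrite -er in h.
transitivity (ent Y T U * 1); first by rewrite mulr1.
congr (_ * _); rewrite (bigD1 (Ordinal bu)) //= eb eqxx big1 ?addr0 // => b' nb.
case: eqP => // e; case/eqP: nb; apply/val_inj => /=.
have : shs (m * (period * b')) U = shs (m * (period * b)) U by rewrite !mulnA eb.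
move=> e'; have := congr1 (fun V : stab => val (val V ord0).1) e'.
rewrite /= !ffunE /= => /eqP; rewrite eqn_modDl => /eqP.
have er : r = (m * (period * stab_order))%N.
  by rewrite [(period * _)%N]mulnC stab_orderE mulnC -r_eq.
rewrite [X in (_ %% X = _ %% X)%N]er -!muln_modr => /eqP.
by rewrite eqn_pmul2l // eqn_pmul2l ?period_gt0 // !modn_small // => /eqP.
Qed.

End Period.

Lemma period_shift (D : {set box}) a : period (shift (m * a) @: D) = period D.
Proof.
have fx b : fixes (shift (m * a) @: D) b = fixes D b.
  rewrite /fixes shift_imsetD addnC -shift_imsetD (inj_eq (imset_inj (@shift_inj _ _ _))) //.
apply/eqP; rewrite /period; do 2 case: ex_minnP; move=> g /andP[g0 gD] gm g' /andP[g0' gD'] gm'.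
by rewrite eqn_leq gm ?gm' // ?g0 ?g0' -?fx // fx.
Qed.

Lemma rotm_isotypic_shift (D : {set box}) a s :
  rotm (m * a) *m isotypic D s = isotypic (shift (m * a) @: D) s *m rotm (m * a).
Proof.
rewrite /isotypic /stab_order /omega /rotsel period_shift -scalemxAr -scalemxAl; congr (_ *: _).
rewrite mulmx_sumr mulmx_suml; apply: eq_bigr => b _.
rewrite -scalemxAr -scalemxAl; congr (_ *: _).
transitivity (rotm (m * period D * b) *m (rotm (m * a) *m sel D)); last first.
  by rewrite rotm_sel mulmxA.
rewrite (mulmxA (rotm _) _ (sel D)) (mulmxA (rotm _) (rotm _) (sel D)); congr (_ *m _).
by rewrite !rotmD addnC.
Qed.

(** Undoing the rotation that relates the two shapes turns the map into an element [Y] of the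
    commutant supported on [D]. Such an element is a combination of rotations, which act on the
    isotypic projector by scalars, so [Y] is a nonzero multiple of that projector. *)
Lemma isotypic_hom (D D' : {set box}) s s' Z : commutes m n Z ->
  isotypic D' s' *m Z *m isotypic D s != 0 -> exists a,
  [/\ D' = shift (m * a) @: D, s = s' %[mod stab_order D] &
      exists2 Z', commutes m n Z' &
      Z' *m (isotypic D' s' *m Z *m isotypic D s) = isotypic D s].
Proof.
move=> cZ; set X := _ *m _ *m _ => nz.
have cX : commutes m n X.
  by apply: commutesM; [apply: commutesM => //|]; exact: isotypic_commutes.
have Xl : isotypic D' s' *m X = X by rewrite /X !mulmxA isotypic_idem.
have Xr : X *m isotypic D s = X by rewrite /X -!mulmxA isotypic_idem.
have [T [U nzTU]] : exists T U, ent X T U != 0.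
  apply: contrapT => no; case/eqP: nz; apply: ent_inj => T U; rewrite ent0.
  by apply/eqP/negPn/negP=> h; apply: no; exists T, U.
have [a [_ ha]] := support_partner r_eq zeta_prim (leqnn n) cX nzTU.
have eT : initial n (val T) = D'.
  apply/eqP; apply: contraNT nzTU => h.
  by rewrite -Xl -(sel_isotypic D') -mulmxA ent_dgf_mul (negPf h) mul0r.
have eU : initial n (val U) = D.
  apply/eqP; apply: contraNT nzTU => h.
  by rewrite -Xr -(isotypic_sel D) mulmxA ent_mul_dgf (negPf h) mulr0.
have eD : D' = shift (m * a) @: D.
  rewrite -eT -eU -initial_shift; congr initial; apply/ffunP=> i.
  by rewrite ffunE ha.
pose Ri := rotm (r - (m * a) %% r).
have RR : rotm (m * a) *m Ri = 1%:M by exact: rotmKr.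
have RiR : Ri *m rotm (m * a) = 1%:M by exact: rotmK.
have cRi : commutes m n Ri := commutes_inv RR (@rotm_commutes K r n m a n).
pose Y := Ri *m X; have XE : X = rotm (m * a) *m Y by rewrite /Y mulmxA RR mul1mx.
have Yl : isotypic D s' *m Y = Y.
  have := rotm_isotypic_shift D a s'; rewrite -eD => h.
  have {}h : isotypic D s' *m Ri = Ri *m isotypic D' s'.
    rewrite -[LHS]mul1mx -RiR -mulmxA (mulmxA (rotm (m * a)) _ Ri) h.
    by rewrite -(mulmxA (isotypic D' s')) RR mulmx1.
  by rewrite /Y mulmxA h -mulmxA Xl.
have Yr : Y *m isotypic D s = Y by rewrite /Y -mulmxA Xr.
have cY : commutes m n Y by exact: commutesM.
have [c eY] : exists c : nat -> K, Y = \sum_(b < stab_order D) c b *: rotsel D b.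
  apply: commutant_shape => //.
  have -> : sel D *m Y = Y by rewrite -Yl (mulmxA (sel D)) sel_isotypic.
  by rewrite -Yr -(mulmxA Y) isotypic_sel.
have [z eYz] : exists z, Y = z *: isotypic D s.
  exists (\sum_(b < stab_order D) c b * (omega D ^+ s) ^+ b).
  rewrite -[LHS]Yr eY mulmx_suml scaler_suml; apply: eq_bigr => b _.
  by rewrite -scalemxAl rotsel_isotypic scalerA.
have z0 : z != 0.
  by apply: contra nz => /eqP z0; rewrite XE eYz z0 scale0r mulmx0.
exists a; split=> //.
  apply: isotypic_orth; apply/eqP=> h; case/eqP: z0.
  have : Y = 0 by rewrite -Yl eYz -scalemxAr h scaler0.
  move=> Y0; move/eqP: nz; rewrite XE Y0 mulmx0 //.
exists (z^-1 *: Ri); first exact: commutesZ.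
by rewrite -scalemxAl -/Y eYz scalerA mulVf // scale1r.
Qed.

End Isotypic.

Lemma sum_of_trans (V : nmodType) (P Q : V -> Prop) v :
  (forall x, P x -> sum_of Q x) -> sum_of P v -> sum_of Q v.
Proof. by move=> h [s [hs ->]]; apply: sum_of_sum => x xs _; apply/h/hs. Qed.

(** * Constituents for G(r,p,n) *)

Section GroupSpec.
Variables (K : numClosedFieldType) (r p n' : nat).
Local Notation n := n'.+1.
Local Notation m := (r %/ p)%N.
Local Notation box := (box r n).
Local Notation stab := (stab r n).
Local Notation N := #|stab|.
Local Notation bset := (@boxset r n').
Local Notation sel := (@shape_sel K r n').
Hypotheses (r_gt0 : (0 < r)%N) (r_eq : r = (p * m)%N).
Variable zeta : K.
Hypothesis zeta_prim : r.-primitive_root zeta.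
Local Notation period := (period (n' := n') r_gt0 r_eq).
Local Notation stab_order := (stab_order (n' := n') r_gt0 r_eq).
Local Notation isotypic := (isotypic r_gt0 r_eq zeta).
Local Notation chi := (@chi K r p n').

Lemma shape_exists (D : {set box}) : ideal D -> #|D| = n ->
  exists T : stab, initial n (val T) = D.
Proof.
move=> idD cD; have [s [us ms hs]] := std_ex idD.
have sz : size s = n by rewrite -(card_uniqP us) (eq_card ms).
have [x0 _] : exists x0, x0 \in D by apply/set0Pn; rewrite -card_gt0 cD.
pose T : tab r n := [ffun i : 'I_n => nth x0 s i].
have stdT : std T.
  apply/stdP; split=> [i j|i z]; rewrite !ffunE.
    by move/eqP; rewrite nth_uniq ?sz ?ltn_ord // => /eqP/val_inj.
  have hi : (i < size s)%N by rewrite sz.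
  move=> /(hs x0 i z hi)[k ki <-].
  have kn : (k < n)%N by rewrite (leq_ltn_trans ki).
  by exists (Ordinal kn); rewrite ?ffunE.
exists (exist _ T stdT); apply/setP=> x; apply/initialP/idP=> [[i _ <-]|xD] /=.
  by rewrite ffunE -ms mem_nth ?sz.
have xs : x \in s by rewrite ms.
have xn : (index x s < n)%N by have := index_mem x s; rewrite xs sz.
by exists (Ordinal xn); rewrite // ffunE nth_index.
Qed.

(** The characters are told apart by the matrix diag(zeta, 1, ..., 1), on which [chi t] takes the
    value zeta^(m t). *)
Lemma chi_inj t t' : chi t = chi t' -> t = t' %[mod p].
Proof.
have m_gt0 : (0 < m)%N by have := r_gt0; rewrite [X in (0 < X)%N]r_eq muln_gt0 => /andP[].
pose d (i : 'I_n) : K := if i == ord0 then zeta else 1.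
have dr i : d i ^+ r = 1.
  by rewrite /d; case: eqP => _; rewrite ?expr1n // (prim_expr_order zeta_prim).
have dnz i : d i != 0.
  apply/eqP=> d0; have := dr i; rewrite d0 expr0n gtn_eqF // => /eqP.
  by rewrite eq_sym oner_eq0.
pose g : {g : 'M[K]_n | Gr1n r g} :=
  exist (fun g => is_true (Gr1n r g)) _ (diag_perm_Gr1n 1%g r_gt0 dr).
move=> e; have := congr1 (fun c : @character K r n => c g) e.
rewrite /chi /delta0 /= prod_nonzero_diag_perm // (bigD1 ord0) //= big1 => [|i ni].
  rewrite mulr1 -!exprM => /eqP; rewrite (eq_prim_root_expr zeta_prim).
  rewrite [X in _ == _ %[mod X]]r_eq [(p * _)%N]mulnC -!muln_modr.
  by rewrite eqn_pmul2l // => /eqP.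
by rewrite /d (negPf ni).
Qed.

Lemma chi_period (D : {set box}) s s' :
  chi (period D * s) = chi (period D * s') <-> s = s' %[mod stab_order D].
Proof.
have e := stab_orderE r_gt0 r_eq D; have g0 := period_gt0 r_gt0 r_eq D.
split=> [/chi_inj|h].
  rewrite -[X in _ = _ %[mod X]]e [(_ * period D)%N]mulnC -!muln_modr => /eqP.
  by rewrite eqn_pmul2l // => /eqP.
have {}h : (period D * s = period D * s' %[mod period D * stab_order D])%N.
  by rewrite -!muln_modr h.
rewrite [X in _ = _ %[mod X]]mulnC e in h.
by rewrite -(chi_mod K n' r_eq (period D * s)) h chi_mod.
Qed.

(** The stabilizer of a shape consists of the [chi (period * s)], and s modulo the stabilizer order
    is also the label of the eigenspace. This matches characters with isotypic projectors. *)
Definition group_spec (w : necklace r p n * @character K r n) (f : 'M[K]_N) : Prop :=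
  exists (l : multi r n) s,
    w = (necklace_class p l, chi (period (bset (val l)) * s)) /\
    f = isotypic (bset (val l)) s.

Lemma group_spec_idem w f : group_spec w f ->
  [/\ commutes m n f, f *m f = f & f != 0].
Proof.
case=> l [s [_ ->]]; split; [exact: isotypic_commutes|exact: isotypic_idem|].
have [T eT] := shape_exists (@boxset_ideal r n' (val l)) (card_multi l (leqnn n)).
exact: isotypic_neq0 eT.
Qed.

Lemma group_spec_hom w w' f f' Z : group_spec w f -> group_spec w' f' -> commutes m n Z ->
  f' *m Z *m f != 0 -> w = w' /\
  exists2 Z', commutes m n Z' & Z' *m (f' *m Z *m f) = f.
Proof.
case=> l [s [-> ->]] [l' [s' [-> ->]]] cZ nz.
have [a [el es hZ]] := isotypic_hom zeta_prim cZ nz; split=> //.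
congr (_, _).
  by apply/necklace_classP; exists a; apply/(rotated_bset r_eq).
by rewrite el period_shift; apply/chi_period.
Qed.

Lemma group_spec_iso w f f' : group_spec w f -> group_spec w f' ->
  exists Z Z', [/\ commutes m n Z, commutes m n Z' & f' = Z *m f *m Z'].
Proof.
case=> l [s [-> ->]] [l' [s' [[]]]].
case/necklace_classP=> a /(rotated_bset r_eq) ->; rewrite period_shift.
move=> /chi_period es ->.
exists (rotm K r n (m * a)), (rotm K r n (r - (m * a) %% r)); split.
- exact: rotm_commutes.
- exact: commutes_inv (rotmKr K r n _) (@rotm_commutes K r n m a n).
rewrite rotm_isotypic_shift -(mulmxA (isotypic _ _)) rotmKr mulmx1.
by rewrite -isotypic_mod // -[RHS]isotypic_mod // /stab_order period_shift es.
Qed.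

Lemma group_spec_summand k w : @Omega K r p n k w -> exists f U Q,
  [/\ group_spec w f, intertwines m n (fun g : 'M[K]_n => g ^t k) U,
      cointertwines m n (fun g : 'M[K]_n => g ^t k) Q & Q *m U = f].
Proof.
case: w => c delta; have [l ->] := necklace_classK c => Ow.
have [t et /(rotated_bset r_eq) ht] := (stabilizerP r_eq _ _).1 (Omega_stabilizer r_gt0 r_eq Ow).
have : (period (bset (val l)) %| t)%N by rewrite -fixesP /fixes -ht.
case/dvdnP=> s es.
have [U [Q [iU iQ QU]]] : summand m (fun g : 'M[K]_n => g ^t k) (bset (val l)).
  by apply: (summand_Lam r_gt0 r_eq zeta_prim); exists l, delta.
exists (isotypic (bset (val l)) s), (U *m isotypic (bset (val l)) s), Q; split=> //.
- by exists l, s; rewrite et es mulnC.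
- by apply: intertwines_mul iU _; exact: isotypic_commutes.
by rewrite (mulmxA Q) QU sel_isotypic.
Qed.

Lemma group_spec_span k : sum_of (fun B : 'M[K]_(n ^ k) => exists w f U Q,
  [/\ @Omega K r p n k w, group_spec w f, intertwines m n (fun g : 'M[K]_n => g ^t k) U,
      cointertwines m n (fun g : 'M[K]_n => g ^t k) Q & B = U *m f *m Q]) 1%:M.
Proof.
have S := spanned_Lam K n' r_gt0 r_eq k; rewrite /spanned in S.
apply: (sum_of_trans _ S) => _ [E [U [Q [[l [delta [<- Ol]]] iU iQ ->]]]].
rewrite -(sum_isotypic r_gt0 r_eq zeta_prim) mulmx_sumr mulmx_suml.
apply: sum_of_sum => s _ _; apply: sum_of_gen.
exists (necklace_class p l, chi (period (bset (val l)) * s)), (isotypic (bset (val l)) s), U, Q.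
split=> //; last by exists l, s.
apply: (Omega_stab_closed r_gt0 r_eq Ol); apply/(stabilizerP r_eq).
exists (period (bset (val l)) * s)%N => //; apply/(rotated_bset r_eq).
by rewrite mulnA period_fix.
Qed.

Lemma centralizer_Grpn_indexed k :
  irreducibles_indexed_by (centralizer (@Grpn K n r p) k) (@Omega K r p n k).
Proof.
apply: (indexed_by_spec (leqnn n) _ _ _ group_spec_idem group_spec_hom group_spec_iso
  (@group_spec_summand k) (group_spec_span k)).
- by move=> *; apply: Grpn_perm.
- by move=> d; apply: Grpn_diag.
- by move=> g; apply: Grpn_decomp.
Qed.

End GroupSpec.

(** * Constituents for L(r,p,n) *)

Section LastSpec.
Variables (K : numClosedFieldType) (r p n' : nat).
Local Notation n := n'.+1.
Local Notation m := (r %/ p)%N.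
Local Notation box := (box r n).
Local Notation stab := (stab r n).
Local Notation N := #|stab|.
Local Notation bset := (@boxset r n').
Local Notation rotm := (rotm K r n).
Local Notation exchange := (exchange K).
Local Notation last_sel := (last_sel K).
Hypotheses (r_gt0 : (0 < r)%N) (r_eq : r = (p * m)%N).
Variable zeta : K.
Hypothesis zeta_prim : r.-primitive_root zeta.
Implicit Types (D : {set box}) (x y : box).

Lemma addable_shift s D x : addable (shift s @: D) (shift s x) = addable D x.
Proof.
have idS (E : {set box}) : ideal (shift s @: E) = ideal E.
  apply/idealP/idealP=> h u v.
    move=> uE vu; rewrite -(shift_imset s); apply: (h (shift s u)).
      by rewrite shift_imset.
    by rewrite below_shift.
  rewrite -[u](shiftKr s) -[v](shiftKr s) !shift_imset below_shift; exact: h.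
by rewrite /addable shift_imset -imsetU1 !idS.
Qed.

Lemma rotm_last_sel s D x :
  rotm s *m last_sel D x = last_sel (shift s @: D) (shift s x) *m rotm s.
Proof.
apply: ent_inj => T U; rewrite -[T](shsKr s); move: (shs _ T) => {}T.
rewrite ent_rotm_mul ent_mul_rotm !ent_dgf (inj_eq (can_inj (shsK s))) /=.
rewrite initial_shift ffunE (inj_eq (@shift_inj _ _ s)).
by rewrite (inj_eq (imset_inj (@shift_inj _ _ s))).
Qed.

(** Boxes of one component carry equal weights, so replacing the last box by another one there
    commutes with L(r,p,n). The resulting modules are isomorphic, which is why only the component of
    the last box is recorded. *)
Lemma exchange_commutes D x y : addable D x -> addable D y -> x.1 = y.1 ->
  commutes m n' (exchange D x y).
Proof.
move=> adx ady exy; split=> [i i' ii' i'n|d [dr _]]; first exact: exchange_Ym.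
have d0 : d ord_max ^+ y.1 != 0.
  rewrite expf_neq0 //; apply/eqP=> d0; have := dr ord_max.
  by rewrite d0 expr0n gtn_eqF // => /eqP; rewrite eq_sym oner_eq0.
apply: (scalerI d0); have := exchange_Dm x d ady; rewrite exy; exact.
Qed.

Lemma conj_absorb q (A C E F : 'M[K]_q) : E *m A = A *m F -> F *m C = C ->
  E *m (A *m C) = A *m C.
Proof. by move=> EA FC; rewrite mulmxA EA -mulmxA FC. Qed.

Lemma absorb_conj q (A B E F : 'M[K]_q) : B *m E = F *m B -> A *m F = A ->
  A *m B *m E = A *m B.
Proof. by move=> BE AF; rewrite -mulmxA BE mulmxA AF. Qed.

Lemma mulmx_inner_inv q (A B C E : 'M[K]_q) : B *m C = 1%:M ->
  (A *m B) *m (C *m E) = A *m E.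
Proof. by move=> BC; rewrite mulmxA -(mulmxA A) BC mulmx1. Qed.

Lemma conj_inv q (R S E F : 'M[K]_q) : R *m S = 1%:M -> R *m E = F *m R ->
  E *m S = S *m F.
Proof.
move=> RS RE; have SR := mulmx1C RS.
by rewrite -[LHS]mul1mx -SR -(mulmxA S) (mulmxA R) RE -(mulmxA _ R) RS mulmx1.
Qed.

Lemma last_sel_commutes D x : addable D x -> commutes m n' (last_sel D x).
Proof. by move=> adx; rewrite -exchange_id; exact: exchange_commutes. Qed.

Lemma last_sel_idem D x : addable D x -> last_sel D x *m last_sel D x = last_sel D x.
Proof. by move=> adx; rewrite -exchange_id exchange_mul. Qed.

Lemma last_sel_support D x D' x' (X : 'M[K]_N) (T U : stab) :
  last_sel D' x' *m X = X -> X *m last_sel D x = X -> ent X T U != 0 ->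
  [/\ initial n' (val T) = D', val T ord_max = x', initial n' (val U) = D &
      val U ord_max = x].
Proof.
move=> Xl Xr nz.
have /andP[/eqP e1 /eqP e2] : (initial n' (val T) == D') && (val T ord_max == x').
  by apply: contraNT nz => h; rewrite -Xl ent_dgf_mul (negPf h) mul0r.
have /andP[/eqP e3 /eqP e4] : (initial n' (val U) == D) && (val U ord_max == x).
  by apply: contraNT nz => h; rewrite -Xr ent_mul_dgf (negPf h) mulr0.
by split.
Qed.

(** Here the stabilizer disappears: support relates a tableau to a rotation of itself, and a fixed
    component of the last box forces that rotation to be trivial. *)
Lemma schur_last D x (Y : 'M[K]_N) : commutes m n' Y ->
  last_sel D x *m Y = Y -> Y *m last_sel D x = Y -> exists z, Y = z *: last_sel D x.
Proof.
move=> cY Yl Yr.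
have diag (T U : stab) : ent Y T U != 0 -> T = U.
  move=> nz; have [eT lT eU lU] := last_sel_support Yl Yr nz.
  have [a [ha hs]] := support_partner r_eq zeta_prim (leqnSn n') cY nz.
  have /eqP a0 : (m * a == 0 %[mod r])%N.
    by rewrite -(eq_ord_add x.1) ord_add0 -{1}lU -ha lT.
  apply/val_inj/ffunP=> i; have [->|ne] := eqVneq i ord_max; first by rewrite lT lU.
  rewrite hs; last by rewrite ltn_neqAle -ltnS ltn_ord andbT.
  by rewrite -shift_mod a0 mod0n shift0.
pose P (T : stab) := (initial n' (val T) == D) && (val T ord_max == x).
have [T0 /andP[/eqP eT0 /eqP lT0]|none] := pickP P; last first.
  exists 0; rewrite scale0r -Yr; apply: ent_inj => T U.
  by rewrite ent_mul_dgf -/(P U) none mulr0 ent0.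
exists (ent Y T0 T0); apply: ent_inj => T U; rewrite entZ ent_dgf.
have [<-|ne] := eqVneq T U; last first.
  rewrite !mulr0; have [//|/diag e] := eqVneq (ent Y T U) 0.
  by rewrite e eqxx in ne.
rewrite mulr1 -/(P T); have [/andP[/eqP eT /eqP lT]|nP] := boolP (P T); last first.
  by rewrite -Yr ent_mul_dgf -/(P T) (negPf nP) !mulr0.
have last_or (i : 'I_n) : (n' <= i)%N -> i = ord_max.
  by move=> h; apply/val_inj/eqP; rewrite /= eqn_leq h -ltnS ltn_ord.
rewrite mulr1; apply: (ent_partner r_eq zeta_prim (leqnSn n') cY (a := 0)).
- by move=> i _; rewrite muln0 shift0.
- by move=> i _; rewrite muln0 shift0.
- by move=> i /last_or ->; rewrite lT0 lT.
- by move=> i /last_or ->; rewrite lT0 lT.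
by rewrite eT0 eT.
Qed.

(** The index [w] sees the last box [x] only through its component, so several idempotents belong to
    one [w]; they are linked by [last_spec_iso]. *)
Definition last_spec (w : colored_necklace r p n') (f : 'M[K]_N) : Prop :=
  exists (mu : multi r n') c x, [/\ w = colored_class mu c, addable (bset (val mu)) x,
    x.1 = comp_of r_eq c & f = last_sel (bset (val mu)) x].

Lemma last_spec_idem w f : last_spec w f -> [/\ commutes m n' f, f *m f = f & f != 0].
Proof.
case=> mu [c [x [_ adx _ ->]]]; split; [exact: last_sel_commutes|exact: last_sel_idem|].
have := trace_last_sel_neq0 K adx (card_multi mu (leqnSn n')).
by apply: contraNneq => ->; rewrite mxtrace0.
Qed.

(** A nonzero map fixes a rotation [a] between the two shapes of n - 1 boxes. Then [V] first
    exchanges the last box for the rotated [x] and afterwards rotates back, which leaves an element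
    supported on [D] and [x], a scalar by [schur_last]. *)
Lemma last_spec_hom w w' f f' Z : last_spec w f -> last_spec w' f' -> commutes m n' Z ->
  f' *m Z *m f != 0 -> w = w' /\
  exists2 Z', commutes m n' Z' & Z' *m (f' *m Z *m f) = f.
Proof.
case=> mu [c [x [-> adx xc ->]]] [mu' [c' [x' [-> adx' xc' ->]]]] cZ.
set D := bset _ in adx *; set D' := bset _ in adx' *; set X := _ *m _ *m _ => nz.
have cX : commutes m n' X :=
  commutesM (commutesM (last_sel_commutes adx') cZ) (last_sel_commutes adx).
have Xl : last_sel D' x' *m X = X by rewrite /X !mulmxA last_sel_idem.
have Xr : X *m last_sel D x = X by rewrite /X -!mulmxA last_sel_idem.
have [T [U nzTU]] : exists T U, ent X T U != 0.
  apply: contrapT => no; case/eqP: nz; apply: ent_inj => T U; rewrite ent0.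
  by apply/eqP/negPn/negP=> h; apply: no; exists T, U.
have [eT lT eU lU] := last_sel_support Xl Xr nzTU.
have [a [ha hs]] := support_partner r_eq zeta_prim (leqnSn n') cX nzTU.
have eD : D' = shift (m * a) @: D.
  rewrite -eT -eU -initial_shift; apply/setP=> z.
  by apply/initialP/initialP=> -[i ih <-]; exists i => //; rewrite ffunE hs.
pose y := shift (m * a) x.
have ady : addable D' y by rewrite eD addable_shift.
have yx' : y.1 = x'.1 by rewrite /= -lT ha lU.
split; first by apply: (@bset_colored r p n' r_eq) eD _; rewrite -xc -xc'.
pose R := rotm (m * a); pose Ri := rotm (r - (m * a) %% r).
have RR : R *m Ri = 1%:M by exact: rotmKr.
have RiR : Ri *m R = 1%:M by exact: rotmK.
have cRi : commutes m n' Ri := commutes_inv RR (@rotm_commutes K r n m a n').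
pose V := Ri *m exchange D' y x'.
have cV : commutes m n' V := commutesM cRi (exchange_commutes ady adx' yx').
have Rf : last_sel D x *m Ri = Ri *m last_sel D' y.
  by apply: (conj_inv RR); rewrite rotm_last_sel -eD.
have cY : commutes m n' (V *m X) := commutesM cV cX.
have fV : last_sel D x *m V = V.
  have fe : last_sel D' y *m exchange D' y x' = exchange D' y x'.
    by rewrite -exchange_id exchange_mul.
  exact: conj_absorb Rf fe.
have eV : exchange D' x' y *m R *m V = last_sel D' x'.
  by rewrite (mulmx_inner_inv _ _ RR) exchange_mul // exchange_id.
clearbody V; move: (X) cX Xl Xr nz cY => Y _ Yl Yr nz cY.
have VYl : last_sel D x *m (V *m Y) = V *m Y by rewrite mulmxA fV.
have VYr : V *m Y *m last_sel D x = V *m Y by rewrite -mulmxA Yr.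
have [z ez] := schur_last cY VYl VYr.
have z0 : z != 0.
  apply: contra nz => /eqP z0; by rewrite -Yl -eV -mulmxA ez z0 scale0r mulmx0.
exists (z^-1 *: V); first exact: commutesZ.
by rewrite -scalemxAl ez scalerA mulVf // scale1r.
Qed.

Lemma last_spec_iso w f f' : last_spec w f -> last_spec w f' ->
  exists Z Z', [/\ commutes m n' Z, commutes m n' Z' & f' = Z *m f *m Z'].
Proof.
case=> mu [c [x [-> adx xc ->]]] [mu' [c' [x' [/(colored_bset r_eq)[t [eD ec]] adx' xc' ->]]]].
set D := bset _ in adx eD *; set D' := bset _ in adx' eD *.
pose y := shift (m * t) x.
have ady : addable D' y by rewrite eD addable_shift.
have yx' : y.1 = x'.1 by rewrite xc' ec -xc.
pose R := rotm (m * t); pose Ri := rotm (r - (m * t) %% r).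
have RR : R *m Ri = 1%:M by exact: rotmKr.
have cR : commutes m n' R by exact: rotm_commutes.
exists (exchange D' x' y *m R), (Ri *m exchange D' y x'); split.
- exact: commutesM (exchange_commutes adx' ady (esym yx')) cR.
- exact: commutesM (commutes_inv RR cR) (exchange_commutes ady adx' yx').
have -> : exchange D' x' y *m R *m last_sel D x = exchange D' x' y *m R.
  apply: (absorb_conj (F := last_sel D' y)); first by rewrite rotm_last_sel -eD.
  by rewrite -exchange_id exchange_mul.
by rewrite (mulmx_inner_inv _ _ RR) exchange_mul // exchange_id.
Qed.

Lemma intertwines_le h h' q (tau : 'M[K]_n -> 'M[K]_q) U : (h <= h')%N ->
  intertwines (r := r) m h' tau U -> intertwines m h tau U.
Proof. by move=> hh [u1 u2]; split=> // i i' ii' i'h; apply: u1 => //; exact: leq_trans hh. Qed.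

Lemma cointertwines_le h h' q (tau : 'M[K]_n -> 'M[K]_q) Q : (h <= h')%N ->
  cointertwines (r := r) m h' tau Q -> cointertwines m h tau Q.
Proof. by move=> hh [u1 u2]; split=> // i i' ii' i'h; apply: u1 => //; exact: leq_trans hh. Qed.

Lemma last_spec_summand k w : @Omega_half K r p n k w -> exists f U Q,
  [/\ last_spec w f, intertwines m n' (fun g : 'M[K]_n => g ^t k) U,
      cointertwines m n' (fun g : 'M[K]_n => g ^t k) Q & Q *m U = f].
Proof.
case/(half_elim r_eq)=> mu [c [x [-> adx xc L]]].
have [U [Q [iU iQ QU]]] := summand_Lam r_gt0 r_eq zeta_prim L.
exists (last_sel (bset (val mu)) x), (U *m last_sel (bset (val mu)) x), Q; split.
- by exists mu, c, x.
- apply: intertwines_mul; last exact: last_sel_commutes.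
  exact: intertwines_le iU.
- exact: cointertwines_le iQ.
by rewrite (mulmxA Q) QU -exchange_id shape_sel_exchange.
Qed.

Lemma last_spec_span k : sum_of (fun B : 'M[K]_(n ^ k) => exists w f U Q,
  [/\ @Omega_half K r p n k w, last_spec w f, intertwines m n' (fun g : 'M[K]_n => g ^t k) U,
      cointertwines m n' (fun g : 'M[K]_n => g ^t k) Q & B = U *m f *m Q]) 1%:M.
Proof.
have S := spanned_Lam K n' r_gt0 r_eq k; rewrite /spanned in S.
apply: (sum_of_trans _ S) => _ [E [U [Q [L iU iQ ->]]]].
rewrite shape_selE mulmx_sumr mulmx_suml; apply: sum_of_sum => x _ xE.
have [[T [eT lT]]|no] := pselect (exists T : stab,
    initial n' (val T) = E :\ x /\ val T ord_max = x); last first.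
  rewrite last_sel_eq0 ?mulmx0 ?mul0mx; first exact: sum_of0.
  by move=> T e1 e2; apply: no; exists T.
have adx : addable (E :\ x) x by rewrite -eT -[X in addable _ X]lT; apply: std_addable (valP T).
have cE : #|E :\ x| = n' by rewrite -eT std_card //; exact: valP.
rewrite -(finset.setD1K xE) in L; have [mu [c [emu xc Oh]]] := half_intro r_eq adx cE L.
apply: sum_of_gen; exists (colored_class mu c), (last_sel (E :\ x) x), U, Q; split=> //.
- by exists mu, c, x; rewrite emu.
- exact: intertwines_le iU.
- exact: cointertwines_le iQ.
Qed.

Lemma centralizer_Lrpn_indexed k :
  irreducibles_indexed_by (centralizer (@Lrpn K n r p) k) (@Omega_half K r p n k).
Proof.
apply: (indexed_by_spec (leqnSn n') _ _ _ last_spec_idem last_spec_hom last_spec_iso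
  (@last_spec_summand k) (last_spec_span k)).
- by move=> *; apply: Lrpn_perm.
- by move=> d; apply: Lrpn_diag.
- by move=> g; apply: Lrpn_decomp.
Qed.

End LastSpec.

End NecklaceIndexing.

Theorem theorem6p4 (R : realType) (r p n k : nat)
    (r_ge2 : 2 <= r) (p_dvd_r : p %| r) (n_gt0 : 0 < n) :
  irreducibles_indexed_by (@centralizer R[i] n (@Grpn R[i] n r p) k)
    (@Omega R[i] r p n k) /\
  irreducibles_indexed_by (@centralizer R[i] n (@Lrpn R[i] n r p) k)
    (@Omega_half R[i] r p n k).
Proof.
have r_gt0 : 0 < r by apply: leq_trans r_ge2.
have r_eq : r = p * (r %/ p) by rewrite mulnC divnK.
have [zeta zeta_prim] := prim_root_exists R[i] r_gt0.
case: n n_gt0 => // n' _; split.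
  exact: centralizer_Grpn_indexed zeta_prim k.
exact: centralizer_Lrpn_indexed zeta_prim k.
Qed.
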